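(* Let $\mathcal C$ be an additive prestack with abelian stalks on a topological space $X$. Suppose that for every $p\in X$ and every morphism $f:A\to B$ in $\mathcal C_p$ there exists an open neighborhood $U$ of $p$ such that $f$ may be represented by a morphism $\tilde f:\tilde A\to\tilde B$ in $\mathcal C(U)$ and there are morphisms $K\to\tilde A$, $\tilde B\to K'$ in $\mathcal C(U)$ such that $K\to\tilde A$ is a kernel of $\tilde f$ in $\mathcal C_q$ and $\tilde B\to K'$ is a cokernel of $\tilde f$ in $\mathcal C_q$ for any $q\in U$. Then the associated stack $\mathcal C^\ddagger$ is an abelian stack.
   Context: A prestack $\mathcal C$ on $X$ assigns to each open $U\subset X$ a category $\mathcal C(U)$, to $V\subset U$ a restriction functor $A\mapsto A|_V$, and coherent natural isomorphisms for compositions of restrictions. It is additive if each $\mathcal C(U)$ is additive and restriction functors are additive; abelian if it is additive, each $\mathcal C(U)$ is abelian and restriction functors are exact. The stalk at $p$ is $\mathcal C_p=2\text{-}\varinjlim_{U\ni p}\mathcal C(U)$: objects are pairs $(U,A)$ with $p\in U$ open and $A\in\mathcal C(U)$, and $\mathrm{Hom}((U,A),(V,B))=\varinjlim_{p\in W\subset U\cap V}\mathrm{Hom}_{\mathcal C(W)}(A|_W,B|_W)$; for $p\in U$ there is a natural functor $\mathcal C(U)\to\mathcal C_p$, and the image of an object is denoted by the same letter. A stack is a prestack for which the presheaves $V\mapsto\mathrm{Hom}_{\mathcal C(V)}(A|_V,B|_V)$ are sheaves and descent data for open coverings are effective. $\mathcal C^\ddagger$ is the stack associated to $\mathcal C$,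 with functor $\mathcal C\to\mathcal C^\ddagger$ universal among functors from $\mathcal C$ to stacks; this functor induces equivalences on stalks. *)

(* Defs.v *)
From mathcomp Require Import all_boot generic_quotient.
From mathcomp Require Import boolp classical_sets topology.

Set Implicit Arguments.
Unset Strict Implicit.
Unset Printing Implicit Defensive.

Local Open Scope classical_set_scope.
Local Open Scope quotient_scope.

Declare Scope cat_scope.
Delimit Scope cat_scope with cat.
Local Open Scope cat_scope.

Reserved Notation "g ∘ f" (at level 40, left associativity).

Record category := Category {
  obj :> Type;
  hom : obj -> obj -> Type;
  idm : forall A, hom A A;
  compm : forall A B D, hom B D -> hom A B -> hom A D;
  comp1m : forall A B (f : hom A B), compm (idm B) f = f;
  compm1 : forall A B (f : hom A B), compm f (idm A) = f;
  compmA : forall A B D E (h : hom D E) (g : hom B D) (f : hom A B),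
    compm h (compm g f) = compm (compm h g) f }.

Arguments hom {c} A B.
Arguments idm {c} A.
Arguments compm {c A B D} g f.
Notation "g ∘ f" := (compm g f) : cat_scope.

Record iso (C : category) (A B : C) := Iso {
  fwd :> hom A B;
  bwd : hom B A;
  fwdK : bwd ∘ fwd = idm A;
  bwdK : fwd ∘ bwd = idm B }.

Record functor (C D : category) := Functor {
  fobj :> C -> D;
  fmor : forall A B, hom A B -> hom (fobj A) (fobj B);
  fmor1 : forall A, fmor (idm A) = idm (fobj A);
  fmorM : forall A B E (g : hom B E) (f : hom A B),
    fmor (g ∘ f) = fmor g ∘ fmor f }.

Arguments fmor {C D} F {A B} f : rename.

Section FunctorConstructions.
Variables C D E : category.

Program Definition iso_comp (A B A' : C) (j : iso B A') (i : iso A B) :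
  iso A A' := {| fwd := fwd j ∘ fwd i; bwd := bwd i ∘ bwd j |}.
Next Obligation. by move=> A B A' j i; rewrite compmA -(compmA _ (bwd j)) fwdK compm1 fwdK. Qed.
Next Obligation. by move=> A B A' j i; rewrite compmA -(compmA _ (fwd i)) bwdK compm1 bwdK. Qed.

Program Definition fmor_iso (F : functor C D) (A B : C) (i : iso A B) :
  iso (F A) (F B) := {| fwd := fmor F (fwd i); bwd := fmor F (bwd i) |}.
Next Obligation. by move=> *; rewrite -fmorM fwdK fmor1. Qed.
Next Obligation. by move=> *; rewrite -fmorM bwdK fmor1. Qed.

Program Definition functor_comp (G : functor D E) (F : functor C D) :
  functor C E :=
  {| fobj := fun A => G (F A); fmor := fun A B f => fmor G (fmor F f) |}.
Next Obligation. by move=> * /=; rewrite !fmor1. Qed.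
Next Obligation. by move=> * /=; rewrite !fmorM. Qed.

End FunctorConstructions.

Definition is_zero_obj (C : category) (Z : C) : Prop :=
  forall A : C, (exists! f : hom A Z, True) /\ (exists! f : hom Z A, True).

(* The zero morphisms of a category with a zero object; in an additive
   category they are the zeros of the groups of morphisms, so that kernels and
   cokernels do not depend on the choice of an additive structure. *)
Definition is_zero_mor (C : category) (A B : C) (f : hom A B) : Prop :=
  exists Z : C, is_zero_obj Z /\
    exists (a : hom A Z) (b : hom Z B), f = b ∘ a.

Definition is_kernel (C : category) (K A B : C) (k : hom K A) (f : hom A B) :
    Prop :=
  is_zero_mor (f ∘ k) /\
  forall (T : C) (g : hom T A), is_zero_mor (f ∘ g) ->
    exists! u : hom T K, k ∘ u = g.

Definition is_cokernel (C : category) (A B K : C) (f : hom A B) (c : hom B K) :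
    Prop :=
  is_zero_mor (c ∘ f) /\
  forall (T : C) (g : hom B T), is_zero_mor (g ∘ f) ->
    exists! u : hom K T, u ∘ c = g.

Definition is_mono (C : category) (A B : C) (f : hom A B) : Prop :=
  forall (T : C) (g h : hom T A), f ∘ g = f ∘ h -> g = h.

Definition is_epi (C : category) (A B : C) (f : hom A B) : Prop :=
  forall (T : C) (g h : hom B T), g ∘ f = h ∘ f -> g = h.

Record preadditive (C : category) := Preadditive {
  addm : forall A B : C, hom A B -> hom A B -> hom A B;
  zerom : forall A B : C, hom A B;
  oppm : forall A B : C, hom A B -> hom A B;
  addmA : forall A B : C, associative (@addm A B);
  addmC : forall A B : C, commutative (@addm A B);
  add0m : forall A B : C, left_id (zerom A B) (@addm A B);
  addNm : forall A B : C, left_inverse (zerom A B) (@oppm A B) (@addm A B);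
  compmDl : forall (A B D : C) (g h : hom B D) (f : hom A B),
    addm g h ∘ f = addm (g ∘ f) (h ∘ f);
  compmDr : forall (A B D : C) (h : hom B D) (f g : hom A B),
    h ∘ addm f g = addm (h ∘ f) (h ∘ g) }.

Arguments addm {C} p {A B} _ _.
Arguments zerom {C} p A B.
Arguments oppm {C} p {A B} _.

Definition is_biproduct (C : category) (ad : preadditive C) (A B P : C)
    (i : hom A P) (j : hom B P) (p : hom P A) (q : hom P B) : Prop :=
  [/\ p ∘ i = idm A, q ∘ j = idm B, q ∘ i = zerom ad A B, p ∘ j = zerom ad B A
    & addm ad (i ∘ p) (j ∘ q) = idm P].

Definition additive_structure (C : category) (ad : preadditive C) : Prop :=
  (exists Z : C, is_zero_obj Z) /\
  (forall A B : C, exists (P : C) (i : hom A P) (j : hom B P)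
     (p : hom P A) (q : hom P B), is_biproduct ad i j p q).

Definition additive_functor (C D : category) (adC : preadditive C)
    (adD : preadditive D) (F : functor C D) : Prop :=
  forall (A B : C) (f g : hom A B),
    fmor F (addm adC f g) = addm adD (fmor F f) (fmor F g).

Definition is_additive (C : category) : Prop :=
  exists ad : preadditive C, additive_structure ad.

Definition is_abelian (C : category) : Prop :=
  [/\ is_additive C,
      forall (A B : C) (f : hom A B), exists (K : C) (k : hom K A),
        is_kernel k f,
      forall (A B : C) (f : hom A B), exists (K : C) (c : hom B K),
        is_cokernel f c,
      forall (A B : C) (f : hom A B), is_mono f ->
        exists (D : C) (g : hom B D), is_kernel f g
    & forall (A B : C) (f : hom A B), is_epi f ->
        exists (D : C) (g : hom D A), is_cokernel g f].

(* Left and right exactness, for functors that are already additive. *)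
Definition is_exact (C D : category) (F : functor C D) : Prop :=
  (forall (K A B : C) (k : hom K A) (f : hom A B),
     is_kernel k f -> is_kernel (fmor F k) (fmor F f)) /\
  (forall (A B K : C) (f : hom A B) (c : hom B K),
     is_cokernel f c -> is_cokernel (fmor F f) (fmor F c)).

Record opens (X : topologicalType) := Opens {
  carrier :> set X;
  openP : open carrier }.

Definition opensI (X : topologicalType) (U V : opens X) : opens X :=
  Opens (openI (openP U) (openP V)).

Lemma opensIl (X : topologicalType) (U V : opens X) : opensI U V `<=` U.
Proof. by move=> x []. Qed.

Lemma opensIr (X : topologicalType) (U V : opens X) : opensI U V `<=` V.
Proof. by move=> x []. Qed.

(* A pseudofunctor on the poset of open subsets.  The coherence isomorphisms
   take the three inclusions as arguments, so that no inclusion proof ever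
   needs to be normalised. *)
Record prestack (X : topologicalType) := Prestack {
  sec :> opens X -> category;
  res : forall U V : opens X, V `<=` U -> functor (sec U) (sec V);
  resC : forall (U V W : opens X) (hVU : V `<=` U) (hWV : W `<=` V)
    (hWU : W `<=` U) (A : sec U), iso (res hWV (res hVU A)) (res hWU A);
  res1 : forall (U : opens X) (hUU : U `<=` U) (A : sec U), iso (res hUU A) A;
  resC_nat : forall (U V W : opens X) (hVU : V `<=` U) (hWV : W `<=` V)
    (hWU : W `<=` U) (A B : sec U) (f : hom A B),
    resC hVU hWV hWU B ∘ fmor (res hWV) (fmor (res hVU) f)
    = fmor (res hWU) f ∘ resC hVU hWV hWU A;
  res1_nat : forall (U : opens X) (hUU : U `<=` U) (A B : sec U) (f : hom A B),
    res1 hUU B ∘ fmor (res hUU) f = f ∘ res1 hUU A;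
  resCA : forall (U V W T : opens X) (hVU : V `<=` U) (hWV : W `<=` V)
    (hTW : T `<=` W) (hWU : W `<=` U) (hTV : T `<=` V) (hTU : T `<=` U)
    (A : sec U),
    resC hWU hTW hTU A ∘ fmor (res hTW) (resC hVU hWV hWU A)
    = resC hVU hTV hTU A ∘ resC hWV hTW hTV (res hVU A);
  resC1l : forall (U V : opens X) (hUU : U `<=` U) (hVU : V `<=` U)
    (A : sec U), fwd (resC hUU hVU hVU A) = fmor (res hVU) (res1 hUU A);
  resC1r : forall (U V : opens X) (hVU : V `<=` U) (hVV : V `<=` V)
    (A : sec U), fwd (resC hVU hVV hVU A) = fwd (res1 hVV (res hVU A)) }.

Arguments res {X} p {U V} _.
Arguments resC {X} p {U V W} _ _ _ _.
Arguments res1 {X} p {U} _ _.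

Section RestrictionOfMorphisms.
Variables (X : topologicalType) (C : prestack X).

(* The restriction to W of a morphism A|V -> B|V, as a morphism A|W -> B|W. *)
Definition mres (U U' V W : opens X) (hVU : V `<=` U) (hVU' : V `<=` U')
    (hWV : W `<=` V) (hWU : W `<=` U) (hWU' : W `<=` U') (A : C U) (B : C U')
    (f : hom (res C hVU A) (res C hVU' B)) :
    hom (res C hWU A) (res C hWU' B) :=
  resC C hVU' hWV hWU' B ∘ fmor (res C hWV) f ∘ bwd (resC C hVU hWV hWU A).

(* The restriction to W of a morphism A|V -> B, for B defined on V. *)
Definition mresl (U V W : opens X) (hVU : V `<=` U) (hWV : W `<=` V)
    (hWU : W `<=` U) (A : C U) (B : C V) (f : hom (res C hVU A) B) :
    hom (res C hWU A) (res C hWV B) :=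
  fmor (res C hWV) f ∘ bwd (resC C hVU hWV hWU A).

Lemma mres1 (U V W : opens X) (hVU : V `<=` U) (hWV : W `<=` V)
    (hWU : W `<=` U) (A : C U) :
  mres hWV hWU hWU (idm (res C hVU A)) = idm _.
Proof. by rewrite /mres fmor1 compm1 bwdK. Qed.

Lemma mresM (U1 U2 U3 V W : opens X) (h1 : V `<=` U1) (h2 : V `<=` U2)
    (h3 : V `<=` U3) (hWV : W `<=` V) (k1 : W `<=` U1) (k2 : W `<=` U2)
    (k3 : W `<=` U3) (A : C U1) (B : C U2) (D : C U3)
    (g : hom (res C h2 B) (res C h3 D)) (f : hom (res C h1 A) (res C h2 B)) :
  mres hWV k1 k3 (g ∘ f) = mres hWV k2 k3 g ∘ mres hWV k1 k2 f.
Proof.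
rewrite /mres fmorM !compmA; congr (_ ∘ _ ∘ _).
by rewrite -(compmA _ (bwd _)) fwdK compm1.
Qed.

Lemma mres_mres (U U' V W T : opens X) (hVU : V `<=` U) (hVU' : V `<=` U')
    (hWV : W `<=` V) (hWU : W `<=` U) (hWU' : W `<=` U') (hTW : T `<=` W)
    (hTV : T `<=` V) (hTU : T `<=` U) (hTU' : T `<=` U') (A : C U) (B : C U')
    (f : hom (res C hVU A) (res C hVU' B)) :
  mres hTW hTU hTU' (mres hWV hWU hWU' f) = mres hTV hTU hTU' f.
Proof.
have isoL (D : category) (a b c : D) (i : iso a b) (x y : hom b c) :
    x ∘ i = y ∘ i -> x = y.
  by move=> /(congr1 (fun z => z ∘ bwd i)); rewrite -!compmA bwdK !compm1.
apply: (isoL _ _ _ _ (iso_comp (resC C hWU hTW hTU A)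
   (fmor_iso (res C hTW) (resC C hVU hWV hWU A)))).
rewrite /= {1}/mres [in LHS]compmA -(compmA _ (bwd _)) fwdK compm1.
rewrite -compmA -fmorM /mres -(compmA _ (bwd _)) fwdK compm1 fmorM compmA resCA.
rewrite -compmA resC_nat compmA resCA !compmA; congr (_ ∘ _).
by rewrite -(compmA _ (bwd _)) fwdK compm1.
Qed.

End RestrictionOfMorphisms.

Section Stalk.
Variables (X : topologicalType) (C : prestack X) (p : X).

Record stalk_obj := StalkObj {
  so_dom : opens X;
  so_mem : carrier so_dom p;
  so_val : C so_dom }.

(* A morphism A|W -> B|W on some open neighbourhood W of p. *)
Record pregerm (A B : stalk_obj) := Pregerm {
  pg_dom : opens X;
  pg_mem : carrier pg_dom p;
  pg_src : pg_dom `<=` so_dom A;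
  pg_tgt : pg_dom `<=` so_dom B;
  pg_mor : hom (res C pg_src (so_val A)) (res C pg_tgt (so_val B)) }.

Definition same_germ (A B : stalk_obj) (f g : pregerm A B) : Prop :=
  exists (W : opens X) (hf : W `<=` pg_dom f) (hg : W `<=` pg_dom g)
    (hA : W `<=` so_dom A) (hB : W `<=` so_dom B),
    carrier W p /\ mres hf hA hB (pg_mor f) = mres hg hA hB (pg_mor g).

Lemma same_germ_refl A B (f : pregerm A B) : same_germ f f.
Proof.
exists (pg_dom f), (fun _ => id), (fun _ => id), (pg_src (p:=f)), (pg_tgt (p:=f)).
by split=> //; exact: pg_mem.
Qed.

Lemma same_germ_sym A B (f g : pregerm A B) : same_germ f g -> same_germ g f.
Proof. by move=> [W [hf [hg [hA [hB [Wp e]]]]]]; exists W, hg, hf, hA, hB. Qed.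

Lemma same_germ_trans A B (f g h : pregerm A B) :
  same_germ f g -> same_germ g h -> same_germ f h.
Proof.
move=> [W [hf [hg [hA [hB [Wp e]]]]]] [V [kg [kh [kA [kB [Vp e']]]]]].
have sW : opensI W V `<=` W by move=> x [].
have sV : opensI W V `<=` V by move=> x [].
exists (opensI W V), (subset_trans sW hf), (subset_trans sV kh),
  (subset_trans sW hA), (subset_trans sW hB); split=> //.
rewrite -(mres_mres hf hA hB sW) e (mres_mres _ _ _ _ (subset_trans sV kg)).
rewrite -(mres_mres kg kA kB sV) e'; exact: mres_mres.
Qed.

Definition germ_rel (A B : stalk_obj) : rel {classic pregerm A B} :=
  fun f g => `[< same_germ f g >].

Lemma germ_rel_refl A B : reflexive (@germ_rel A B).
Proof. by move=> f; apply/asboolP; exact: same_germ_refl. Qed.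

Lemma germ_rel_sym A B : symmetric (@germ_rel A B).
Proof. by move=> f g; apply: asbool_equiv_eq; split; exact: same_germ_sym. Qed.

Lemma germ_rel_trans A B : transitive (@germ_rel A B).
Proof.
move=> g f h /asboolP fg /asboolP gh.
by apply/asboolP; exact: same_germ_trans fg gh.
Qed.

Canonical germ_equiv A B := EquivRel (@germ_rel A B)
  (@germ_rel_refl A B) (@germ_rel_sym A B) (@germ_rel_trans A B).

Definition stalk_hom (A B : stalk_obj) : Type := {eq_quot germ_equiv A B}.

Definition germ_of (A B : stalk_obj) (f : pregerm A B) : stalk_hom A B :=
  \pi_({eq_quot germ_equiv A B}) (f : {classic pregerm A B}).

Definition germ_rep (A B : stalk_obj) (f : stalk_hom A B) : pregerm A B :=
  @repr _ {eq_quot germ_equiv A B} f.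

Lemma germ_ofP A B (f g : pregerm A B) : germ_of f = germ_of g <-> same_germ f g.
Proof.
split=> [/eqmodP/asboolP//|fg]; apply/eqmodP; exact/asboolP.
Qed.

Lemma repK A B (f : stalk_hom A B) : germ_of (germ_rep f) = f.
Proof. exact: reprK. Qed.

Lemma same_germ_rep A B (f : pregerm A B) : same_germ (germ_rep (germ_of f)) f.
Proof. by apply/germ_ofP; rewrite repK. Qed.

Definition pregerm_id (A : stalk_obj) : pregerm A A :=
  Pregerm (so_mem A) (idm (res C (fun _ => id) (so_val A))).

Definition pregerm_comp (A B D : stalk_obj) (g : pregerm B D)
    (f : pregerm A B) : pregerm A D :=
  let W := opensI (pg_dom f) (pg_dom g) in
  let hf : W `<=` pg_dom f := @opensIl _ _ _ in
  let hg : W `<=` pg_dom g := @opensIr _ _ _ in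
  let hA := subset_trans hf (pg_src (p:=f)) in
  let hB := subset_trans hf (pg_tgt (p:=f)) in
  let hD := subset_trans hg (pg_tgt (p:=g)) in
  @Pregerm A D W (conj (pg_mem f) (pg_mem g)) hA hD
    (mres hg hB hD (pg_mor g) ∘ mres hf hA hB (pg_mor f)).

Lemma mres_pregerm_comp A B D (g : pregerm B D) (f : pregerm A B)
    (W : opens X) (hfg : W `<=` pg_dom (pregerm_comp g f))
    (hf : W `<=` pg_dom f) (hg : W `<=` pg_dom g) (hA : W `<=` so_dom A)
    (hB : W `<=` so_dom B) (hD : W `<=` so_dom D) :
  mres hfg hA hD (pg_mor (pregerm_comp g f))
  = mres hg hB hD (pg_mor g) ∘ mres hf hA hB (pg_mor f).
Proof. by rewrite /= (mresM _ _ hB) (mres_mres _ _ _ _ hg) (mres_mres _ _ _ _ hf). Qed.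

Lemma same_germ_comp A B D (g g' : pregerm B D) (f f' : pregerm A B) :
  same_germ g g' -> same_germ f f' ->
  same_germ (pregerm_comp g f) (pregerm_comp g' f').
Proof.
move=> [V [kg [kg' [kB [kD [Vp eg]]]]]] [W [hf [hf' [hA [hB [Wp ef]]]]]].
have sW : opensI W V `<=` W by move=> x [].
have sV : opensI W V `<=` V by move=> x [].
have h1 : opensI W V `<=` pg_dom (pregerm_comp g f).
  by move=> x [Wx Vx]; split; [exact: (hf x) | exact: (kg x)].
have h2 : opensI W V `<=` pg_dom (pregerm_comp g' f').
  by move=> x [Wx Vx]; split; [exact: (hf' x) | exact: (kg' x)].
exists (opensI W V), h1, h2, (subset_trans sW hA), (subset_trans sV kD).
split=> //.
rewrite (mres_pregerm_comp _ (subset_trans sW hf) (subset_trans sV kg) _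
  (subset_trans sW hB)).
rewrite (mres_pregerm_comp _ (subset_trans sW hf') (subset_trans sV kg') _
  (subset_trans sW hB)).
rewrite -(mres_mres hf hA hB sW) ef.
rewrite (mres_mres _ _ _ _ (subset_trans sW hf')).
by rewrite -(mres_mres kg kB kD sV) eg (mres_mres _ _ _ _ (subset_trans sV kg')).
Qed.

Definition stalk_id (A : stalk_obj) : stalk_hom A A := germ_of (pregerm_id A).

Definition stalk_comp (A B D : stalk_obj) (g : stalk_hom B D)
    (f : stalk_hom A B) : stalk_hom A D :=
  germ_of (pregerm_comp (germ_rep g) (germ_rep f)).

Lemma stalk_compE A B D (g : pregerm B D) (f : pregerm A B) :
  stalk_comp (germ_of g) (germ_of f) = germ_of (pregerm_comp g f).
Proof.
by apply/germ_ofP; apply: same_germ_comp; exact: same_germ_rep.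
Qed.

Lemma stalk_comp1m A B (f : stalk_hom A B) : stalk_comp (stalk_id B) f = f.
Proof.
rewrite -[f]repK stalk_compE; apply/germ_ofP; set g := germ_rep f.
set L := pregerm_comp (pregerm_id B) g.
have kg : pg_dom L `<=` pg_dom g by move=> x [].
have k1 : pg_dom L `<=` pg_dom (pregerm_id B) by move=> x [].
exists (pg_dom L), (fun _ => id), kg, (pg_src (p:=L)), (pg_tgt (p:=L)).
split; first exact: pg_mem.
by rewrite (mres_pregerm_comp _ kg k1 _ (pg_tgt (p:=L))) mres1 comp1m.
Qed.

Lemma stalk_compm1 A B (f : stalk_hom A B) : stalk_comp f (stalk_id A) = f.
Proof.
rewrite -[f]repK stalk_compE; apply/germ_ofP; set g := germ_rep f.
set L := pregerm_comp g (pregerm_id A).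
have kg : pg_dom L `<=` pg_dom g by move=> x [].
have k1 : pg_dom L `<=` pg_dom (pregerm_id A) by move=> x [].
exists (pg_dom L), (fun _ => id), kg, (pg_src (p:=L)), (pg_tgt (p:=L)).
split; first exact: pg_mem.
by rewrite (mres_pregerm_comp _ k1 kg _ (pg_src (p:=L))) mres1 compm1.
Qed.

Lemma stalk_compmA A B D E (h : stalk_hom D E) (g : stalk_hom B D)
    (f : stalk_hom A B) :
  stalk_comp h (stalk_comp g f) = stalk_comp (stalk_comp h g) f.
Proof.
rewrite -[h]repK -[g]repK -[f]repK !stalk_compE; apply/germ_ofP.
move: (germ_rep h) (germ_rep g) (germ_rep f) => {}h {}g {}f.
set L := pregerm_comp h (pregerm_comp g f).
have kf : pg_dom L `<=` pg_dom f by move=> x [[]].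
have kg : pg_dom L `<=` pg_dom g by move=> x [[]].
have kh : pg_dom L `<=` pg_dom h by move=> x [[]].
have kgf : pg_dom L `<=` pg_dom (pregerm_comp g f) by move=> x [].
have khg : pg_dom L `<=` pg_dom (pregerm_comp h g) by move=> x [[]].
have kR : pg_dom L `<=` pg_dom (pregerm_comp (pregerm_comp h g) f).
  by move=> x [[]].
have kB := subset_trans kg (pg_src (p:=g)).
have kD := subset_trans kh (pg_src (p:=h)).
exists (pg_dom L), (fun _ => id), kR, (pg_src (p:=L)), (pg_tgt (p:=L)).
split; first exact: pg_mem.
rewrite (mres_pregerm_comp _ kgf kh _ kD) (mres_pregerm_comp _ kf kg _ kB).
by rewrite (mres_pregerm_comp _ kf khg _ kB) (mres_pregerm_comp _ kg kh _ kD)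
  compmA.
Qed.

Definition stalk : category :=
  {| obj := stalk_obj; hom := stalk_hom; idm := stalk_id; compm := stalk_comp;
     comp1m := stalk_comp1m; compm1 := stalk_compm1; compmA := stalk_compmA |}.

End Stalk.

Section StalkFunctor.
Variables (X : topologicalType) (C : prestack X) (p : X) (U : opens X).
Hypothesis pU : carrier U p.

Definition germ_obj (A : C U) : stalk C p := StalkObj pU A.

Definition pregerm_mor (A B : C U) (f : hom A B) :
    pregerm (germ_obj A) (germ_obj B) :=
  @Pregerm _ _ _ (germ_obj A) (germ_obj B) U pU (fun _ => id) (fun _ => id)
    (fmor (res C (fun _ => id)) f).

Definition germ_mor (A B : C U) (f : hom A B) : hom (germ_obj A) (germ_obj B) :=
  germ_of (pregerm_mor f).

Lemma germ_mor1 A : germ_mor (idm A) = idm (germ_obj A).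
Proof. by rewrite /germ_mor /pregerm_mor fmor1. Qed.

Lemma germ_morM A B D (g : hom B D) (f : hom A B) :
  germ_mor (g ∘ f) = germ_mor g ∘ germ_mor f.
Proof.
rewrite /germ_mor /= stalk_compE; apply/germ_ofP.
set a := pregerm_mor g; set b := pregerm_mor f.
pose L := pregerm_comp a b.
have ka : pg_dom L `<=` pg_dom a by move=> x [].
exists (pg_dom L), ka, (fun _ => id), (@pg_src _ _ _ _ _ L), (@pg_tgt _ _ _ _ _ L).
split; first exact: pg_mem.
rewrite (mres_pregerm_comp _ (ka : _ `<=` pg_dom b) ka _ (@pg_src _ _ _ _ _ L)).
by rewrite /= fmorM; exact: mresM.
Qed.

Definition germ : functor (C U) (stalk C p) :=
  {| fobj := germ_obj : C U -> stalk C p; fmor := germ_mor;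
     fmor1 := germ_mor1; fmorM := germ_morM |}.

(* f' represents f when, in the stalk, its image is isomorphic to f as an
   arrow; A' and B' need not be restrictions of the given representatives of
   A and B. *)
Definition represents (A' B' : C U) (f' : hom A' B') (A B : stalk C p)
    (f : hom A B) : Prop :=
  exists (a : iso (germ A') A) (b : iso (germ B') B),
    f ∘ a = b ∘ fmor germ f'.

End StalkFunctor.

Arguments germ {X} C {p U} pU.

Definition is_additive_prestack (X : topologicalType) (C : prestack X) : Prop :=
  exists ad : forall U : opens X, preadditive (C U),
    (forall U, additive_structure (ad U)) /\
    (forall (U V : opens X) (hVU : V `<=` U),
       additive_functor (ad U) (ad V) (res C hVU)).

Definition is_abelian_prestack (X : topologicalType) (C : prestack X) : Prop :=
  [/\ is_additive_prestack C,
      forall U : opens X, is_abelian (C U)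
    & forall (U V : opens X) (hVU : V `<=` U), is_exact (res C hVU)].

Definition homs_are_sheaves (X : topologicalType) (C : prestack X) : Prop :=
  forall (U : opens X) (A B : C U) (V : opens X) (hVU : V `<=` U)
    (I : Type) (W : I -> opens X) (hWV : forall i, W i `<=` V)
    (hWU : forall i, W i `<=` U)
    (f : forall i, hom (res C (hWU i) A) (res C (hWU i) B)),
  V `<=` \bigcup_i W i ->
  (forall i j (hU : opensI (W i) (W j) `<=` U),
     mres (@opensIl _ (W i) (W j)) hU hU (f i)
     = mres (@opensIr _ (W i) (W j)) hU hU (f j)) ->
  exists! g : hom (res C hVU A) (res C hVU B),
    forall i, mres (hWV i) (hWU i) (hWU i) g = f i.

Record descent_datum (X : topologicalType) (C : prestack X) (I : Type)
    (V : I -> opens X) := DescentDatum {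
  dd_obj : forall i, C (V i);
  dd_iso : forall i j, iso (res C (@opensIr _ (V i) (V j)) (dd_obj j))
                           (res C (@opensIl _ (V i) (V j)) (dd_obj i));
  dd_cocycle : forall i j k (W := opensI (opensI (V i) (V j)) (V k))
    (hij : W `<=` opensI (V i) (V j)) (hjk : W `<=` opensI (V j) (V k))
    (hik : W `<=` opensI (V i) (V k))
    (hi : W `<=` V i) (hj : W `<=` V j) (hk : W `<=` V k),
    mres hij hj hi (dd_iso i j) ∘ mres hjk hk hj (dd_iso j k)
    = mres hik hk hi (dd_iso i k) }.

Definition effective (X : topologicalType) (C : prestack X) (I : Type)
    (V : I -> opens X) (d : descent_datum C V) (U : opens X)
    (hVU : forall i, V i `<=` U) : Prop :=
  exists (A : C U) (phi : forall i, iso (res C (hVU i) A) (dd_obj d i)),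
    forall i j (hU : opensI (V i) (V j) `<=` U),
      dd_iso d i j ∘ mresl (@opensIr _ (V i) (V j)) hU (phi j)
      = mresl (@opensIl _ (V i) (V j)) hU (phi i).

Definition is_stack (X : topologicalType) (C : prestack X) : Prop :=
  homs_are_sheaves C /\
  forall (U : opens X) (I : Type) (V : I -> opens X)
    (hVU : forall i, V i `<=` U), U `<=` \bigcup_i V i ->
    forall d : descent_datum C V, effective d hVU.

Definition is_abelian_stack (X : topologicalType) (C : prestack X) : Prop :=
  is_stack C /\ is_abelian_prestack C.

Record prestack_functor (X : topologicalType) (C D : prestack X) :=
  PrestackFunctor {
  pfun :> forall U : opens X, functor (C U) (D U);
  pres : forall (U V : opens X) (hVU : V `<=` U) (A : C U),
    iso (pfun V (res C hVU A)) (res D hVU (pfun U A));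
  pres_nat : forall (U V : opens X) (hVU : V `<=` U) (A B : C U) (f : hom A B),
    pres hVU B ∘ fmor (pfun V) (fmor (res C hVU) f)
    = fmor (res D hVU) (fmor (pfun U) f) ∘ pres hVU A;
  presC : forall (U V W : opens X) (hVU : V `<=` U) (hWV : W `<=` V)
    (hWU : W `<=` U) (A : C U),
    resC D hVU hWV hWU (pfun U A) ∘ fmor (res D hWV) (pres hVU A)
      ∘ pres hWV (res C hVU A)
    = pres hWU A ∘ fmor (pfun W) (resC C hVU hWV hWU A);
  pres1 : forall (U : opens X) (hUU : U `<=` U) (A : C U),
    res1 D hUU (pfun U A) ∘ pres hUU A = fmor (pfun U) (res1 C hUU A) }.

Arguments pres {X C D} p {U V} hVU A.

Record prestack_transf (X : topologicalType) (C D : prestack X)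
    (F G : prestack_functor C D) := PrestackTransf {
  ptr :> forall (U : opens X) (A : C U), hom (F U A) (G U A);
  ptr_nat : forall (U : opens X) (A B : C U) (f : hom A B),
    ptr B ∘ fmor (F U) f = fmor (G U) f ∘ ptr A;
  ptr_res : forall (U V : opens X) (hVU : V `<=` U) (A : C U),
    fmor (res D hVU) (ptr A) ∘ pres F hVU A
    = pres G hVU A ∘ ptr (res C hVU A) }.

Definition is_transf_iso (X : topologicalType) (C D : prestack X)
    (F G : prestack_functor C D) (t : prestack_transf F G) : Prop :=
  forall (U : opens X) (A : C U), exists i : iso (F U A) (G U A), fwd i = t U A.

Section PrestackFunctorComposition.
Variables (X : topologicalType) (C D E : prestack X).
Variables (G : prestack_functor D E) (F : prestack_functor C D).

Program Definition prestack_functor_comp : prestack_functor C E :=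
  {| pfun := fun U => functor_comp (G U) (F U);
     pres := fun U V hVU A =>
       iso_comp (pres G hVU (F U A)) (fmor_iso (G V) (pres F hVU A)) |}.
Next Obligation.
move=> U V hVU A B f /=.
by rewrite -compmA -fmorM pres_nat fmorM compmA pres_nat compmA.
Qed.
Next Obligation.
move=> U V W hVU hWV hWU A /=.
rewrite fmorM -!compmA [in LHS](compmA (fmor _ _) (fwd _)) -pres_nat.
rewrite !compmA presC -!compmA; congr (_ ∘ _).
by rewrite -!fmorM compmA presC.
Qed.
Next Obligation.
by move=> U hUU A /=; rewrite compmA pres1 -fmorM pres1.
Qed.

End PrestackFunctorComposition.

(* eta is a functor to a stack, and for every stack T composition with eta is
   an equivalence from the category of functors S -> T to the category of
   functors C -> T: it is essentially surjective and fully faithful. *)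
Definition is_associated_stack (X : topologicalType) (C S : prestack X)
    (eta : prestack_functor C S) : Prop :=
  is_stack S /\
  forall T : prestack X, is_stack T ->
    (forall G : prestack_functor C T, exists (H : prestack_functor S T)
       (t : prestack_transf (prestack_functor_comp H eta) G),
       is_transf_iso t) /\
    (forall (H H' : prestack_functor S T)
       (t : prestack_transf (prestack_functor_comp H eta)
                            (prestack_functor_comp H' eta)),
       (exists s : prestack_transf H H',
          forall (U : opens X) (A : C U), s U (eta U A) = t U A) /\
       (forall s s' : prestack_transf H H',
          (forall (U : opens X) (A : C U), s U (eta U A) = t U A) ->
          (forall (U : opens X) (A : C U), s' U (eta U A) = t U A) ->
          forall (U : opens X) (B : S U), s U B = s' U B)).

(* Main.v *)
Require Import Defs.
From mathcomp Require Import all_boot.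
From mathcomp Require Import boolp classical_sets topology.

(** The associated stack S is only known through its universal property, so the
    first half of the proof extracts from it that eta is an equivalence on
    stalks, by testing it on two stacks.

    Families of objects of the stalks of C, one for each point, form a stack,
    and sending an object to the family of its germs is a functor from C to it.
    This functor separates germs and factors through eta, so eta is faithful on
    stalks (stalkf_eta_inj). Objects of S with an atlas, that is, with local
    isomorphisms to objects of C whose transitions come from C, form a second
    stack. It lies over S, and eta lifts to it. Existence in the universal
    property lifts S itself, and uniqueness shows that the lift, followed by
    forgetting the atlas, is isomorphic to the identity (assoc_retract). So every
    object of S comes locally from C, and so does every morphism between objects
    of C (stalkf_eta_esssurj, stalkf_eta_full).

    The second half works in S with germs. In a stack a morphism is a family of
    germs that is locally the germ of a section (hom_sep, hom_glue), and an
    object can be glued from local ones when germs of transitions are singled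
    out by a condition with a unique solution (obj_glue). Sums of germs in C
    carry over to the stalks of S, and sums of morphisms of S are glued from
    them. Biproducts exist locally, coming from C; the hypothesis of the theorem
    gives, locally on U, kernels and cokernels on all germs
    (local_representation). All of them are unique up to unique isomorphism, so
    they glue (cone_glue, cocone_glue). A morphism that is a kernel on germs is a
    kernel, as factorizations glue; conversely every kernel is one on germs, by
    uniqueness of kernels. Hence restriction functors are exact. A monomorphism f
    has zero kernel, so f is a monomorphism on germs, hence the kernel of its
    cokernel there, because stalks are abelian; and so f is the kernel of its
    cokernel. Dually for epimorphisms. *)

Set Implicit Arguments.
Unset Strict Implicit.
Unset Printing Implicit Defensive.

Local Open Scope classical_set_scope.
Local Open Scope cat_scope.

Arguments compm : simpl never.

(** * Isomorphisms *)

Section Isomorphisms.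
Variable C : category.

Definition iso_id (A : C) : iso A A := Iso (comp1m (idm A)) (comp1m (idm A)).

Definition iso_inv (A B : C) (i : iso A B) : iso B A := Iso (bwdK i) (fwdK i).

Lemma iso_epi (A B D : C) (i : iso A B) (f g : hom B D) : f ∘ i = g ∘ i -> f = g.
Proof. by move=> /(congr1 (fun z => z ∘ bwd i)); rewrite -!compmA bwdK !compm1. Qed.

Lemma iso_mono (A B D : C) (i : iso A B) (f g : hom D A) : i ∘ f = i ∘ g -> f = g.
Proof. by move=> /(congr1 (compm (bwd i))); rewrite !compmA fwdK !comp1m. Qed.

Lemma compm_fwdK (A B D : C) (i : iso A B) (f : hom A D) : f ∘ bwd i ∘ i = f.
Proof. by rewrite -compmA fwdK compm1. Qed.

Lemma compm_bwdK (A B D : C) (i : iso A B) (f : hom B D) : f ∘ i ∘ bwd i = f.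
Proof. by rewrite -compmA bwdK compm1. Qed.

Lemma fwd_compK (A B D : C) (i : iso A B) (f : hom D A) : bwd i ∘ (i ∘ f) = f.
Proof. by rewrite compmA fwdK comp1m. Qed.

Lemma bwd_compK (A B D : C) (i : iso A B) (f : hom D B) : i ∘ (bwd i ∘ f) = f.
Proof. by rewrite compmA bwdK comp1m. Qed.

End Isomorphisms.

(** * Sections and germs *)

Section Germs.
Variables (X : topologicalType) (C : prestack X).

(** A section over W of Hom(A, B), where A and B live on larger opens U and V,
    has germs between A and B themselves: no object has to be restricted. The
    membership proofs are free arguments, so that germs taken at a varying
    point always compose. *)
Definition sgerm (p : X) (U V W : opens X) (hU : W `<=` U) (hV : W `<=` V)
    (A : C U) (B : C V) (u : hom (res C hU A) (res C hV B))
    (Wp : carrier W p) (Up : carrier U p) (Vp : carrier V p) :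
    @hom (stalk C p) (StalkObj Up A) (StalkObj Vp B) :=
  germ_of (@Pregerm _ C p (StalkObj Up A) (StalkObj Vp B) W Wp hU hV u).

Lemma sgerm_eqP (p : X) (U V W W' : opens X) (hU : W `<=` U) (hV : W `<=` V)
    (hU' : W' `<=` U) (hV' : W' `<=` V) (A : C U) (B : C V)
    (u : hom (res C hU A) (res C hV B)) (u' : hom (res C hU' A) (res C hV' B))
    (Wp : carrier W p) (W'p : carrier W' p) (Up : carrier U p)
    (Vp : carrier V p) :
  sgerm u Wp Up Vp = sgerm u' W'p Up Vp <->
  exists (T : opens X) (hT : T `<=` W) (hT' : T `<=` W') (kU : T `<=` U)
    (kV : T `<=` V), carrier T p /\ mres hT kU kV u = mres hT' kU kV u'.
Proof. exact: germ_ofP. Qed.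

Lemma sgerm_mres (p : X) (U V W T : opens X) (hU : W `<=` U) (hV : W `<=` V)
    (hT : T `<=` W) (kU : T `<=` U) (kV : T `<=` V) (A : C U) (B : C V)
    (u : hom (res C hU A) (res C hV B)) (Tp : carrier T p) (Wp : carrier W p)
    (Up : carrier U p) (Vp : carrier V p) :
  sgerm (mres hT kU kV u) Tp Up Vp = sgerm u Wp Up Vp.
Proof.
apply/sgerm_eqP; exists T, (fun _ => id), hT, kU, kV; split=> //.
exact: mres_mres.
Qed.

Lemma sgerm1 (p : X) (U W : opens X) (hU : W `<=` U) (A : C U)
    (Wp : carrier W p) (Up : carrier U p) :
  sgerm (idm (res C hU A)) Wp Up Up = idm _.
Proof.
apply/sgerm_eqP; exists W, (fun _ => id), hU, hU, hU; split=> //.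
by rewrite !mres1.
Qed.

Lemma sgermM (p : X) (U V T W : opens X) (hU : W `<=` U) (hV : W `<=` V)
    (hT : W `<=` T) (A : C U) (B : C V) (D : C T)
    (v : hom (res C hV B) (res C hT D)) (u : hom (res C hU A) (res C hV B))
    (Wp : carrier W p) (Up : carrier U p) (Vp : carrier V p)
    (Tp : carrier T p) :
  sgerm (v ∘ u) Wp Up Tp = sgerm v Wp Vp Tp ∘ sgerm u Wp Up Vp.
Proof.
rewrite [RHS]stalk_compE /sgerm;
  pose f := @Pregerm _ C p (StalkObj Up A) (StalkObj Vp B) W Wp hU hV u.
pose g := @Pregerm _ C p (StalkObj Vp B) (StalkObj Tp D) W Wp hV hT v.
rewrite -/f -/g.
apply/germ_ofP.
exists (pg_dom (pregerm_comp g f)), (@opensIl _ _ _), (fun _ => id),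
  (@pg_src _ _ _ _ _ (pregerm_comp g f)), (@pg_tgt _ _ _ _ _ (pregerm_comp g f)).
split; first exact: (conj Wp Wp).
have k : opensI W W `<=` V := subset_trans (@opensIl _ W W) hV.
rewrite (@mres_pregerm_comp _ _ _ _ _ _ g f _ _ (@opensIl _ W W)
  (@opensIr _ W W) _ k) /=.
rewrite (mresM _ _ k); congr (mres _ _ _ _ ∘ _).
exact: Prop_irrelevance.
Qed.

Lemma sgermP (p : X) (U V : opens X) (A : C U) (B : C V) (Up : carrier U p)
    (Vp : carrier V p) (f : @hom (stalk C p) (StalkObj Up A) (StalkObj Vp B)) :
  exists (W : opens X) (Wp : carrier W p) (hU : W `<=` U) (hV : W `<=` V)
    (u : hom (res C hU A) (res C hV B)), f = sgerm u Wp Up Vp.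
Proof.
rewrite -[f]repK; case: (germ_rep _) => W Wp hU hV u.
by exists W, Wp, hU, hV, u.
Qed.

Lemma sgerm_composable (p : X) (U V T : opens X) (A : C U) (B : C V) (D : C T)
    (Up : carrier U p) (Vp : carrier V p) (Tp : carrier T p)
    (f : @hom (stalk C p) (StalkObj Up A) (StalkObj Vp B))
    (g : @hom (stalk C p) (StalkObj Vp B) (StalkObj Tp D)) :
  exists (W : opens X) (Wp : carrier W p) (hU : W `<=` U) (hV : W `<=` V)
    (hT : W `<=` T) (u : hom (res C hU A) (res C hV B))
    (v : hom (res C hV B) (res C hT D)),
    f = sgerm u Wp Up Vp /\ g = sgerm v Wp Vp Tp.
Proof.
have [W [Wp [hU [hV [u ->]]]]] := sgermP f.
have [W' [W'p [hV' [hT [v ->]]]]] := sgermP g.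
have s1 : opensI W W' `<=` W by exact: opensIl.
have s2 : opensI W W' `<=` W' by exact: opensIr.
have kV := subset_trans s1 hV.
exists (opensI W W'), (conj Wp W'p), (subset_trans s1 hU), kV, (subset_trans s2 hT).
exists (mres s1 _ kV u), (mres s2 kV _ v).
by rewrite !sgerm_mres.
Qed.

Lemma sgerm_parallel (p : X) (U V : opens X) (A : C U) (B : C V)
    (Up : carrier U p) (Vp : carrier V p)
    (f g : @hom (stalk C p) (StalkObj Up A) (StalkObj Vp B)) :
  exists (W : opens X) (Wp : carrier W p) (hU : W `<=` U) (hV : W `<=` V)
    (u v : hom (res C hU A) (res C hV B)),
    f = sgerm u Wp Up Vp /\ g = sgerm v Wp Up Vp.
Proof.
have [W [Wp [hU [hV [u ->]]]]] := sgermP f.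
have [W' [W'p [hU' [hV' [v ->]]]]] := sgermP g.
have s1 : opensI W W' `<=` W by exact: opensIl.
have s2 : opensI W W' `<=` W' by exact: opensIr.
exists (opensI W W'), (conj Wp W'p), (subset_trans s1 hU), (subset_trans s1 hV).
by exists (mres s1 _ _ u), (mres s2 _ _ v); rewrite !sgerm_mres.
Qed.

(** Germs agree when sections agree on a neighbourhood, so their equality is an
    open condition. All the spreading out below rests on this. *)
Lemma sgerm_near (p : X) (U V W W' : opens X) (hU : W `<=` U) (hV : W `<=` V)
    (hU' : W' `<=` U) (hV' : W' `<=` V) (A : C U) (B : C V)
    (u : hom (res C hU A) (res C hV B)) (u' : hom (res C hU' A) (res C hV' B))
    (Wp : carrier W p) (W'p : carrier W' p) (Up : carrier U p)
    (Vp : carrier V p) :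
  sgerm u Wp Up Vp = sgerm u' W'p Up Vp ->
  exists (T : opens X), [/\ carrier T p, T `<=` W, T `<=` W' &
    forall q (Tq : carrier T q) (Wq : carrier W q) (W'q : carrier W' q)
      (Uq : carrier U q) (Vq : carrier V q),
      sgerm u Wq Uq Vq = sgerm u' W'q Uq Vq].
Proof.
move=> /sgerm_eqP [T [hT [hT' [kU [kV [Tp e]]]]]]; exists T; split=> // q Tq Wq W'q Uq Vq.
by rewrite -(sgerm_mres hT kU kV _ Tq) e sgerm_mres.
Qed.

Lemma germE (p : X) (U : opens X) (Up : carrier U p) (A B : C U) (f : hom A B) :
  fmor (germ C Up) f = sgerm (fmor (res C (fun _ => id)) f) Up Up Up.
Proof. by []. Qed.

Definition sgerm_iso (p : X) (U V W : opens X) (hU : W `<=` U) (hV : W `<=` V)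
    (A : C U) (B : C V) (u : iso (res C hU A) (res C hV B))
    (Wp : carrier W p) (Up : carrier U p) (Vp : carrier V p) :
    @iso (stalk C p) (StalkObj Up A) (StalkObj Vp B).
Proof.
refine (@Iso (stalk C p) _ _ (sgerm u Wp Up Vp) (sgerm (bwd u) Wp Vp Up) _ _).
  by rewrite -sgermM fwdK sgerm1.
by rewrite -sgermM bwdK sgerm1.
Defined.

(** In the stalk, A|V and A are different objects with the same germs; rho is
    the canonical identification. *)
Definition rho (p : X) (U V : opens X) (hVU : V `<=` U) (A : C U)
    (Vp : carrier V p) (Up : carrier U p) :
    @iso (stalk C p) (StalkObj Vp (res C hVU A)) (StalkObj Up A) :=
  sgerm_iso (res1 C (fun _ => id) (res C hVU A)) Vp Vp Up.

Lemma rhoE (p : X) (U V : opens X) (hVU : V `<=` U) (A : C U)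
    (Vp : carrier V p) (Up : carrier U p) :
  fwd (rho hVU A Vp Up) = sgerm (res1 C (fun _ => id) (res C hVU A)) Vp Vp Up.
Proof. by []. Qed.

Lemma rho_nat (p : X) (U U' V : opens X) (hU : V `<=` U) (hU' : V `<=` U')
    (A : C U) (B : C U') (u : hom (res C hU A) (res C hU' B))
    (Vp : carrier V p) (Up : carrier U p) (U'p : carrier U' p) :
  rho hU' B Vp U'p ∘ fmor (germ C Vp) u = sgerm u Vp Up U'p ∘ rho hU A Vp Up.
Proof. by rewrite germE /= -!sgermM res1_nat. Qed.

Lemma mres_fmor (U V W : opens X) (hVU : V `<=` U) (hWV : W `<=` V) (hWU : W `<=` U)
  (A B : C U) (f : hom A B) :
  mres hWV hWU hWU (fmor (res C hVU) f) = fmor (res C hWU) f.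
Proof. by rewrite /mres resC_nat compm_bwdK. Qed.

Lemma sgerm_fmor (p : X) (U W : opens X) (hU : W `<=` U) (A B : C U)
    (f : hom A B) (Wp : carrier W p) (Up : carrier U p) :
  sgerm (fmor (res C hU) f) Wp Up Up = fmor (germ C Up) f.
Proof.
by rewrite germE -(sgerm_mres hU hU hU (fmor _ f) Wp) mres_fmor.
Qed.

Lemma rho1 (p : X) (U : opens X) (hUU : U `<=` U) (A : C U) (Up : carrier U p) :
  fmor (germ C Up) (res1 C hUU A) = rho hUU A Up Up.
Proof.
have -> : hUU = (fun _ => id) by exact: Prop_irrelevance.
by rewrite germE /= -(resC1l (fun _ => id) (fun _ => id)) resC1r.
Qed.

(** As sections over any smaller open, the coherence isomorphisms of C have
    germ rho: passing to germs absorbs all the coherence data. *)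
Lemma rho_resC (p : X) (U V W : opens X) (hVU : V `<=` U) (hWV : W `<=` V)
    (hWU : W `<=` U) (A : C U) (Wp : carrier W p) (Vp : carrier V p)
    (Up : carrier U p) :
  fwd (rho hVU A Vp Up) = sgerm (resC C hVU hWV hWU A) Wp Vp Up.
Proof.
rewrite rhoE -(sgerm_mres hWV hWV hWU (res1 C _ _) Wp).
by rewrite /mres -resC1l compm_bwdK.
Qed.

Lemma rhoC (p : X) (U V W : opens X) (hVU : V `<=` U) (hWV : W `<=` V)
    (hWU : W `<=` U) (A : C U) (Wp : carrier W p) (Vp : carrier V p)
    (Up : carrier U p) :
  rho hWU A Wp Up ∘ fmor (germ C Wp) (resC C hVU hWV hWU A)
  = rho hVU A Vp Up ∘ rho hWV (res C hVU A) Wp Vp.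
Proof.
rewrite (rho_resC hVU hWV hWU A Wp Vp Up) germE !rhoE -!sgermM.
by rewrite res1_nat.
Qed.

End Germs.

(** * Functors induced on stalks *)

Section StalkOfFunctor.
Variables (X : topologicalType) (C D : prestack X) (F : prestack_functor C D).

Definition fsec (U V W : opens X) (hU : W `<=` U) (hV : W `<=` V) (A : C U)
    (B : C V) (u : hom (res C hU A) (res C hV B)) :
    hom (res D hU (F U A)) (res D hV (F V B)) :=
  pres F hV B ∘ fmor (F W) u ∘ bwd (pres F hU A).

Lemma fsec1 (U W : opens X) (hU : W `<=` U) (A : C U) :
  fsec (idm (res C hU A)) = idm _.
Proof. by rewrite /fsec fmor1 compm1 bwdK. Qed.

Lemma fsecM (U V T W : opens X) (hU : W `<=` U) (hV : W `<=` V) (hT : W `<=` T)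
    (A : C U) (B : C V) (E : C T) (v : hom (res C hV B) (res C hT E))
    (u : hom (res C hU A) (res C hV B)) :
  fsec (v ∘ u) = fsec v ∘ fsec u.
Proof. by rewrite /fsec fmorM !compmA compm_fwdK. Qed.

Lemma fsec_fmor (U W : opens X) (hU : W `<=` U) (A B : C U) (f : hom A B) :
  fsec (fmor (res C hU) f) = fmor (res D hU) (fmor (F U) f).
Proof. by rewrite /fsec pres_nat compm_bwdK. Qed.

Lemma presC_bwd (U V W : opens X) (hVU : V `<=` U) (hWV : W `<=` V)
    (hWU : W `<=` U) (A : C U) :
  fmor (F W) (bwd (resC C hVU hWV hWU A)) ∘ bwd (pres F hWU A)
  = bwd (pres F hWV (res C hVU A)) ∘ fmor (res D hWV) (bwd (pres F hVU A))
    ∘ bwd (resC D hVU hWV hWU (F U A)).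
Proof.
apply: (iso_epi (i := iso_comp (pres F hWU A) (fmor_iso (F W) (resC C hVU hWV hWU A)))).
transitivity (idm (F W (res C hWV (res C hVU A)))) => /=.
  by rewrite compmA compm_fwdK -fmorM fwdK fmor1.
by rewrite -presC !compmA compm_fwdK -(compmA _ (fmor _ (bwd _))) -fmorM fwdK fmor1
  compm1 fwdK.
Qed.

Lemma fsec_mres (U V W T : opens X) (hU : W `<=` U) (hV : W `<=` V)
    (hT : T `<=` W) (kU : T `<=` U) (kV : T `<=` V) (A : C U) (B : C V)
    (u : hom (res C hU A) (res C hV B)) :
  fsec (mres hT kU kV u) = mres hT kU kV (fsec u).
Proof.
rewrite /fsec /mres !fmorM -!compmA presC_bwd !compmA; congr (_ ∘ _ ∘ _).
rewrite -presC -[in LHS](compmA _ (fwd (pres F hT _)) (fmor (F T) _)) pres_nat.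
by rewrite compmA compm_bwdK.
Qed.

Definition stalkf_obj (p : X) (L : stalk C p) : stalk D p :=
  StalkObj (so_mem L) (F _ (so_val L)).

Definition pregerm_map (p : X) (L M : stalk C p) (f : pregerm L M) :
    pregerm (stalkf_obj L) (stalkf_obj M) :=
  @Pregerm _ D p (stalkf_obj L) (stalkf_obj M) _ (pg_mem f) (@pg_src _ _ _ _ _ f)
    (@pg_tgt _ _ _ _ _ f) (fsec (pg_mor f)).

Definition stalkf_mor (p : X) (L M : stalk C p) (f : hom L M) :
    hom (stalkf_obj L) (stalkf_obj M) :=
  germ_of (pregerm_map (germ_rep f)).

Lemma stalkf_mor_sgerm (p : X) (U V W : opens X) (hU : W `<=` U) (hV : W `<=` V)
    (A : C U) (B : C V) (u : hom (res C hU A) (res C hV B))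
    (Wp : carrier W p) (Up : carrier U p) (Vp : carrier V p) :
  stalkf_mor (sgerm u Wp Up Vp) = sgerm (fsec u) Wp Up Vp.
Proof.
apply/germ_ofP; rewrite /sgerm.
have [T [h1 [h2 [hA [hB [Tp e]]]]]] :=
  same_germ_rep (@Pregerm _ C p (StalkObj Up A) (StalkObj Vp B) W Wp hU hV u).
exists T, h1, h2, hA, hB; split=> //=.
by rewrite -!fsec_mres e.
Qed.

Lemma stalkf1 (p : X) (L : stalk C p) : stalkf_mor (idm L) = idm (stalkf_obj L).
Proof.
case: L => U Up A.
by rewrite -(sgerm1 (fun _ => id) A Up Up) stalkf_mor_sgerm fsec1 sgerm1.
Qed.

Lemma stalkfM (p : X) (L M N : stalk C p) (g : hom M N) (f : hom L M) :
  stalkf_mor (g ∘ f) = stalkf_mor g ∘ stalkf_mor f.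
Proof.
case: L M N g f => [U Up A] [V Vp B] [T Tp E] g f.
have [W [Wp [hU [hV [hT [u [v [-> ->]]]]]]]] := sgerm_composable f g.
by rewrite -sgermM !stalkf_mor_sgerm fsecM sgermM.
Qed.

Definition stalkf (p : X) : functor (stalk C p) (stalk D p) :=
  {| fobj := @stalkf_obj p : stalk C p -> stalk D p; fmor := @stalkf_mor p;
     fmor1 := @stalkf1 p; fmorM := @stalkfM p |}.

Lemma stalkf_sgerm (p : X) (U V W : opens X) (hU : W `<=` U) (hV : W `<=` V)
    (A : C U) (B : C V) (u : hom (res C hU A) (res C hV B))
    (Wp : carrier W p) (Up : carrier U p) (Vp : carrier V p) :
  fmor (stalkf p) (sgerm u Wp Up Vp) = sgerm (fsec u) Wp Up Vp.
Proof. exact: stalkf_mor_sgerm. Qed.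

Lemma stalkf_germ (p : X) (U : opens X) (Up : carrier U p) (A B : C U)
    (f : hom A B) :
  fmor (stalkf p) (fmor (germ C Up) f) = fmor (germ D Up) (fmor (F U) f).
Proof. by rewrite !germE stalkf_sgerm fsec_fmor. Qed.

Lemma stalkf_rho (p : X) (U V : opens X) (hVU : V `<=` U) (A : C U)
    (Vp : carrier V p) (Up : carrier U p) :
  fmor (stalkf p) (rho hVU A Vp Up)
  = rho hVU (F U A) Vp Up ∘ fmor (germ D Vp) (pres F hVU A).
Proof.
rewrite !rhoE stalkf_sgerm germE -sgermM res1_nat /fsec.
by rewrite -pres1 !compmA compm_bwdK.
Qed.

End StalkOfFunctor.

Section StalkOfTransformation.
Variables (X : topologicalType) (C D : prestack X) (F G : prestack_functor C D).
Variable t : prestack_transf F G.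

Lemma ptr_sec (U V W : opens X) (hU : W `<=` U) (hV : W `<=` V) (A : C U)
    (B : C V) (u : hom (res C hU A) (res C hV B)) :
  fmor (res D hV) (t V B) ∘ fsec F u = fsec G u ∘ fmor (res D hU) (t U A).
Proof.
rewrite /fsec !compmA ptr_res -(compmA _ (ptr _ _)) ptr_nat !compmA.
rewrite -(compmA _ _ (bwd (pres F hU A))) -[in RHS]compmA; congr (_ ∘ _).
apply: (iso_epi (i := pres F hU A)); rewrite compm_fwdK.
by rewrite -compmA ptr_res fwd_compK.
Qed.

(** Naturality of t concerns morphisms of C U only; germs are reached because
    t is also compatible with restrictions. *)
Lemma ptr_stalk (p : X) (U V : opens X) (Up : carrier U p) (Vp : carrier V p)
    (A : C U) (B : C V)
    (f : @hom (stalk C p) (StalkObj Up A) (StalkObj Vp B)) :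
  fmor (germ D Vp) (t V B) ∘ fmor (stalkf F p) f
  = fmor (stalkf G p) f ∘ fmor (germ D Up) (t U A).
Proof.
have [W [Wp [hU [hV [u ->]]]]] := sgermP f.
by rewrite !stalkf_sgerm -(sgerm_fmor hV _ Wp) -(sgerm_fmor hU _ Wp) -!sgermM ptr_sec.
Qed.

End StalkOfTransformation.

Lemma stalkf_comp (X : topologicalType) (C D E : prestack X)
    (G : prestack_functor D E) (F : prestack_functor C D) (p : X)
    (L M : stalk C p) (f : hom L M) :
  fmor (stalkf (prestack_functor_comp G F) p) f
  = fmor (stalkf G p) (fmor (stalkf F p) f).
Proof.
case: L M f => [U Up A] [V Vp B] f.
have [W [Wp [hU [hV [u ->]]]]] := sgermP f.
by rewrite !stalkf_sgerm /fsec /= !fmorM !compmA.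
Qed.

Program Definition prestack_functor_id (X : topologicalType) (C : prestack X) :
    prestack_functor C C :=
  {| pfun := fun U => Functor (fobj := id) (fmor := fun A B f => f) (fun _ => erefl)
       (fun _ _ _ _ _ => erefl);
     pres := fun U V hVU A => iso_id (res C hVU A) |}.
Next Obligation. by move=> *; rewrite compm1 comp1m. Qed.
Next Obligation. by move=> *; rewrite /= fmor1 !compm1 comp1m. Qed.
Next Obligation. by move=> *; rewrite /= compm1. Qed.

Lemma stalkf_id (X : topologicalType) (C : prestack X) (p : X)
    (U V : opens X) (Up : carrier U p) (Vp : carrier V p) (A : C U) (B : C V)
    (f : @hom (stalk C p) (StalkObj Up A) (StalkObj Vp B)) :
  fmor (stalkf (prestack_functor_id C) p) f = f.
Proof.
have [W [Wp [hU [hV [u ->]]]]] := sgermP f.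
by rewrite stalkf_sgerm /fsec /= comp1m compm1.
Qed.

(** * The stack of families of objects *)

Section Families.
Variables (X : topologicalType) (D : X -> category).

(** An object is a family over the whole of X, and only morphisms know about U.
    Restriction is then the identity on objects, and every coherence
    isomorphism is an identity. *)
Program Definition fam_cat (U : opens X) : category :=
  {| obj := forall p, D p;
     hom := fun A B => forall p, carrier U p -> hom (A p) (B p);
     idm := fun A p _ => idm (A p);
     compm := fun A B E g f p h => g p h ∘ f p h |}.
Next Obligation. by move=> *; apply: functional_extensionality_dep => p;
  apply: funext => h; rewrite comp1m. Qed.
Next Obligation. by move=> *; apply: functional_extensionality_dep => p;
  apply: funext => h; rewrite compm1. Qed.
Next Obligation. by move=> *; apply: functional_extensionality_dep => p;
  apply: funext => h; rewrite compmA. Qed.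

Lemma fam_homP (U : opens X) (A B : fam_cat U) (f g : hom A B) :
  (forall p h, f p h = g p h) -> f = g.
Proof. by move=> e; apply: functional_extensionality_dep => p; apply: funext => h. Qed.

Program Definition fam_res (U V : opens X) (hVU : V `<=` U) :
    functor (fam_cat U) (fam_cat V) :=
  {| fobj := fun A : fam_cat U => A : fam_cat V;
     fmor := fun A B (f : hom A B) => (fun p h => f p (hVU p h)) |}.
Next Obligation. by []. Qed.
Next Obligation. by []. Qed.

Program Definition families : prestack X :=
  {| sec := fam_cat; res := fam_res;
     resC := fun U V W _ _ _ A => iso_id (A : fam_cat W);
     res1 := fun U _ A => iso_id (A : fam_cat U) |}.
Next Obligation.
move=> U V W hVU hWV hWU A B f; apply: fam_homP => p h; rewrite comp1m compm1 /=.
by congr (f p _); exact: Prop_irrelevance.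
Qed.
Next Obligation.
move=> U hUU A B f; apply: fam_homP => p h; rewrite comp1m compm1 /=.
by congr (f p _); exact: Prop_irrelevance.
Qed.
Next Obligation. by []. Qed.
Next Obligation. by []. Qed.
Next Obligation. by []. Qed.

Lemma fam_compE (U : opens X) (A B E : families U) (g : hom B E) (f : hom A B)
    p h : (g ∘ f) p h = g p h ∘ f p h.
Proof. by []. Qed.

Lemma fam_mres (U U' V W : opens X) (hVU : V `<=` U) (hVU' : V `<=` U')
    (hWV : W `<=` V) (hWU : W `<=` U) (hWU' : W `<=` U') (A : families U)
    (B : families U') (f : hom (res families hVU A) (res families hVU' B)) p h h' :
  mres hWV hWU hWU' f p h = f p h'.
Proof.
rewrite /mres comp1m compm1 /=; congr (f p _); exact: Prop_irrelevance.
Qed.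

Lemma fam_mresl (U V W : opens X) (hVU : V `<=` U) (hWV : W `<=` V)
    (hWU : W `<=` U) (A : families U) (B : families V)
    (f : hom (res families hVU A) B) p h h' :
  mresl hWV hWU f p h = f p h'.
Proof.
rewrite /mresl compm1 /=; congr (f p _); exact: Prop_irrelevance.
Qed.

End Families.

Section FamiliesStack.
Variables (X : topologicalType) (D : X -> category).

Lemma families_sheaf : homs_are_sheaves (families D).
Proof.
move=> U A B V hVU I W hWV hWU f cov agree.
have agree' i j p (hi : carrier (W i) p) (hj : carrier (W j) p) : f i p hi = f j p hj.
  have hU : opensI (W i) (W j) `<=` U by move=> x [/hWU].
  have := congr1 (fun g => g p (conj hi hj)) (agree i j hU).
  by rewrite !(fam_mres _ _ _ _ _ hi) (fam_mres _ _ _ _ _ hj).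
have cov' p : carrier V p -> {i | carrier (W i) p}.
  by move=> /cov h; apply: cid; case: h => i _ Wip; exists i.
exists (fun p h => f (sval (cov' p h)) p (svalP (cov' p h))); split.
  by move=> i; apply: fam_homP => p h; rewrite (fam_mres _ _ _ _ _ (hWV i p h)).
move=> g gf; apply: fam_homP => p h; case: (cov' p h) => i hi /=.
by rewrite -gf (fam_mres _ _ _ _ _ h).
Qed.

Section Descent.
Variables (z : forall p, D p) (U : opens X) (I : Type) (V : I -> opens X).
Hypotheses (hVU : forall i, V i `<=` U) (cov : U `<=` \bigcup_i V i).
Variable d : descent_datum (families D) V.

Let T i j p (hi : carrier (V i) p) (hj : carrier (V j) p) :
  hom (dd_obj d j p) (dd_obj d i p) := fwd (dd_iso d i j) p (conj hi hj).

Let TM i j k p (hi : carrier (V i) p) (hj : carrier (V j) p)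
    (hk : carrier (V k) p) : T hi hj ∘ T hj hk = T hi hk.
Proof.
have h1 : opensI (opensI (V i) (V j)) (V k) `<=` opensI (V i) (V j) by move=> x [].
have h2 : opensI (opensI (V i) (V j)) (V k) `<=` opensI (V j) (V k) by move=> x [[]].
have h3 : opensI (opensI (V i) (V j)) (V k) `<=` opensI (V i) (V k) by move=> x [[]].
have h4 : opensI (opensI (V i) (V j)) (V k) `<=` V i by move=> x [[]].
have h5 : opensI (opensI (V i) (V j)) (V k) `<=` V j by move=> x [[]].
have h6 : opensI (opensI (V i) (V j)) (V k) `<=` V k by move=> x [].
have := congr1 (fun g => g p (conj (conj hi hj) hk)) (dd_cocycle d h1 h2 h3 h4 h5 h6).
rewrite /= fam_compE (fam_mres _ _ _ _ _ (conj hi hk : carrier (opensI _ _) p)).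
rewrite (fam_mres _ _ _ _ _ (conj hi hj : carrier (opensI _ _) p)).
by rewrite (fam_mres _ _ _ _ _ (conj hj hk : carrier (opensI _ _) p)).
Qed.

Let T1 i p (hi : carrier (V i) p) : T hi hi = idm _.
Proof.
have e : bwd (dd_iso d i i) p (conj hi hi) ∘ T hi hi = idm _.
  exact: (congr1 (fun g => g p (conj hi hi)) (fwdK (dd_iso d i i))).
by rewrite -e -{2}(TM hi hi hi) compmA e comp1m.
Qed.

Let idx p (h : carrier U p) : {i | carrier (V i) p}.
Proof. by apply: cid; case: (cov h) => i _ Vip; exists i. Qed.

Let val_at p (s : {carrier U p} + {~ carrier U p}) : D p :=
  match s with left h => dd_obj d (sval (idx h)) p | right _ => z p end.

Let phif i p (s : {carrier U p} + {~ carrier U p}) (h : carrier (V i) p) :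
    hom (val_at s) (dd_obj d i p) :=
  match s with
  | left h' => T h (svalP (idx h'))
  | right n => match n (hVU h) with end
  end.

Let phib i p (s : {carrier U p} + {~ carrier U p}) (h : carrier (V i) p) :
    hom (dd_obj d i p) (val_at s) :=
  match s with
  | left h' => T (svalP (idx h')) h
  | right n => match n (hVU h) with end
  end.

(** At each point of U any member of the cover gives a value of the glued
    family; by the cocycle condition the choice does not matter. Outside U the
    value is the arbitrary z p. *)
Lemma families_effective : effective d (@hVU).
Proof.
pose A : families D U := fun p => val_at (pselect (carrier U p)).
pose f (i : I) : hom (res (families D) (@hVU i) A) (dd_obj d i) :=
  fun p h => phif (pselect (carrier U p)) h.
pose g (i : I) : hom (dd_obj d i) (res (families D) (@hVU i) A) :=
  fun p h => phib (pselect (carrier U p)) h.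
have e1 (i : I) : g i ∘ f i = idm _.
  apply: fam_homP => p h; rewrite fam_compE /f /g /idm /= /A.
  by case: pselect => [h'|n] /=; [rewrite TM T1 | case: (n (hVU h))].
have e2 (i : I) : f i ∘ g i = idm _.
  apply: fam_homP => p h; rewrite fam_compE /f /g /idm /= /A.
  by case: pselect => [h'|n] /=; [rewrite TM T1 | case: (n (hVU h))].
exists A, (fun i => Iso (e1 i) (e2 i)) => i j hU.
apply: fam_homP => p h; have [hi hj] := h : carrier (V i) p /\ carrier (V j) p.
have -> : h = conj hi hj by exact: Prop_irrelevance.
rewrite fam_compE (fam_mresl _ _ _ _ hj) (fam_mresl _ _ _ _ hi) /f /=.
rewrite -/(T hi hj) /A.
by case: pselect => [h'|n] /=; [rewrite TM | case: (n (hVU hi))].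
Qed.

End Descent.

Lemma families_stack (z : forall p, D p) : is_stack (families D).
Proof.
by split; [exact: families_sheaf | move=> U I V hVU cov d; exact: families_effective].
Qed.

End FamiliesStack.

(** * The family of germs *)

Section GermFamily.
Variables (X : topologicalType) (C : prestack X) (z : forall p, stalk C p).

Let D := families (stalk C).

(** Outside U the value z p is arbitrary: no morphism over U sees it. *)
Definition germ_at (U : opens X) (p : X) (s : {carrier U p} + {~ carrier U p})
    (A : C U) : stalk C p :=
  match s with left h => germ C h A | right _ => z p end.

(** The remaining branches are impossible, since p lies in W and hence in U
    and in V. *)
Definition germ_at_sec (U V W : opens X) (hU : W `<=` U) (hV : W `<=` V) (A : C U)
    (B : C V)
    (u : hom (res C hU A) (res C hV B)) (p : X) (Wp : carrier W p)
    (s : {carrier U p} + {~ carrier U p}) (t : {carrier V p} + {~ carrier V p}) :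
    hom (germ_at s A) (germ_at t B) :=
  match s, t with
  | left Up, left Vp => sgerm u Wp Up Vp
  | right n, _ => match n (hU _ Wp) with end
  | _, right n => match n (hV _ Wp) with end
  end.

Lemma germ_at_sec1 (U W : opens X) (hU : W `<=` U) (A : C U) (p : X) (Wp : carrier W p)
    (s : {carrier U p} + {~ carrier U p}) :
  germ_at_sec (idm (res C hU A)) Wp s s = idm _.
Proof.
case: s => [Up|n]; [exact: sgerm1 | by case: (n (hU _ Wp))].
Qed.

Lemma germ_at_secM (U V T W : opens X) (hU : W `<=` U) (hV : W `<=` V) (hT : W `<=` T)
    (A : C U) (B : C V) (E : C T) (v : hom (res C hV B) (res C hT E))
    (u : hom (res C hU A) (res C hV B)) (p : X) (Wp : carrier W p) s t r :
  germ_at_sec (v ∘ u) Wp s r = germ_at_sec v Wp t r ∘ germ_at_sec u Wp s t.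
Proof.
case: s => [Up|n]; last by case: (n (hU _ Wp)).
case: t => [Vp|n]; last by case: (n (hV _ Wp)).
case: r => [Tp|n]; last by case: (n (hT _ Wp)).
exact: sgermM.
Qed.

Lemma germ_at_sec_mres (U V W T : opens X) (hU : W `<=` U) (hV : W `<=` V)
    (hT : T `<=` W) (kU : T `<=` U) (kV : T `<=` V) (A : C U) (B : C V)
    (u : hom (res C hU A) (res C hV B)) (p : X) (Tp : carrier T p) (Wp : carrier W p) s
      t :
  germ_at_sec (mres hT kU kV u) Tp s t = germ_at_sec u Wp s t.
Proof.
case: s => [Up|n]; last by case: (n (hU _ Wp)).
case: t => [Vp|n]; last by case: (n (hV _ Wp)).
exact: sgerm_mres.
Qed.

Lemma germ_at_sec_inj (U V W : opens X) (hU : W `<=` U) (hV : W `<=` V) (A : C U)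
    (B : C V)
    (u v : hom (res C hU A) (res C hV B)) (p : X) (Wp : carrier W p) s t
    (Up : carrier U p) (Vp : carrier V p) :
  germ_at_sec u Wp s t = germ_at_sec v Wp s t ->
  sgerm u Wp Up Vp = sgerm v Wp Up Vp.
Proof.
case: s => [Up'|n]; last by case: (n Up).
case: t => [Vp'|n]; last by case: (n Vp).
by rewrite (Prop_irrelevance Up' Up) (Prop_irrelevance Vp' Vp).
Qed.

Program Definition germs_fun (U : opens X) : functor (C U) (D U) :=
  {| fobj := fun A p => germ_at (pselect (carrier U p)) A;
     fmor := fun A B f p h => germ_at_sec (fmor (res C (fun _ => id)) f) h _ _ |}.
Next Obligation. by move=> U A; apply: fam_homP => p h; rewrite fmor1 germ_at_sec1. Qed.
Next Obligation.
move=> U A B E g f; apply: fam_homP => p h.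
by rewrite fmorM (germ_at_secM _ _ _ _ (pselect (carrier U p))).
Qed.

Program Definition germs_pres (U V : opens X) (hVU : V `<=` U) (A : C U) :
    iso (germs_fun V (res C hVU A)) (res D hVU (germs_fun U A)) :=
  {| fwd := fun p Vp => germ_at_sec (res1 C (fun _ => id) (res C hVU A)) Vp _ _;
     bwd := fun p Vp => germ_at_sec (bwd (res1 C (fun _ => id) (res C hVU A))) Vp _ _ |}.
Next Obligation.
move=> U V hVU A; apply: fam_homP => p h.
rewrite -[LHS]/(germ_at_sec (bwd _) h (pselect (carrier U p)) (pselect (carrier V p))
  ∘ germ_at_sec (fwd _) h (pselect (carrier V p)) (pselect (carrier U p))).
by rewrite -germ_at_secM fwdK germ_at_sec1.
Qed.
Next Obligation.
move=> U V hVU A; apply: fam_homP => p h.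
rewrite -[LHS]/(germ_at_sec (fwd _) h (pselect (carrier V p)) (pselect (carrier U p))
  ∘ germ_at_sec (bwd _) h (pselect (carrier U p)) (pselect (carrier V p))).
by rewrite -germ_at_secM bwdK germ_at_sec1.
Qed.

Program Definition germs : prestack_functor C D :=
  {| pfun := germs_fun; pres := germs_pres |}.
Next Obligation.
move=> U V hVU A B f; apply: fam_homP => p h.
rewrite -[LHS]/(germ_at_sec (fwd _) h _ _ ∘ germ_at_sec _ h _ _).
rewrite -[RHS]/(germ_at_sec _ _ _ _ ∘ germ_at_sec (fwd _) h _ _).
rewrite -germ_at_secM res1_nat -(germ_at_sec_mres hVU hVU hVU (fmor _ f) h).
by rewrite -germ_at_secM mres_fmor.
Qed.
Next Obligation.
move=> U V W hVU hWV hWU A; apply: fam_homP => p h.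
rewrite !fam_compE /= comp1m.
rewrite -(germ_at_sec_mres hWV hWV hWU (fwd (res1 C _ (res C hVU A))) h).
by rewrite -!germ_at_secM res1_nat /mres -resC1l compm_bwdK.
Qed.
Next Obligation.
move=> U hUU A; apply: fam_homP => p h; rewrite fam_compE comp1m /=.
have -> : hUU = (fun _ => id) by exact: Prop_irrelevance.
by rewrite -(resC1l (fun _ => id) (fun _ => id)) resC1r.
Qed.

(** The component at p of a morphism of families of germs is a germ at p, so
    nothing is lost at p. *)
Lemma stalkf_germs_inj (p : X) (L M : stalk C p) (f g : hom L M) :
  fmor (stalkf germs p) f = fmor (stalkf germs p) g -> f = g.
Proof.
case: L M f g => [U Up A] [V Vp B] f g.
have [W [Wp [hU [hV [u [v [-> ->]]]]]]] := sgerm_parallel f g.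
rewrite !stalkf_sgerm => /sgerm_eqP [T [hT [hT' [kU [kV [Tp]]]]]].
rewrite -!fsec_mres /fsec => e.
have {}e := iso_mono (iso_epi (i := iso_inv (pres germs kU A)) e).
have := congr1 (fun k => k p Tp) e.
rewrite -(sgerm_mres hT kU kV u Tp Wp Up Vp) -(sgerm_mres hT' kU kV v Tp Wp Up Vp).
move=> /(germ_at_sec_inj Tp Tp); rewrite -!germE => {}e.
by apply: (iso_epi (i := rho kU A Tp Up)); rewrite -!rho_nat e.
Qed.

End GermFamily.

(** * Faithfulness on stalks *)

(** Families form a stack, so the functor taking germs factors through eta up
    to isomorphism; hence eta cannot identify two different germs. *)
Lemma stalkf_eta_inj (X : topologicalType) (C S : prestack X)
    (eta : prestack_functor C S) (z : forall p, stalk C p) :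
  is_associated_stack eta ->
  forall (p : X) (L M : stalk C p) (f g : hom L M),
  fmor (stalkf eta p) f = fmor (stalkf eta p) g -> f = g.
Proof.
move=> [_ univ] p L M f g e.
have [/(_ (germs z)) [H [t tiso]] _] := univ _ (families_stack z).
apply: (@stalkf_germs_inj _ _ z).
case: L M f g e => [U Up A] [V Vp B] f g e.
have [i ti] := tiso U A.
apply: (iso_epi (i := fmor_iso (germ _ Up) i)); rewrite /= ti -!(ptr_stalk t).
by rewrite !stalkf_comp e.
Qed.

(** * Objects with an atlas coming from the prestack *)

Section MoreGerms.
Variables (X : topologicalType) (C : prestack X).

Definition mres_iso (U U' V W : opens X) (hVU : V `<=` U) (hVU' : V `<=` U')
    (hWV : W `<=` V) (hWU : W `<=` U) (hWU' : W `<=` U') (A : C U) (B : C U')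
    (f : iso (res C hVU A) (res C hVU' B)) : iso (res C hWU A) (res C hWU' B).
Proof.
refine (@Iso _ _ _ (mres hWV hWU hWU' f) (mres hWV hWU' hWU (bwd f)) _ _).
  by rewrite -mresM fwdK mres1.
by rewrite -mresM bwdK mres1.
Defined.

Lemma rho_fmor (p : X) (U V : opens X) (hVU : V `<=` U) (A B : C U)
    (f : hom A B) (Vp : carrier V p) (Up : carrier U p) :
  rho hVU B Vp Up ∘ fmor (germ C Vp) (fmor (res C hVU) f)
  = fmor (germ C Up) f ∘ rho hVU A Vp Up.
Proof. by rewrite rho_nat sgerm_fmor. Qed.

End MoreGerms.

Section Charted.
Variables (X : topologicalType) (C S : prestack X) (eta : prestack_functor C S).

(** A choice of distinguished germs of morphisms to B from objects in the image
    of eta: in intent, those that come from C in the charts of B. *)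
Definition germ_pred (U : opens X) (B : S U) : Type :=
  forall p (Up : carrier U p) (L : stalk C p),
    @hom (stalk S p) (stalkf eta p L) (StalkObj Up B) -> Prop.

(** Near p the distinguished germs are those that come from C when read through
    the single isomorphism phi. For two such isomorphisms the transition between
    them therefore comes locally from C. *)
Definition has_chart (U : opens X) (B : S U) (F : germ_pred B) (p : X) : Prop :=
  exists (V : opens X) (A : C V) (W : opens X) (hV : W `<=` V) (hU : W `<=` U)
    (phi : iso (res S hV (eta V A)) (res S hU B)), carrier W p /\
    forall q (Wq : carrier W q) (Vq : carrier V q) (Uq : carrier U q)
      (L : stalk C q) psi,
      F q Uq L psi <-> exists g : @hom (stalk C q) L (StalkObj Vq A),
        psi = sgerm phi Wq Vq Uq ∘ fmor (stalkf eta q) g.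

(** The isomorphism is only needed near p. This covers both restricted objects
    and objects glued from charted pieces. *)
Lemma has_chart_iso (U U' W : opens X) (B : S U) (B' : S U') (F : germ_pred B)
    (F' : germ_pred B') (hU : W `<=` U) (hU' : W `<=` U')
    (th : iso (res S hU B) (res S hU' B')) (p : X) (Wp : carrier W p) :
  (forall q (Wq : carrier W q) (Uq : carrier U q) (U'q : carrier U' q) L psi,
    F' q U'q L psi <-> F q Uq L (sgerm (bwd th) Wq U'q Uq ∘ psi)) ->
  has_chart F p -> has_chart F' p.
Proof.
move=> FF' [V [A [T [hV [kU [phi [Tp Fphi]]]]]]].
have s1 : opensI W T `<=` W by exact: opensIl.
have s2 : opensI W T `<=` T by exact: opensIr.
pose kV := subset_trans s2 hV; pose k := subset_trans s2 kU;
  pose k' := subset_trans s1 hU'.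
exists V, A, (opensI W T), kV, k',
  (iso_comp (mres_iso s1 k k' th) (mres_iso s2 kV k phi)).
split=> // q Iq Vq U'q L psi.
have Uq := k q Iq.
rewrite (FF' q (s1 q Iq) Uq U'q) (Fphi q (s2 q Iq) Vq Uq) /=.
rewrite (sgermM _ _ _ _ Uq) (sgerm_mres s1 k k' _ Iq (s1 q Iq))
  (sgerm_mres s2 kV k _ Iq (s2 q Iq)).
split=> -[g e]; exists g.
  by rewrite -compmA -e compmA -sgermM bwdK sgerm1 comp1m.
by rewrite e compmA compmA -sgermM fwdK sgerm1 comp1m.
Qed.

(** An object of S with an atlas whose transitions come from C. An atlas is
    encoded by the germs it distinguishes instead of by its charts: what a
    morphism has to preserve is then a condition at each point, so it is local
    and glues. *)
Record charted (U : opens X) := Charted {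
  ch_obj : S U;
  ch_pred : germ_pred ch_obj;
  ch_chart : forall p, carrier U p -> has_chart ch_pred p }.

Arguments ch_pred {U} c {p} Up L psi.

Definition ch_compat (U : opens X) (A B : charted U)
    (f : hom (ch_obj A) (ch_obj B)) : Prop :=
  forall p (Up : carrier U p) (L : stalk C p) psi,
    ch_pred A Up L psi -> ch_pred B Up L (fmor (germ S Up) f ∘ psi).

Definition ch_hom (U : opens X) (A B : charted U) : Type :=
  {f : hom (ch_obj A) (ch_obj B) | ch_compat f}.

Lemma ch_homP (U : opens X) (A B : charted U) (f g : ch_hom A B) :
  sval f = sval g -> f = g.
Proof. by case: f g => [f hf] [g hg] /= e; exact: eq_exist. Qed.

Program Definition ch_cat (U : opens X) : category :=
  {| obj := charted U; hom := @ch_hom U;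
     idm := fun A => exist _ (idm (ch_obj A)) _;
     compm := fun A B E g f => exist _ (sval g ∘ sval f) _ |}.
Next Obligation. by move=> U A p Up L psi h; rewrite fmor1 comp1m. Qed.
Next Obligation.
by move=> U A B E g f p Up L psi h; rewrite fmorM -compmA; apply: (svalP g);
  apply: (svalP f).
Qed.
Next Obligation. by move=> *; apply: ch_homP; exact: comp1m. Qed.
Next Obligation. by move=> *; apply: ch_homP; exact: compm1. Qed.
Next Obligation. by move=> *; apply: ch_homP; exact: compmA. Qed.

Section ChartedIso.
Variables (U : opens X) (A B : charted U) (f : iso (ch_obj A) (ch_obj B)).
Hypothesis hf : forall p (Up : carrier U p) (L : stalk C p) psi,
  ch_pred A Up L psi <-> ch_pred B Up L (fmor (germ S Up) f ∘ psi).

Lemma ch_iso_fwd : ch_compat f. Proof. by move=> p Up L psi /hf. Qed.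

Lemma ch_iso_bwd : ch_compat (bwd f).
Proof.
by move=> p Up L psi h; apply/hf; rewrite compmA -fmorM bwdK fmor1 comp1m.
Qed.

Let g : @hom (ch_cat U) A B := exist (@ch_compat U A B) (fwd f) ch_iso_fwd.
Let h : @hom (ch_cat U) B A := exist (@ch_compat U B A) (bwd f) ch_iso_bwd.

Lemma ch_fwdK : h ∘ g = idm _. Proof. by apply: ch_homP; exact: fwdK. Qed.

Lemma ch_bwdK : g ∘ h = idm _. Proof. by apply: ch_homP; exact: bwdK. Qed.

Definition ch_iso : @iso (ch_cat U) A B := Iso ch_fwdK ch_bwdK.

End ChartedIso.

Program Definition ch_res_obj (U V : opens X) (hVU : V `<=` U) (B : charted U) :
    charted V :=
  {| ch_obj := res S hVU (ch_obj B);
     ch_pred := fun p Vp L psi =>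
       ch_pred B (hVU p Vp) L (rho hVU _ Vp (hVU p Vp) ∘ psi) |}.
Next Obligation.
move=> U V hVU B p Vp.
have kV : V `<=` V by [].
apply: (has_chart_iso (th := iso_inv (resC S hVU kV hVU (ch_obj B))) Vp _
  (ch_chart B (hVU p Vp))).
move=> q Vq Uq V'q L psi.
have e := Prop_irrelevance V'q Vq; subst V'q.
rewrite -[bwd (iso_inv _)]/(fwd (resC _ _ _ _ _)) -(rho_resC hVU kV hVU _ Vq Vq Uq).
by rewrite (Prop_irrelevance Uq (hVU q Vq)).
Qed.

Lemma ch_resE (U V : opens X) (hVU : V `<=` U) (B : charted U) (p : X)
    (Vp : carrier V p) (Up : carrier U p) (L : stalk C p) psi :
  ch_pred (ch_res_obj hVU B) Vp L psi = ch_pred B Up L (rho hVU _ Vp Up ∘ psi).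
Proof. by rewrite (Prop_irrelevance Up (hVU p Vp)). Qed.

Program Definition ch_res (U V : opens X) (hVU : V `<=` U) :
    functor (ch_cat U) (ch_cat V) :=
  {| fobj := ch_res_obj hVU;
     fmor := fun A B f => exist _ (fmor (res S hVU) (sval f)) _ |}.
Next Obligation.
move=> U V hVU A B f p Vp L psi h.
have Up := hVU p Vp; move: h; rewrite !(ch_resE Up).
by rewrite compmA rho_fmor -compmA; exact: (svalP f).
Qed.
Next Obligation. by move=> *; apply: ch_homP; exact: fmor1. Qed.
Next Obligation. by move=> *; apply: ch_homP; exact: fmorM. Qed.

Lemma ch_resC_pred (U V W : opens X) (hVU : V `<=` U) (hWV : W `<=` V)
    (hWU : W `<=` U) (A : ch_cat U) p (Wp : carrier W p) (L : stalk C p) psi :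
  ch_pred (ch_res hWV (ch_res hVU A)) Wp L psi <->
  ch_pred (ch_res hWU A) Wp L
    (fmor (germ S Wp) (resC S hVU hWV hWU (ch_obj A)) ∘ psi).
Proof.
have Vp := hWV p Wp; have Up := hVU p Vp.
rewrite /ch_res !(ch_resE Vp) !(ch_resE Up).
by rewrite !compmA (rhoC _ _ _ _ _ Vp).
Qed.

Lemma ch_res1_pred (U : opens X) (hUU : U `<=` U) (A : ch_cat U) p
    (Up : carrier U p) (L : stalk C p) psi :
  ch_pred (ch_res hUU A) Up L psi <->
  ch_pred A Up L (fmor (germ S Up) (res1 S hUU (ch_obj A)) ∘ psi).
Proof. by rewrite (ch_resE Up) rho1. Qed.

Program Definition charts : prestack X :=
  {| sec := ch_cat; res := ch_res;
     resC := fun U V W hVU hWV hWU A => ch_iso (@ch_resC_pred U V W hVU hWV hWU A);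
     res1 := fun U hUU A => ch_iso (@ch_res1_pred U hUU A) |}.
Next Obligation.
by move=> U V W h1 h2 h3 A B f; apply: ch_homP; exact: (resC_nat h1 h2 h3 (sval f)).
Qed.
Next Obligation.
by move=> U h A B f; apply: ch_homP; exact: (res1_nat h (sval f)).
Qed.
Next Obligation.
move=> U V W T h1 h2 h3 h4 h5 h6 A; apply: ch_homP.
exact: (resCA h1 h2 h3 h4 h5 h6 (ch_obj A)).
Qed.
Next Obligation.
by move=> U V h1 h2 A; apply: ch_homP; exact: (resC1l h1 h2 (ch_obj A)).
Qed.
Next Obligation.
by move=> U V h1 h2 A; apply: ch_homP; exact: (resC1r h1 h2 (ch_obj A)).
Qed.

Program Definition forget : prestack_functor charts S :=
  {| pfun := fun U => Functor (C := charts U) (D := S U) (fobj := @ch_obj U)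
       (fmor := fun A B f => sval f) _ _;
     pres := fun U V hVU A => iso_id (res S hVU (ch_obj A)) |}.
Next Obligation. by []. Qed.
Next Obligation. by []. Qed.
Next Obligation. by move=> *; rewrite comp1m compm1. Qed.
Next Obligation. by move=> *; rewrite /= fmor1 !compm1 comp1m. Qed.
Next Obligation. by move=> *; rewrite /= compm1. Qed.

End Charted.

Arguments ch_pred {X C S eta U} c {p} Up L psi.

(** * Descent for charted objects *)

Section Effective.
Variables (X : topologicalType) (C : prestack X).

Definition sec_of (U V : opens X) (hVU : V `<=` U) (A : C U) (B : C V)
    (f : iso (res C hVU A) B) : iso (res C hVU A) (res C (fun _ => id) B) :=
  iso_comp (iso_inv (res1 C (fun _ => id) B)) f.

Lemma mresl_sec (U V W : opens X) (hVU : V `<=` U) (hWV : W `<=` V)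
    (hWU : W `<=` U) (A : C U) (B : C V) (f : iso (res C hVU A) B) :
  mresl hWV hWU f = mres hWV hWU hWV (sec_of f).
Proof.
by rewrite /mresl /mres resC1l -fmorM bwd_compK.
Qed.

Lemma germ_sec_of (p : X) (U V : opens X) (hVU : V `<=` U) (A : C U) (B : C V)
    (f : iso (res C hVU A) B) (Vp : carrier V p) (Up : carrier U p) :
  fmor (germ C Vp) f = sgerm (sec_of f) Vp Up Vp ∘ rho hVU A Vp Up.
Proof.
by rewrite germE rhoE -sgermM /= -compmA -res1_nat fwd_compK.
Qed.

(** The coherence isomorphisms in the gluing condition disappear on germs. *)
Lemma effective_germ (U : opens X) (I : Type) (V : I -> opens X)
    (hVU : forall i, V i `<=` U) (d : descent_datum C V) (A : C U)
    (f : forall i, iso (res C (hVU i) A) (dd_obj d i)) :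
  (forall i j (hU : opensI (V i) (V j) `<=` U),
     dd_iso d i j ∘ mresl (@opensIr _ (V i) (V j)) hU (f j)
     = mresl (@opensIl _ (V i) (V j)) hU (f i)) ->
  forall i j q (Vi : carrier (V i) q) (Vj : carrier (V j) q)
      (Vij : carrier (opensI (V i) (V j)) q) (Uq : carrier U q),
    sgerm (dd_iso d i j) Vij Vj Vi ∘ sgerm (sec_of (f j)) Vj Uq Vj
    = sgerm (sec_of (f i)) Vi Uq Vi.
Proof.
move=> fE i j q Vi Vj Vij Uq.
have hU : opensI (V i) (V j) `<=` U by move=> x [/hVU].
rewrite -(sgerm_mres (@opensIl _ _ _) hU (@opensIl _ _ _) (sec_of (f i)) Vij) -mresl_sec
  -fE.
by rewrite mresl_sec (sgermM _ _ _ _ Vj) sgerm_mres.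
Qed.

End Effective.

Section ChartsStack.
Variables (X : topologicalType) (C S : prestack X) (eta : prestack_functor C S).
Hypothesis SS : is_stack S.
Let N := charts eta.

Lemma ch_compatP (U U' V : opens X) (hU : V `<=` U) (hU' : V `<=` U')
    (A : charted eta U) (B : charted eta U')
    (u : hom (res S hU (ch_obj A)) (res S hU' (ch_obj B))) :
  ch_compat (A := ch_res_obj hU A) (B := ch_res_obj hU' B) u <->
  forall q (Vq : carrier V q) (Uq : carrier U q) (U'q : carrier U' q)
    (L : stalk C q) psi,
    ch_pred A Uq L psi -> ch_pred B U'q L (sgerm u Vq Uq U'q ∘ psi).
Proof.
split=> [h q Vq Uq U'q L psi Apsi|h q Vq L psi].
  have := h q Vq L (bwd (rho hU (ch_obj A) Vq Uq) ∘ psi).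
  rewrite (ch_resE Uq) bwd_compK => /(_ Apsi); rewrite (ch_resE U'q).
  by rewrite compmA rho_nat -compmA bwd_compK.
have Uq := hU q Vq; have U'q := hU' q Vq.
rewrite (ch_resE Uq) (ch_resE U'q) compmA (rho_nat _ _ Uq) -compmA.
exact: h.
Qed.

Lemma charts_sheaf : homs_are_sheaves N.
Proof.
move=> U A B V hVU I W hWV hWU f cov agree.
have [g [gf guniq]] := proj1 SS U (ch_obj A) (ch_obj B) V hVU I W hWV hWU
  (fun i => sval (f i)) cov (fun i j hU => congr1 sval (agree i j hU)).
have gP : ch_compat (A := ch_res_obj hVU A) (B := ch_res_obj hVU B) g.
  apply/ch_compatP => q Vq Uq U'q L psi h.
  have [i _ Wq] := cov q Vq.
  rewrite -(sgerm_mres (hWV i) (hWU i) (hWU i) g Wq) gf.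
  have fP : ch_compat (A := ch_res_obj (hWU i) A) (B := ch_res_obj (hWU i) B)
    (sval (f i)) := svalP (f i).
  by move/ch_compatP: fP; apply.
exists (exist _ g gP); split.
  by move=> i; apply: ch_homP; exact: gf.
move=> h hf; apply: ch_homP; apply: guniq => i.
by rewrite -hf.
Qed.

Section Descent.
Variables (U : opens X) (I : Type) (V : I -> opens X).
Variable hVU : forall i, V i `<=` U.
Hypothesis cov : U `<=` \bigcup_i V i.
Variable d : descent_datum N V.

Let dS : descent_datum S V.
Proof.
refine (@DescentDatum _ S I V (fun i => ch_obj (dd_obj d i))
  (fun i j => fmor_iso (forget eta _) (dd_iso d i j)) _).
move=> i j k W hij hjk hik hi hj hk.
exact: (congr1 sval (dd_cocycle d hij hjk hik hi hj hk)).
Defined.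

(** A germ at q is distinguished for the glued object when it is so in one of
    the pieces around q, equivalently in all of them, as transitions preserve
    distinguished germs. *)
Lemma charts_effective : effective d (@hVU).
Proof.
have [A [f fE']] := proj2 SS U I V (@hVU) cov dS.
have fE := effective_germ fE'.
pose F : germ_pred eta A := fun q Uq L psi => exists i (Vq : carrier (V i) q),
  ch_pred (dd_obj d i) Vq L (sgerm (sec_of (f i)) Vq Uq Vq ∘ psi).
have FE i q Uq L psi (Vq : carrier (V i) q) :
    F q Uq L psi <-> ch_pred (dd_obj d i) Vq L (sgerm (sec_of (f i)) Vq Uq Vq ∘ psi).
  split=> [[j [Vjq]]|h]; last by exists i, Vq.
  rewrite -(fE i j q Vq Vjq (conj Vq Vjq)) -compmA.
  have gP : ch_compat (A := ch_res_obj (@opensIr _ (V i) (V j)) (dd_obj d j))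
    (B := ch_res_obj (@opensIl _ (V i) (V j)) (dd_obj d i))
    (sval (fwd (dd_iso d i j))) := svalP (fwd (dd_iso d i j)).
  by move/ch_compatP: gP; apply.
have Fch p (Up : carrier U p) : has_chart F p.
  have [i _ Vp] := cov Up.
  apply: (has_chart_iso (th := iso_inv (sec_of (f i))) Vp _ (ch_chart (dd_obj d i) Vp)).
  move=> q Vq V'q Uq L psi; have e := Prop_irrelevance V'q Vq; subst V'q.
  exact: FE.
pose B : N U := @Charted _ _ _ _ _ A F Fch.
have fP i q (Vq : carrier (V i) q) L psi :
  ch_pred (ch_res_obj (@hVU i) B) Vq L psi <->
  ch_pred (dd_obj d i) Vq L (fmor (germ S Vq) (f i) ∘ psi).
  have Uq := @hVU i q Vq.
  rewrite (ch_resE Uq) (germ_sec_of _ _ Uq) -compmA; exact: FE.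
exists B, (fun i => ch_iso (@fP i)) => i j hU; apply: ch_homP; exact: fE'.
Qed.
End Descent.

Lemma charts_stack : is_stack N.
Proof. by split; [exact: charts_sheaf | move=> U I V hVU cov d; exact: charts_effective].
  Qed.

End ChartsStack.

Section ChartsOfImage.
Variables (X : topologicalType) (C S : prestack X) (eta : prestack_functor C S).
Let N := charts eta.

Definition image_pred (U : opens X) (A : C U) : germ_pred eta (eta U A) :=
  fun p Up L psi => exists g : @hom (stalk C p) L (StalkObj Up A),
    psi = fmor (stalkf eta p) g.

Lemma image_has_chart (U : opens X) (A : C U) p : carrier U p -> has_chart
    (@image_pred U A) p.
Proof.
move=> Up; exists U, A, U, (fun _ => id), (fun _ => id), (iso_id _); split=> //.
move=> q Uq Uq' Uq'' L psi.
have e := Prop_irrelevance Uq'' Uq'; subst Uq''.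
rewrite (_ : sgerm _ _ _ _ = idm _); last exact: sgerm1.
by split=> -[g ->]; exists g; rewrite comp1m.
Qed.

Definition image_charted (U : opens X) (A : C U) : N U :=
  @Charted _ _ _ _ _ (eta U A) (@image_pred U A) (@image_has_chart U A).

Program Definition image_fun (U : opens X) : functor (C U) (N U) :=
  {| fobj := @image_charted U;
     fmor := fun A B f => exist (ch_compat (A := image_charted A) (B := image_charted B))
       (fmor (eta U) f) _ |}.
Next Obligation.
move=> U A B f p Up L psi [g ->]; exists (fmor (germ C Up) f ∘ g).
by rewrite fmorM -stalkf_germ.
Qed.
Next Obligation. by move=> *; apply: ch_homP; exact: fmor1. Qed.
Next Obligation. by move=> *; apply: ch_homP; exact: fmorM. Qed.

Lemma image_pres_pred (U V : opens X) (hVU : V `<=` U) (A : C U) p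
    (Vp : carrier V p) (L : stalk C p) psi :
  ch_pred (image_charted (res C hVU A)) Vp L psi <->
  ch_pred (res N hVU (image_charted A)) Vp L (fmor (germ S Vp) (pres eta hVU A) ∘ psi).
Proof.
have Up := hVU p Vp; rewrite (ch_resE Up) compmA -stalkf_rho.
split=> -[g e]; first by exists (rho hVU A Vp Up ∘ g); rewrite fmorM e.
exists (bwd (rho hVU A Vp Up) ∘ g); rewrite fmorM -e.
exact: esym (fwd_compK (fmor_iso (stalkf eta p) (rho hVU A Vp Up)) psi).
Qed.

Program Definition image_charts : prestack_functor C N :=
  {| pfun := image_fun;
     pres := fun U V hVU A =>
       @ch_iso _ _ _ _ _ (image_fun V (res C hVU A)) (res N hVU (image_fun U A))
         (pres eta hVU A) (@image_pres_pred U V hVU A) |}.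
Next Obligation.
by move=> U V h A B f; apply: ch_homP; exact: (pres_nat eta h f).
Qed.
Next Obligation.
by move=> U V W h1 h2 h3 A; apply: ch_homP; exact: (presC eta h1 h2 h3 A).
Qed.
Next Obligation.
by move=> U h A; apply: ch_homP; exact: (pres1 eta h A).
Qed.

End ChartsOfImage.

(** * The functor to the associated stack is an equivalence on stalks *)

Section Transformations.
Variables (X : topologicalType) (C D : prestack X).

Lemma transf_inv (F G : prestack_functor C D) (t : prestack_transf F G) :
  is_transf_iso t ->
  exists t' : prestack_transf G F, forall (U : opens X) (A : C U),
    t' U A ∘ t U A = idm _ /\ t U A ∘ t' U A = idm _.
Proof.
move=> tiso.
have [i iE] : exists i : forall (U : opens X) (A : C U), iso (F U A) (G U A),
    forall U A, fwd (i U A) = t U A.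
  by exists (fun U A => sval (cid (tiso U A))) => U A; exact: (svalP (cid (tiso U A))).
have nat' (U : opens X) (A B : C U) (f : hom A B) :
    bwd (i U B) ∘ fmor (G U) f = fmor (F U) f ∘ bwd (i U A).
  apply: (iso_epi (i := i U A)); rewrite compm_fwdK.
  apply: (iso_mono (i := i U B)); rewrite !compmA bwdK comp1m.
  by rewrite !iE ptr_nat.
have res' (U V : opens X) (hVU : V `<=` U) (A : C U) :
    fmor (res D hVU) (bwd (i U A)) ∘ pres G hVU A
    = pres F hVU A ∘ bwd (i V (res C hVU A)).
  apply: (iso_epi (i := i V (res C hVU A))); rewrite compm_fwdK.
  by rewrite iE -compmA -ptr_res compmA -iE -fmorM fwdK fmor1 comp1m.
exists (PrestackTransf nat' res') => U A /=.
by rewrite -iE fwdK bwdK.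
Qed.

Lemma transf_comp (F G H : prestack_functor C D) (s : prestack_transf G H)
    (t : prestack_transf F G) :
  exists r : prestack_transf F H, forall U A, r U A = s U A ∘ t U A.
Proof.
have nat' (U : opens X) (A B : C U) (f : hom A B) :
    (s U B ∘ t U B) ∘ fmor (F U) f = fmor (H U) f ∘ (s U A ∘ t U A).
  by rewrite -compmA ptr_nat !compmA ptr_nat.
have res' (U V : opens X) (hVU : V `<=` U) (A : C U) :
    fmor (res D hVU) (s U A ∘ t U A) ∘ pres F hVU A
    = pres H hVU A ∘ (s V (res C hVU A) ∘ t V (res C hVU A)).
  by rewrite fmorM -compmA ptr_res !compmA ptr_res.
by exists (PrestackTransf nat' res').
Qed.

Lemma transf_id (F : prestack_functor C D) :
  exists r : prestack_transf F F, forall U A, r U A = idm _.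
Proof.
have nat' (U : opens X) (A B : C U) (f : hom A B) :
    idm _ ∘ fmor (F U) f = fmor (F U) f ∘ idm _.
  by rewrite compm1 comp1m.
have res' (U V : opens X) (hVU : V `<=` U) (A : C U) :
    fmor (res D hVU) (idm _) ∘ pres F hVU A
    = pres F hVU A ∘ idm _.
  by rewrite fmor1 compm1 comp1m.
by exists (PrestackTransf nat' res').
Qed.

End Transformations.

Section AssociatedStack.
Variables (X : topologicalType) (C S : prestack X) (eta : prestack_functor C S).
Hypothesis Sass : is_associated_stack eta.

Let N := charts eta.

Lemma assoc_lift : exists (H : prestack_functor S N)
  (t : prestack_transf (prestack_functor_comp H eta) (image_charts eta)),
  is_transf_iso t.
Proof.
exact: (proj1 (proj2 Sass N (charts_stack eta (proj1 Sass))) (image_charts eta)).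
Qed.

(** Objects of S acquire atlases functorially. The functor eta lifts to charted
    objects, and these form a stack, so S lifts as well; followed by forgetting
    the atlas, the lift restricts to eta along eta, and is therefore isomorphic
    to the identity of S. *)
Lemma assoc_retract : exists (H : prestack_functor S N)
    (t : prestack_transf (prestack_functor_comp H eta) (image_charts eta))
    (s : prestack_transf (prestack_functor_comp (forget eta) H) (prestack_functor_id S)),
  [/\ is_transf_iso t, is_transf_iso s & forall U (A : C U),
    s U (eta U A) = sval (t U A)].
Proof.
have [H [t tiso]] := assoc_lift; exists H, t.
have [t' tt'] := transf_inv tiso.
pose H1 := prestack_functor_comp (forget eta) H.
pose H2 := prestack_functor_id S.
have nat1 (U : opens X) (A B : C U) (f : hom A B) :
    sval (t U B) ∘ fmor (prestack_functor_comp H1 eta U) f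
    = fmor (prestack_functor_comp H2 eta U) f ∘ sval (t U A).
  exact: (congr1 sval (ptr_nat t f)).
have res1 (U V : opens X) (hVU : V `<=` U) (A : C U) :
    fmor (res S hVU) (sval (t U A)) ∘ pres (prestack_functor_comp H1 eta) hVU A
    = pres (prestack_functor_comp H2 eta) hVU A ∘ sval (t V (res C hVU A)).
  rewrite /= !comp1m.
  exact: (congr1 sval (ptr_res t hVU A)).
have nat2 (U : opens X) (A B : C U) (f : hom A B) :
    sval (t' U B) ∘ fmor (prestack_functor_comp H2 eta U) f
    = fmor (prestack_functor_comp H1 eta U) f ∘ sval (t' U A).
  exact: (congr1 sval (ptr_nat t' f)).
have res2 (U V : opens X) (hVU : V `<=` U) (A : C U) :
    fmor (res S hVU) (sval (t' U A)) ∘ pres (prestack_functor_comp H2 eta) hVU A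
    = pres (prestack_functor_comp H1 eta) hVU A ∘ sval (t' V (res C hVU A)).
  rewrite /= !comp1m.
  exact: (congr1 sval (ptr_res t' hVU A)).
have [_ univ] := proj2 Sass S (proj1 Sass).
have [[s sE] _] := univ H1 H2 (@PrestackTransf _ _ _ (prestack_functor_comp H1 eta)
  (prestack_functor_comp H2 eta) (fun U A => sval (t U A)) nat1 res1).
have [[s' s'E] _] := univ H2 H1 (@PrestackTransf _ _ _ (prestack_functor_comp H2 eta)
  (prestack_functor_comp H1 eta) (fun U A => sval (t' U A)) nat2 res2).
exists s; split=> //.
have [ss' ss'E] := transf_comp s' s.
have [i1 i1E] := transf_id H1.
have [s's s'sE] := transf_comp s s'.
have [i2 i2E] := transf_id H2.
have e1 U A : s' U A ∘ s U A = idm _.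
  rewrite -ss'E -(i1E U A).
  have [i1' i1'E] := transf_id (prestack_functor_comp H1 eta).
  have [_ u] := univ H1 H1 i1'; apply: u => V B; rewrite i1'E.
    by rewrite ss'E sE s'E; exact: (congr1 sval (proj1 (tt' V B))).
  exact: i1E.
have e2 U A : s U A ∘ s' U A = idm _.
  rewrite -s'sE -(i2E U A).
  have [i2' i2'E] := transf_id (prestack_functor_comp H2 eta).
  have [_ u] := univ H2 H2 i2'; apply: u => V B; rewrite i2'E.
    by rewrite s'sE sE s'E; exact: (congr1 sval (proj2 (tt' V B))).
  exact: i2E.
by move=> U A; exists (Iso (e1 U A) (e2 U A)).
Qed.

(** Preservation of distinguished germs is a condition at each point, so it
    makes sense for germs of morphisms. *)
Lemma stalk_charts_pred (p : X) (U V : opens X) (Up : carrier U p) (Vp : carrier V p)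
    (A : N U) (B : N V) (f : @hom (stalk N p) (StalkObj Up A) (StalkObj Vp B))
    (L : stalk C p) psi :
  ch_pred A Up L psi -> ch_pred B Vp L (fmor (stalkf (forget eta) p) f ∘ psi).
Proof.
have [W [Wp [hU [hV [u ->]]]]] := sgermP f.
have uP : ch_compat (A := ch_res_obj hU A) (B := ch_res_obj hV B) (sval u) := svalP u.
rewrite stalkf_sgerm (_ : fsec (forget eta) u = sval u);
  last by rewrite /fsec comp1m compm1.
by move/ch_compatP: uP; apply.
Qed.

(** By the retraction, f is the germ of a morphism of charted objects. It
    preserves distinguished germs, and the identity is one; so f itself is
    distinguished, which means that it comes from C. *)
Lemma stalkf_eta_full (p : X) (L M : stalk C p)
    (f : hom (stalkf eta p L) (stalkf eta p M)) :
  exists g : hom L M, f = fmor (stalkf eta p) g.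
Proof.
have [H [t [s [tiso siso st]]]] := assoc_retract.
have [t' tt'] := transf_inv tiso.
case: L M f => [U Up A] [V Vp B] f0.
pose f : @hom (stalk S p) (StalkObj Up (eta U A)) (StalkObj Vp (eta V B)) := f0.
rewrite -/f; move: f => {f0} f.
pose h : @hom (stalk N p) (StalkObj Up (image_charts eta U A))
  (StalkObj Vp (image_charts eta V B)) :=
  fmor (germ N Vp) (t V B) ∘ fmor (stalkf H p) f ∘ fmor (germ N Up) (t' U A).
have hE : fmor (stalkf (forget eta) p) h = f.
  rewrite /h !fmorM !stalkf_germ -[fmor (forget eta V) _]st.
  rewrite -(stalkf_comp (forget eta) H f) (ptr_stalk s f) stalkf_id.
  rewrite -compmA -[RHS]compm1; congr (f ∘ _).
  have e : s U (eta U A) ∘ sval (t' U A) = idm (eta U A).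
    by rewrite st; exact: (congr1 sval (proj2 (tt' U A))).
  by rewrite -[RHS]/(idm (germ S Up (eta U A))) -fmor1 -e fmorM.
pose L : stalk C p := StalkObj Up A.
pose psi : @hom (stalk S p) (stalkf eta p L)
  (StalkObj Up (ch_obj (image_charts eta U A))) :=
  idm (stalkf eta p L).
have psiP : ch_pred (image_charts eta U A) Up L psi by exists (idm L); rewrite fmor1.
have [g fg] := stalk_charts_pred h psiP.
by exists g; rewrite -fg hE; symmetry; exact: compm1.
Qed.

(** A chart at p of the charted object over B identifies the germ of B with an
    object in the image of eta. *)
Lemma stalkf_eta_esssurj (p : X) (M : stalk S p) :
  exists (L : stalk C p) (i : iso (stalkf eta p L) M), True.
Proof.
have [H [t [s [tiso siso st]]]] := assoc_retract.
case: M => U Up B.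
have [i _] := siso U B.
have [V [A [W [hV [hU [phi [Wp _]]]]]]] := ch_chart (H U B) Up.
have Vp := hV p Wp.
exists (StalkObj Vp A : stalk C p).
by exists (iso_comp (fmor_iso (germ S Up) i) (sgerm_iso phi Wp Vp Up)).
Qed.

End AssociatedStack.

(** * Gluing morphisms and objects germ by germ *)

Section Gluing.
Variables (X : topologicalType) (S : prestack X).
Hypothesis SS : is_stack S.

Lemma fmor_res_id_inj (U : opens X) (hUU : U `<=` U) (A B : S U) (f g : hom A B) :
  fmor (res S hUU) f = fmor (res S hUU) g -> f = g.
Proof.
move=> e; apply: (iso_epi (i := res1 S hUU A)).
by rewrite -!res1_nat e.
Qed.

Lemma hom_sep (U : opens X) (A B : S U) (f g : hom A B) :
  (forall q (Uq : carrier U q), fmor (germ S Uq) f = fmor (germ S Uq) g) -> f = g.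
Proof.
move=> e; have hUU : U `<=` U by [].
pose I := {q | carrier U q}.
have loc (i : I) : exists W : opens X, carrier W (sval i) /\ exists hWU : W `<=` U,
    fmor (res S hWU) f = fmor (res S hWU) g.
  case: i => q Uq /=; have := e q Uq; rewrite -!(sgerm_fmor hUU _ Uq Uq) => /sgerm_eqP.
  move=> [T [hT [hT' [kU [kV [Tq]]]]]].
  have -> : kV = kU by exact: Prop_irrelevance.
  by rewrite !mres_fmor => e'; exists T; split=> //; exists kU.
pose W i := sval (cid (loc i)).
have Wi i : carrier (W i) (sval i) by case: (svalP (cid (loc i))).
have hWU i : W i `<=` U by case: (svalP (cid (loc i))) => _ [].
have fg i : fmor (res S (hWU i)) f = fmor (res S (hWU i)) g.
  case: (svalP (cid (loc i))) => _ [h]; rewrite -/(W i) in h *.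
  by rewrite (Prop_irrelevance (hWU i) h).
have [k [kf ku]] := proj1 SS U A B U hUU I W hWU hWU (fun i => fmor (res S (hWU i)) f)
  (fun q Uq => ex_intro2 _ _ (exist _ q Uq : I) Logic.I (Wi (exist _ q Uq)))
  (fun i j hU => etrans (mres_fmor _ _ _ f) (esym (mres_fmor _ _ _ f))).
apply: (fmor_res_id_inj (hUU := hUU)).
rewrite -(ku (fmor (res S hUU) f)); last by move=> i; rewrite mres_fmor.
by apply: ku => i; rewrite mres_fmor.
Qed.

Lemma sec_sep (U V W : opens X) (hU : W `<=` U) (hV : W `<=` V) (A : S U) (B : S V)
    (u v : hom (res S hU A) (res S hV B)) :
  (forall q (Wq : carrier W q) (Uq : carrier U q) (Vq : carrier V q),
     sgerm u Wq Uq Vq = sgerm v Wq Uq Vq) -> u = v.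
Proof.
move=> e; apply: hom_sep => q Wq; have Uq := hU q Wq; have Vq := hV q Wq.
by apply: (iso_mono (i := rho hV B Wq Vq)); rewrite !(rho_nat _ _ Uq) e.
Qed.

(** Local solutions of a condition with at most one solution on germs agree on
    overlaps, so they glue. *)
Lemma hom_glue (U : opens X) (A B : S U)
    (P : forall q (Uq : carrier U q),
       @hom (stalk S q) (StalkObj Uq A) (StalkObj Uq B) -> Prop) :
  (forall q Uq f g, P q Uq f -> P q Uq g -> f = g) ->
  (forall p, carrier U p -> exists (W : opens X) (hWU : W `<=` U)
     (u : hom (res S hWU A) (res S hWU B)), carrier W p /\
     forall q (Wq : carrier W q) (Uq : carrier U q), P q Uq (sgerm u Wq Uq Uq)) ->
  exists f : hom A B, forall q (Uq : carrier U q), P q Uq (fmor (germ S Uq) f).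
Proof.
move=> Puniq loc; have hUU : U `<=` U by [].
pose I := {q | carrier U q}.
have {}loc (i : I) : {W : opens X &
  {hWU : W `<=` U & {u : hom (res S hWU A) (res S hWU B) |
    carrier W (sval i) /\
     forall q (Wq : carrier W q) (Uq : carrier U q), P q Uq (sgerm u Wq Uq Uq)}}}.
  have /cid [W /cid [hWU /cid h]] := loc (sval i) (svalP i).
  by exists W, hWU.
pose W i := projT1 (loc i).
pose hWU i : W i `<=` U := projT1 (projT2 (loc i)).
pose u i : hom (res S (hWU i) A) (res S (hWU i) B) := sval (projT2 (projT2 (loc i))).
have Wi i : carrier (W i) (sval i) := proj1 (svalP (projT2 (projT2 (loc i)))).
have uP i : forall q (Wq : carrier (W i) q) (Uq : carrier U q),
  P q Uq (sgerm (u i) Wq Uq Uq)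
  := proj2 (svalP (projT2 (projT2 (loc i)))).
have agree i j (hU : opensI (W i) (W j) `<=` U) :
     mres (@opensIl _ (W i) (W j)) hU hU (u i)
     = mres (@opensIr _ (W i) (W j)) hU hU (u j).
  apply: sec_sep => q Wq Uq Vq; have [Wiq Wjq] := Wq : carrier (W i) q /\ carrier (W j) q.
  rewrite (sgerm_mres _ _ _ _ _ Wiq) (sgerm_mres _ _ _ _ _ Wjq).
  rewrite (Prop_irrelevance Vq Uq); exact: Puniq (uP _ _ _ _) (uP _ _ _ _).
have [k [ku _]] := proj1 SS U A B U hUU I W hWU hWU u
  (fun q Uq => ex_intro2 _ _ (exist _ q Uq : I) Logic.I (Wi (exist _ q Uq))) agree.
exists (res1 S hUU B ∘ k ∘ bwd (res1 S hUU A)) => q Uq.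
have -> : fmor (germ S Uq) (res1 S hUU B ∘ k ∘ bwd (res1 S hUU A)) = sgerm k Uq Uq Uq.
  rewrite !fmorM rho1; apply: (iso_epi (i := rho hUU A Uq Uq)).
  rewrite -rho_nat -[RHS]compm1 -fmor1 -(fwdK (res1 S hUU A)) fmorM rho1 !compmA.
  by [].
rewrite -(sgerm_mres (hWU (exist _ q Uq)) (hWU (exist _ q Uq)) (hWU (exist _ q Uq)) k
  (Wi (exist _ q Uq))).
by rewrite ku; exact: uP.
Qed.

Lemma sec_glue (U V T : opens X) (hU : T `<=` U) (hV : T `<=` V) (A : S U) (B : S V)
    (P : forall q (Uq : carrier U q) (Vq : carrier V q),
       @hom (stalk S q) (StalkObj Uq A) (StalkObj Vq B) -> Prop) :
  (forall q Uq Vq f g, carrier T q -> P q Uq Vq f -> P q Uq Vq g -> f = g) ->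
  (forall p, carrier T p -> exists (W : opens X) (kU : W `<=` U) (kV : W `<=` V)
     (u : hom (res S kU A) (res S kV B)), carrier W p /\
     forall q (Wq : carrier W q) (Uq : carrier U q) (Vq : carrier V q),
       P q Uq Vq (sgerm u Wq Uq Vq)) ->
  exists u : hom (res S hU A) (res S hV B),
    forall q (Tq : carrier T q) (Uq : carrier U q) (Vq : carrier V q),
      P q Uq Vq (sgerm u Tq Uq Vq).
Proof.
move=> Puniq loc.
have [q Tq f g Pf Pg|p Tp|f fP] := @hom_glue T (res S hU A) (res S hV B) (fun q Tq f =>
  P q (hU q Tq) (hV q Tq) (rho hV B Tq (hV q Tq) ∘ f ∘ bwd (rho hU A Tq (hU q Tq)))).
- exact: iso_mono (iso_epi (i := iso_inv (rho hU A Tq (hU q Tq)))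
    (Puniq _ _ _ _ _ Tq Pf Pg)).
- have [W [kU [kV [u [Wp uP]]]]] := loc p Tp.
  have s1 : opensI W T `<=` W by exact: opensIl.
  have s2 : opensI W T `<=` T by exact: opensIr.
  exists (opensI W T), s2.
  have lU := subset_trans s1 kU. have lV := subset_trans s1 kV.
  exists (bwd (resC S hV s2 lV B) ∘ mres s1 lU lV u ∘ resC S hU s2 lU A);
    split=> // q Iq Tq.
  have Wq := s1 q Iq.
  rewrite (sgermM _ _ _ _ (hU q Tq)) (sgermM _ _ _ _ (hV q Tq)) (sgerm_mres _ _ _ _ _ Wq).
  rewrite (rho_resC hV s2 lV B Iq Tq) !compmA -sgermM bwdK sgerm1 comp1m.
  rewrite -(rho_resC hU s2 lU A Iq Tq) compm_bwdK.
  exact: uP.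
exists f => q Tq Uq Vq; have := fP q Tq; rewrite (rho_nat _ _ (hU q Tq)) compm_bwdK.
by rewrite (Prop_irrelevance Uq (hU q Tq)) (Prop_irrelevance Vq (hV q Tq)).
Qed.

Section ObjectGluing.
Variables (U : opens X) (I : Type) (V : I -> opens X).
Hypotheses (hVU : forall i, V i `<=` U) (cov : U `<=` \bigcup_i V i).
Variable K : forall i, S (V i).
Variable E : forall i j q (Vi : carrier (V i) q) (Vj : carrier (V j) q),
  @hom (stalk S q) (StalkObj Vj (K j)) (StalkObj Vi (K i)) -> Prop.
Arguments E {i j q} Vi Vj _.
Hypothesis Euniq : forall i j q (Vi : carrier (V i) q) (Vj : carrier (V j) q) f g,
  E Vi Vj f -> E Vi Vj g -> f = g.
Hypothesis Eid : forall i q (Vi : carrier (V i) q), E Vi Vi (idm _).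
Hypothesis Ecomp : forall i j k q (Vi : carrier (V i) q) (Vj : carrier (V j) q)
  (Vk : carrier (V k) q) f g, E Vi Vj f -> E Vj Vk g -> E Vi Vk (f ∘ g).
Hypothesis Eloc : forall i j p, carrier (V i) p -> carrier (V j) p ->
  exists (W : opens X) (kj : W `<=` V j) (ki : W `<=` V i)
    (u : hom (res S kj (K j)) (res S ki (K i))), carrier W p /\
    forall q (Wq : carrier W q) (Vi : carrier (V i) q) (Vj : carrier (V j) q),
      E Vi Vj (sgerm u Wq Vj Vi).

Lemma transition i j : {u : hom (res S (@opensIr _ (V i) (V j)) (K j))
      (res S (@opensIl _ (V i) (V j)) (K i)) |
    forall q (Wq : carrier (opensI (V i) (V j)) q) (Vi : carrier (V i) q)
      (Vj : carrier (V j) q), E Vi Vj (sgerm u Wq Vj Vi)}.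
Proof.
apply: cid.
have [q Vj Vi f g _ fE gE|p [Vi Vj]|u uP] :=
  @sec_glue (V j) (V i) (opensI (V i) (V j)) (@opensIr _ _ _)
  (@opensIl _ _ _) (K j) (K i) (fun q Vj Vi f => E Vi Vj f).
- exact: Euniq fE gE.
- have [W [kj [ki [u [Wp uP]]]]] := Eloc Vi Vj.
  by exists W, kj, ki, u; split=> // q Wq Vjq Viq; exact: uP.
by exists u => q Wq Vi Vj; exact: uP.
Qed.

Lemma transition_fwdK i j (hij : opensI (V i) (V j) `<=` opensI (V j) (V i)) :
  mres hij (@opensIl _ (V i) (V j)) (@opensIr _ (V i) (V j)) (sval (transition j i))
  ∘ sval (transition i j) = idm _.
Proof.
apply: sec_sep => q Wq Viq Viq'; have e := Prop_irrelevance Viq' Viq; subst Viq'.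
have [Vi _] := Wq : carrier (V i) q /\ carrier (V j) q.
rewrite (sgermM _ _ _ _ Vi) (sgerm_mres _ _ _ _ _ (hij _ Wq)) sgerm1.
apply: (Euniq _ (Eid _)); apply: Ecomp (svalP (transition i j) _ _ _ _);
  exact: (svalP (transition j i)).
Qed.

Lemma transition_bwdK i j (hij : opensI (V i) (V j) `<=` opensI (V j) (V i)) :
  sval (transition i j) ∘
  mres hij (@opensIl _ (V i) (V j)) (@opensIr _ (V i) (V j)) (sval (transition j i))
  = idm _.
Proof.
apply: sec_sep => q Wq Viq Viq'; have e := Prop_irrelevance Viq' Viq; subst Viq'.
have [_ Vj] := Wq : carrier (V i) q /\ carrier (V j) q.
rewrite (sgermM _ _ _ _ Vj) (sgerm_mres _ _ _ _ _ (hij _ Wq)) sgerm1.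
apply: (Euniq _ (Eid _)); apply: Ecomp (svalP (transition j i) _ _ _ _);
  exact: (svalP (transition i j)).
Qed.

Definition transition_iso i j : iso (res S (@opensIr _ (V i) (V j)) (K j))
    (res S (@opensIl _ (V i) (V j)) (K i)) :=
  Iso (transition_fwdK (fun x h => conj (proj2 h) (proj1 h)))
    (transition_bwdK (fun x h => conj (proj2 h) (proj1 h))).

(** Since germs satisfying E are unique, the transitions they define satisfy the
    cocycle condition for free, and any germ satisfying E is one of them. *)
Lemma obj_glue : exists (A : S U)
    (s : forall i, iso (res S (@hVU i) A) (res S (fun _ => id) (K i))),
  forall i j q (Vi : carrier (V i) q) (Vj : carrier (V j) q) (Uq : carrier U q) f,
    E Vi Vj f -> f ∘ sgerm (s j) Vj Uq Vj = sgerm (s i) Vi Uq Vi.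
Proof.
unshelve epose (d := @DescentDatum _ S I V K transition_iso _).
  move=> i j k W hij hjk hik hi hj hk.
  apply: sec_sep => q Wq Vk Vi; have Vj := hj q Wq.
  rewrite (sgermM _ _ _ _ Vj) (sgerm_mres _ _ _ _ _ (hij _ Wq)).
  rewrite (sgerm_mres _ _ _ _ _ (hjk _ Wq)) (sgerm_mres _ _ _ _ _ (hik _ Wq)).
  apply: (@Euniq i k q Vi Vk); last exact: (svalP (transition i k)).
  by apply: (Ecomp (Vj := Vj)); exact: (svalP (transition _ _)).
have [A [f fE]] := proj2 SS U I V (@hVU) cov d.
exists A, (fun i => sec_of (f i)) => i j q Vi Vj Uq g gE.
rewrite -(effective_germ fE Vi Vj (conj Vi Vj) Uq); congr (_ ∘ _).
apply: Euniq gE _; exact: (svalP (transition i j)).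
Qed.

End ObjectGluing.

End Gluing.

(** * Kernels and cokernels in preadditive categories *)

Section ZeroMorphisms.
Variable C : category.

Lemma zero_mor_compl (A B D : C) (g : hom B D) (f : hom A B) :
  is_zero_mor f -> is_zero_mor (g ∘ f).
Proof. by move=> [Z [Z0 [a [b ->]]]]; exists Z; split=> //; exists a, (g ∘ b);
  rewrite compmA. Qed.

Lemma zero_mor_compr (A B D : C) (g : hom B D) (f : hom A B) :
  is_zero_mor g -> is_zero_mor (g ∘ f).
Proof. by move=> [Z [Z0 [a [b ->]]]]; exists Z; split=> //; exists (a ∘ f), b;
  rewrite compmA. Qed.

Lemma is_kernel_iso (A A' B B' K K' : C) (a : iso A A') (b : iso B B')
    (c : iso K K') (k : hom K A) (k' : hom K' A') (f : hom A B) (f' : hom A' B') :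
  f' ∘ a = b ∘ f -> k' ∘ c = a ∘ k -> is_kernel k f -> is_kernel k' f'.
Proof.
move=> ef ek [fk0 uk].
have {}ef : f' = b ∘ f ∘ bwd a by rewrite -ef compm_bwdK.
have {}ek : k' = a ∘ k ∘ bwd c by rewrite -ek compm_bwdK.
split.
  rewrite ef ek !compmA compm_fwdK.
  by apply: zero_mor_compr; rewrite -compmA; exact: zero_mor_compl.
move=> T g fg0.
have [|u [uE uu]] := uk T (bwd a ∘ g).
  have := zero_mor_compl (bwd b) fg0.
  by rewrite ef !compmA fwdK comp1m.
exists (c ∘ u); split; first by rewrite ek compmA compm_fwdK -compmA uE bwd_compK.
move=> v vE; apply: (iso_mono (i := iso_inv c)); rewrite /= fwd_compK; apply: uu.
by rewrite -vE ek !compmA fwdK comp1m.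
Qed.

Lemma is_cokernel_iso (A A' B B' K K' : C) (a : iso A A') (b : iso B B')
    (c : iso K K') (k : hom B K) (k' : hom B' K') (f : hom A B) (f' : hom A' B') :
  f' ∘ a = b ∘ f -> c ∘ k = k' ∘ b -> is_cokernel f k -> is_cokernel f' k'.
Proof.
move=> ef ek [fk0 uk].
have {}ef : f' = b ∘ f ∘ bwd a by rewrite -ef compm_bwdK.
have {}ek : k' = c ∘ k ∘ bwd b by rewrite ek compm_bwdK.
split.
  rewrite ef ek !compmA compm_fwdK.
  by apply: zero_mor_compr; rewrite -compmA; exact: zero_mor_compl.
move=> T g fg0.
have [|u [uE uu]] := uk T (g ∘ b).
  by have := zero_mor_compr a fg0; rewrite ef !compmA compm_fwdK.
exists (u ∘ bwd c); split; first by rewrite ek !compmA compm_fwdK uE compm_bwdK.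
move=> v vE; apply: (iso_epi (i := c)); rewrite compm_fwdK; apply: uu.
by rewrite -vE ek !compmA compm_fwdK.
Qed.

(** The morphism g kills f, so it factors through the cokernel c; whatever c
    kills is then killed by g. *)
Lemma normal_mono_coker (A B D K : C) (f : hom A B) (g : hom B D) (c : hom B K) :
  is_kernel f g -> is_cokernel f c -> is_kernel f c.
Proof.
move=> [gf0 uf] [cf0 uc]; split=> // T h ch0.
have [u [uE _]] := uc D g gf0.
by apply: uf; rewrite -uE -compmA; exact: zero_mor_compl.
Qed.

Lemma normal_epi_ker (A B D K : C) (f : hom A B) (g : hom D A) (k : hom K A) :
  is_cokernel g f -> is_kernel k f -> is_cokernel k f.
Proof.
move=> [fg0 uf] [fk0 uk]; split=> // T h hk0.
have [u [uE _]] := uk D g fg0.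
by apply: uf; rewrite -uE compmA; exact: zero_mor_compr.
Qed.

End ZeroMorphisms.

Section Preadditive.
Variables (C : category) (ad : preadditive C).
Local Notation "f +' g" := (addm ad f g) (at level 50, left associativity).
Local Notation "0'" := (zerom ad _ _).

Lemma addm0 (A B : C) (f : hom A B) : f +' 0' = f.
Proof. by rewrite addmC add0m. Qed.

Lemma addmN (A B : C) (f : hom A B) : f +' oppm ad f = 0'.
Proof. by rewrite addmC addNm. Qed.

Lemma addmI (A B : C) (f g h : hom A B) : f +' g = f +' h -> g = h.
Proof. by move=> /(congr1 (addm ad (oppm ad f))); rewrite !addmA addNm !add0m. Qed.

Lemma comp0m (A B D : C) (f : hom A B) : zerom ad B D ∘ f = 0'.
Proof. by apply: (@addmI _ _ (zerom ad B D ∘ f)); rewrite -compmDl add0m addm0. Qed.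

Lemma compm0 (A B D : C) (f : hom B D) : f ∘ zerom ad A B = 0'.
Proof. by apply: (@addmI _ _ (f ∘ zerom ad A B)); rewrite -compmDr add0m addm0. Qed.

Lemma oppm_unique (A B : C) (f g : hom A B) : f +' g = 0' -> g = oppm ad f.
Proof. by move=> e; apply: (addmI (f := f)); rewrite e addmN. Qed.

Lemma subm_eq0 (A B : C) (f g : hom A B) : f +' oppm ad g = 0' -> f = g.
Proof.
by move=> e; apply: (addmI (f := oppm ad g)); rewrite addmC e addNm.
Qed.

Lemma compmNr (A B D : C) (h : hom B D) (f : hom A B) : h ∘ oppm ad f = oppm ad (h ∘ f).
Proof. by apply: oppm_unique; rewrite -compmDr addmN compm0. Qed.

Lemma compmNl (A B D : C) (h : hom B D) (f : hom A B) : oppm ad h ∘ f = oppm ad (h ∘ f).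
Proof. by apply: oppm_unique; rewrite -compmDl addmN comp0m. Qed.

Lemma zero_objP (Z : C) : is_zero_obj Z <-> idm Z = zerom ad Z Z.
Proof.
split=> [Z0|e A].
  have [[f [_ fu]] _] := Z0 Z.
  exact: etrans (esym (fu (idm Z) Logic.I)) (fu 0' Logic.I).
split.
  exists 0'; split=> // f _; rewrite -[f]comp1m e comp0m //.
by exists 0'; split=> // f _; rewrite -[f]compm1 e compm0.
Qed.

Hypothesis zero : exists Z : C, is_zero_obj Z.

Lemma zero_morP (A B : C) (f : hom A B) : is_zero_mor f <-> f = 0'.
Proof.
split=> [[Z [/zero_objP Z0 [a [b ->]]]]|->].
  by rewrite -[b]compm1 Z0 compm0 comp0m.
have [Z Z0] := zero; exists Z; split=> //; exists 0', 0'.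
by rewrite comp0m.
Qed.

Lemma kernelP (K A B : C) (k : hom K A) (f : hom A B) :
  is_kernel k f <-> f ∘ k = 0' /\
    forall (T : C) (g : hom T A), f ∘ g = 0' -> exists! u : hom T K, k ∘ u = g.
Proof.
split=> -[/zero_morP fk uk]; split=> //.
  by move=> T g /zero_morP; exact: uk.
by move=> T g /zero_morP; exact: uk.
Qed.

Lemma cokernelP (K A B : C) (f : hom A B) (c : hom B K) :
  is_cokernel f c <-> c ∘ f = 0' /\
    forall (T : C) (g : hom B T), g ∘ f = 0' -> exists! u : hom K T, u ∘ c = g.
Proof.
split=> -[/zero_morP fk uk]; split=> //.
  by move=> T g /zero_morP; exact: uk.
by move=> T g /zero_morP; exact: uk.
Qed.

Lemma kernel_mono (K A B : C) (k : hom K A) (f : hom A B) :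
  is_kernel k f -> is_mono k.
Proof.
move=> [fk0 uk] T g h e.
have [|u [_ uu]] := uk T (k ∘ h); first by rewrite compmA; exact: zero_mor_compr.
by rewrite -(uu g e) (uu h).
Qed.

Lemma cokernel_epi (K A B : C) (f : hom A B) (c : hom B K) :
  is_cokernel f c -> is_epi c.
Proof.
move=> [fk0 uk] T g h e.
have [|u [_ uu]] := uk T (h ∘ c); first by rewrite -compmA; exact: zero_mor_compl.
by rewrite -(uu g e) (uu h).
Qed.

(** Two morphisms with the same composite with f differ by a morphism that f
    kills, which factors through k. *)
Lemma kernel0_mono (K A B : C) (k : hom K A) (f : hom A B) :
  is_kernel k f -> k = 0' <-> is_mono f.
Proof.
move=> /[dup] /kernelP [fk0 uk] kk; split=> [k0 T g h e|fm].
  apply: subm_eq0; have [|u [<- _]] := uk T (g +' oppm ad h).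
    by rewrite compmDr compmNr e addmN.
  by rewrite k0 comp0m.
by apply: fm; rewrite fk0 compm0.
Qed.

Lemma cokernel0_epi (K A B : C) (f : hom A B) (c : hom B K) :
  is_cokernel f c -> c = 0' <-> is_epi f.
Proof.
move=> /[dup] /cokernelP [fk0 uk] kk; split=> [k0 T g h e|fm].
  apply: subm_eq0; have [|u [<- _]] := uk T (g +' oppm ad h).
    by rewrite compmDl compmNl e addmN.
  by rewrite k0 compm0.
by apply: fm; rewrite fk0 comp0m.
Qed.

End Preadditive.

(** * Transport along an equivalence of categories *)

Section Equivalence.
Variables (C D : category) (F : functor C D).
Hypothesis Finj : forall (A B : C) (f g : hom A B), fmor F f = fmor F g -> f = g.
Hypothesis Ffull : forall (A B : C) (f : hom (F A) (F B)), exists g, f = fmor F g.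
Hypothesis Fess : forall B : D, exists (A : C) (i : iso (F A) B), True.

Section Transport.
Variable ad : preadditive C.

Let lift_obj (B : D) : C := sval (cid (Fess B)).
Let lift_iso (B : D) : iso (F (lift_obj B)) B := sval (cid (svalP (cid (Fess B)))).
Let lift (A B : D) (f : hom A B) : hom (lift_obj A) (lift_obj B) :=
  sval (cid (Ffull (bwd (lift_iso B) ∘ f ∘ lift_iso A))).
Let unlift (A B : D) (f : hom (lift_obj A) (lift_obj B)) : hom A B :=
  lift_iso B ∘ fmor F f ∘ bwd (lift_iso A).

Let liftE A B (f : hom A B) : fmor F (lift f) = bwd (lift_iso B) ∘ f ∘ lift_iso A.
Proof. by rewrite /lift; case: (cid _) => g /= <-. Qed.

Let liftK A B (f : hom A B) : unlift (lift f) = f.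
Proof. by rewrite /unlift liftE !compmA bwdK comp1m compm_bwdK. Qed.

Let unliftK A B (f : hom (lift_obj A) (lift_obj B)) : lift (unlift f) = f.
Proof. by apply: Finj; rewrite liftE /unlift !compmA fwdK comp1m compm_fwdK. Qed.

Let lift_inj A B (f g : hom A B) : lift f = lift g -> f = g.
Proof. by move=> e; rewrite -[f]liftK e liftK. Qed.

Let liftM A B E (g : hom B E) (f : hom A B) : lift (g ∘ f) = lift g ∘ lift f.
Proof.
by apply: Finj; rewrite fmorM !liftE !compmA compm_bwdK.
Qed.

Program Definition transport : preadditive D :=
  {| addm := fun A B f g => unlift (addm ad (lift f) (lift g));
     zerom := fun A B => unlift (zerom ad _ _);
     oppm := fun A B f => unlift (oppm ad (lift f)) |}.
Next Obligation. by move=> A B f g h; rewrite !unliftK addmA. Qed.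
Next Obligation. by move=> A B f g; rewrite addmC. Qed.
Next Obligation. by move=> A B f; rewrite unliftK add0m liftK. Qed.
Next Obligation. by move=> A B f; rewrite unliftK addNm. Qed.
Next Obligation.
by move=> A B E g h f; apply: lift_inj; rewrite liftM !unliftK compmDl !liftM.
Qed.
Next Obligation.
by move=> A B E h f g; apply: lift_inj; rewrite liftM !unliftK compmDr !liftM.
Qed.

(** The preimage chosen for F A need not be A, but the two differ by an
    isomorphism, and composition with it is additive. *)
Lemma transport_additive : additive_functor ad transport F.
Proof.
move=> A B f g; apply: lift_inj; rewrite [in RHS]unliftK.
have [i iE] := Ffull (fwd (lift_iso (F A))).
have [j jE] := Ffull (bwd (lift_iso (F B))).
have lE (h : hom A B) : lift (fmor F h) = j ∘ h ∘ i.
  by apply: Finj; rewrite liftE !fmorM iE jE.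
by rewrite !lE compmDr compmDl.
Qed.

End Transport.

Variables (adC : preadditive C) (adD : preadditive D).
Hypothesis Fadd : additive_functor adC adD F.
Hypotheses (zC : exists Z : C, is_zero_obj Z).

Lemma additive_functor0 (A B : C) : fmor F (zerom adC A B) = zerom adD (F A) (F B).
Proof.
by apply: (addmI (ad := adD) (f := fmor F (zerom adC A B))); rewrite -Fadd add0m addm0.
Qed.

Lemma additive_functorN (A B : C) (f : hom A B) :
  fmor F (oppm adC f) = oppm adD (fmor F f).
Proof. by apply: oppm_unique; rewrite -Fadd addmN additive_functor0. Qed.

Lemma additive_functor_zero_obj (Z : C) : is_zero_obj Z -> is_zero_obj (F Z).
Proof.
by move=> /(zero_objP adC) Z0; apply/(zero_objP adD); rewrite -fmor1 Z0 additive_functor0.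
Qed.

Lemma equiv_zero_obj : exists Z : D, is_zero_obj Z.
Proof. by have [Z Z0] := zC; exists (F Z); exact: additive_functor_zero_obj. Qed.

Let zD := equiv_zero_obj.

Lemma equiv_kernel (K A B : C) (k : hom K A) (f : hom A B) :
  is_kernel k f -> is_kernel (fmor F k) (fmor F f).
Proof.
move=> /(kernelP adC zC) [fk0 uk]; apply/(kernelP adD zD); split.
  by rewrite -fmorM fk0 additive_functor0.
move=> T g fg0; have [L [i _]] := Fess T.
have [h hE] := Ffull (g ∘ i).
have [|u [uE uu]] := uk L h.
  by apply: Finj; rewrite fmorM -hE compmA fg0 comp0m additive_functor0.
exists (fmor F u ∘ bwd i); split; first by rewrite compmA -fmorM uE -hE compm_bwdK.
move=> v vE; apply: (iso_epi (i := i)); rewrite compm_fwdK.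
have [w wE] := Ffull (v ∘ i).
rewrite wE (uu w) //; apply: Finj.
by rewrite fmorM -wE compmA vE hE.
Qed.

Lemma equiv_cokernel (K A B : C) (f : hom A B) (c : hom B K) :
  is_cokernel f c -> is_cokernel (fmor F f) (fmor F c).
Proof.
move=> /(cokernelP adC zC) [fk0 uk]; apply/(cokernelP adD zD); split.
  by rewrite -fmorM fk0 additive_functor0.
move=> T g fg0; have [L [i _]] := Fess T.
have [h hE] := Ffull (bwd i ∘ g).
have [|u [uE uu]] := uk L h.
  by apply: Finj; rewrite fmorM -hE -compmA fg0 compm0 additive_functor0.
exists (i ∘ fmor F u); split; first by rewrite -compmA -fmorM uE -hE bwd_compK.
move=> v vE; apply: (iso_mono (i := iso_inv i)); rewrite /= fwd_compK.
have [w wE] := Ffull (bwd i ∘ v).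
rewrite wE (uu w) //; apply: Finj.
by rewrite fmorM -wE -compmA vE hE.
Qed.

Lemma equiv_normal_mono :
  (forall (A B : C) (f : hom A B), is_mono f -> exists (E : C) (g : hom B E),
    is_kernel f g) ->
  forall (A B : D) (f : hom A B), is_mono f -> exists (E : D) (g : hom B E),
    is_kernel f g.
Proof.
move=> norm A B f fm; have [L [i _]] := Fess A; have [M [j _]] := Fess B.
have [h hE] := Ffull (bwd j ∘ f ∘ i).
have [|E [g /equiv_kernel gk]] := norm L M h.
  move=> T u v e; apply: Finj; apply: (iso_mono (i := i)); apply: fm.
  apply: (iso_mono (i := iso_inv j)) => /=.
  by rewrite !compmA hE -!fmorM e.
exists (F E), (fmor F g ∘ bwd j).
apply: (is_kernel_iso (a := j) (b := iso_id _) (c := i) _ _ gk).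
  by rewrite compm_fwdK comp1m.
by rewrite -hE !compmA bwdK comp1m.
Qed.

Lemma equiv_normal_epi :
  (forall (A B : C) (f : hom A B), is_epi f -> exists (E : C) (g : hom E A),
    is_cokernel g f) ->
  forall (A B : D) (f : hom A B), is_epi f -> exists (E : D) (g : hom E A),
    is_cokernel g f.
Proof.
move=> norm A B f fm; have [L [i _]] := Fess A; have [M [j _]] := Fess B.
have [h hE] := Ffull (bwd j ∘ f ∘ i).
have [|E [g /equiv_cokernel gk]] := norm L M h.
  move=> T u v e; apply: Finj; apply: (iso_epi (i := iso_inv j)) => /=; apply: fm.
  apply: (iso_epi (i := i)).
  by rewrite -!compmA (compmA (bwd j)) hE -!fmorM e.
exists (F E), (i ∘ fmor F g).
apply: (is_cokernel_iso (a := iso_id _) (b := i) (c := j) _ _ gk).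
  by rewrite compm1.
by rewrite -hE !compmA bwdK comp1m.
Qed.

End Equivalence.

(** * Sums of germs *)

Section GermSums.
Variables (X : topologicalType) (C : prestack X).
Variable ad : forall U : opens X, preadditive (C U).
Hypothesis adres : forall (U V : opens X) (hVU : V `<=` U),
  additive_functor (ad U) (ad V) (res C hVU).

Lemma mresD (U U' V W : opens X) (hVU : V `<=` U) (hVU' : V `<=` U')
    (hWV : W `<=` V) (hWU : W `<=` U) (hWU' : W `<=` U') (A : C U) (B : C U')
    (f g : hom (res C hVU A) (res C hVU' B)) :
  mres hWV hWU hWU' (addm (ad V) f g)
  = addm (ad W) (mres hWV hWU hWU' f) (mres hWV hWU hWU' g).
Proof. by rewrite /mres adres compmDr compmDl. Qed.

Lemma mres0 (U U' V W : opens X) (hVU : V `<=` U) (hVU' : V `<=` U')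
    (hWV : W `<=` V) (hWU : W `<=` U) (hWU' : W `<=` U') (A : C U) (B : C U') :
  mres hWV hWU hWU' (zerom (ad V) (res C hVU A) (res C hVU' B))
  = zerom (ad W) _ _.
Proof.
set z := zerom _ _ _.
by apply: (addmI (ad := ad W) (f := mres hWV hWU hWU' z)); rewrite -mresD add0m addm0.
Qed.

Section At.
Variable p : X.

Lemma sgermD_unique (U V W W' : opens X) (hU : W `<=` U) (hV : W `<=` V)
    (hU' : W' `<=` U) (hV' : W' `<=` V) (A : C U) (B : C V)
    (u v : hom (res C hU A) (res C hV B)) (u' v' : hom (res C hU' A) (res C hV' B))
    (Wp : carrier W p) (W'p : carrier W' p) (Up : carrier U p) (Vp : carrier V p) :
  sgerm u Wp Up Vp = sgerm u' W'p Up Vp -> sgerm v Wp Up Vp = sgerm v' W'p Up Vp ->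
  sgerm (addm (ad W) u v) Wp Up Vp = sgerm (addm (ad W') u' v') W'p Up Vp.
Proof.
move=> /sgerm_eqP [T [hT [hT' [kU [kV [Tp e]]]]]] /sgerm_eqP
  [R [hR [hR' [lU [lV [Rp e']]]]]].
have s1 : opensI T R `<=` T by exact: opensIl.
have s2 : opensI T R `<=` R by exact: opensIr.
have k1 := subset_trans s1 kU; have k2 := subset_trans s1 kV.
apply/sgerm_eqP; exists (opensI T R), (subset_trans s1 hT), (subset_trans s1 hT'), k1, k2.
split; first by split.
rewrite !mresD; congr (addm _ _ _).
  by rewrite -(mres_mres hT kU kV s1) e; exact: mres_mres.
by rewrite -(mres_mres hR lU lV s2) e'; exact: mres_mres.
Qed.

(** Representatives live on neighbourhoods that vary, so the sum is
    characterized by all common ones at once instead of being computed on one. *)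
Lemma germ_add_ex (L M : stalk C p) (f g : hom L M) :
  exists h : hom L M, forall W Wp hL hM
    (u v : hom (res C hL (so_val L)) (res C hM (so_val M))),
    f = germ_of (@Pregerm _ C p L M W Wp hL hM u) ->
    g = germ_of (@Pregerm _ C p L M W Wp hL hM v) ->
    h = germ_of (@Pregerm _ C p L M W Wp hL hM (addm (ad W) u v)).
Proof.
case: L M f g => [U Up A] [V Vp B] f g.
have [W [Wp [hU [hV [u [v [-> ->]]]]]]] := sgerm_parallel f g.
exists (sgerm (addm (ad W) u v) Wp Up Vp) => W' W'p hU' hV' u' v' e e'.
exact: (sgermD_unique e e').
Qed.

Definition germ_add (L M : stalk C p) (f g : hom L M) : hom L M :=
  sval (cid (germ_add_ex f g)).

Lemma germ_addE (U V W : opens X) (hU : W `<=` U) (hV : W `<=` V) (A : C U) (B : C V)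
    (u v : hom (res C hU A) (res C hV B)) (Wp : carrier W p) (Up : carrier U p)
    (Vp : carrier V p) :
  germ_add (sgerm u Wp Up Vp) (sgerm v Wp Up Vp) = sgerm (addm (ad W) u v) Wp Up Vp.
Proof. exact: (svalP (cid (germ_add_ex (sgerm u Wp Up Vp) (sgerm v Wp Up Vp)))). Qed.

Definition germ_zero (L M : stalk C p) : hom L M :=
  @germ_of _ C p L M (@Pregerm _ C p L M (opensI (so_dom L) (so_dom M))
    (conj (so_mem L) (so_mem M)) (@opensIl _ _ _) (@opensIr _ _ _) (zerom (ad _) _ _)).

Lemma germ_zeroE (U V W : opens X) (hU : W `<=` U) (hV : W `<=` V) (A : C U) (B : C V)
    (Wp : carrier W p) (Up : carrier U p) (Vp : carrier V p) :
  germ_zero (StalkObj Up A) (StalkObj Vp B)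
  = sgerm (zerom (ad W) (res C hU A) (res C hV B)) Wp Up Vp.
Proof.
have hW : W `<=` opensI U V by move=> x Wx; split; [exact: hU | exact: hV].
rewrite -[LHS]/(sgerm (zerom (ad (opensI U V)) (res C (@opensIl _ U V) A)
  (res C (@opensIr _ U V) B)) (conj Up Vp : carrier (opensI U V) p) Up Vp).
by rewrite -(sgerm_mres hW hU hV _ Wp) mres0.
Qed.

Lemma germ_opp_ex (L M : stalk C p) (f : hom L M) :
  exists g : hom L M, germ_add g f = germ_zero L M.
Proof.
case: L M f => [U Up A] [V Vp B] f.
have [W [Wp [hU [hV [u ->]]]]] := sgermP f.
exists (sgerm (oppm (ad W) u) Wp Up Vp).
by rewrite germ_addE addNm -germ_zeroE.
Qed.

Lemma germ_addC (L M : stalk C p) : commutative (@germ_add L M).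
Proof.
case: L M => [U Up A] [V Vp B] f g.
have [W [Wp [hU [hV [u [v [-> ->]]]]]]] := sgerm_parallel f g.
by rewrite !germ_addE addmC.
Qed.

Lemma germ_add0 (L M : stalk C p) : left_id (germ_zero L M) (@germ_add L M).
Proof.
case: L M => [U Up A] [V Vp B] f.
have [W [Wp [hU [hV [u ->]]]]] := sgermP f.
by rewrite (germ_zeroE hU hV _ _ Wp) germ_addE add0m.
Qed.

Lemma sgerm_triple (U V : opens X) (A : C U) (B : C V)
    (Up : carrier U p) (Vp : carrier V p)
    (f g h : @hom (stalk C p) (StalkObj Up A) (StalkObj Vp B)) :
  exists (W : opens X) (Wp : carrier W p) (hU : W `<=` U) (hV : W `<=` V)
    (u v w : hom (res C hU A) (res C hV B)),
    [/\ f = sgerm u Wp Up Vp, g = sgerm v Wp Up Vp & h = sgerm w Wp Up Vp].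
Proof.
have [W [Wp [hU [hV [u [v [-> ->]]]]]]] := sgerm_parallel f g.
have [W' [W'p [hU' [hV' [w ->]]]]] := sgermP h.
have s1 : opensI W W' `<=` W by exact: opensIl.
have s2 : opensI W W' `<=` W' by exact: opensIr.
exists (opensI W W'), (conj Wp W'p), (subset_trans s1 hU), (subset_trans s1 hV).
by exists (mres s1 _ _ u), (mres s1 _ _ v), (mres s2 _ _ w); rewrite !sgerm_mres.
Qed.

Lemma germ_addA (L M : stalk C p) : associative (@germ_add L M).
Proof.
case: L M => [U Up A] [V Vp B] f g h.
have [W [Wp [hU [hV [u [v [w [-> -> ->]]]]]]]] := sgerm_triple f g h.
by rewrite !germ_addE addmA.
Qed.

Lemma germ_addMl (L M N : stalk C p) (g h : hom M N) (f : hom L M) :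
  germ_add g h ∘ f = germ_add (g ∘ f) (h ∘ f).
Proof.
case: L M N f g h => [U Up A] [V Vp B] [T Tp D] f g h.
have [W [Wp [hV [hT [v [w [-> ->]]]]]]] := sgerm_parallel g h.
have [W' [W'p [hU' [hV' [u ->]]]]] := sgermP f.
have s1 : opensI W W' `<=` W by exact: opensIl.
have s2 : opensI W W' `<=` W' by exact: opensIr.
have kU := subset_trans s2 hU'; have kV := subset_trans s1 hV;
  have kT := subset_trans s1 hT.
have Ip : carrier (opensI W W') p by split.
rewrite germ_addE -(sgerm_mres s1 kV kT v Ip) -(sgerm_mres s1 kV kT w Ip).
rewrite -(sgerm_mres s1 kV kT (addm _ _ _) Ip) -(sgerm_mres s2 kU kV u Ip).
by rewrite -!sgermM germ_addE mresD compmDl.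
Qed.

Lemma germ_addMr (L M N : stalk C p) (h : hom M N) (f g : hom L M) :
  h ∘ germ_add f g = germ_add (h ∘ f) (h ∘ g).
Proof.
case: L M N f g h => [U Up A] [V Vp B] [T Tp D] f g h.
have [W [Wp [hU [hV [u [v [-> ->]]]]]]] := sgerm_parallel f g.
have [W' [W'p [hV' [hT' [w ->]]]]] := sgermP h.
have s1 : opensI W W' `<=` W by exact: opensIl.
have s2 : opensI W W' `<=` W' by exact: opensIr.
have kU := subset_trans s1 hU; have kV := subset_trans s1 hV;
  have kT := subset_trans s2 hT'.
have Ip : carrier (opensI W W') p by split.
rewrite germ_addE -(sgerm_mres s1 kU kV u Ip) -(sgerm_mres s1 kU kV v Ip).
rewrite -(sgerm_mres s1 kU kV (addm _ _ _) Ip) -(sgerm_mres s2 kV kT w Ip).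
by rewrite -!sgermM germ_addE mresD compmDr.
Qed.

Definition stalk_preadditive : preadditive (stalk C p) :=
  {| addmA := germ_addA; addmC := germ_addC; add0m := germ_add0;
     addNm := fun L M f => svalP (cid (germ_opp_ex f));
     compmDl := germ_addMl; compmDr := germ_addMr |}.

Lemma sgermD (U V W : opens X) (hU : W `<=` U) (hV : W `<=` V) (A : C U) (B : C V)
    (u v : hom (res C hU A) (res C hV B)) (Wp : carrier W p) (Up : carrier U p)
    (Vp : carrier V p) :
  sgerm (addm (ad W) u v) Wp Up Vp
  = addm stalk_preadditive (sgerm u Wp Up Vp) (sgerm v Wp Up Vp).
Proof. by symmetry; exact: germ_addE. Qed.

Lemma sgermN (U V W : opens X) (hU : W `<=` U) (hV : W `<=` V) (A : C U) (B : C V)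
    (u : hom (res C hU A) (res C hV B)) (Wp : carrier W p) (Up : carrier U p)
    (Vp : carrier V p) :
  sgerm (oppm (ad W) u) Wp Up Vp = oppm stalk_preadditive (sgerm u Wp Up Vp).
Proof. by apply: oppm_unique; rewrite -sgermD addmN -germ_zeroE. Qed.

Lemma germ_additive (U : opens X) (Up : carrier U p) :
  additive_functor (ad U) stalk_preadditive (germ C Up).
Proof. by move=> A B f g; rewrite !germE adres sgermD. Qed.

Lemma stalk_zero_obj (U : opens X) (Up : carrier U p) :
  (exists Z : C U, is_zero_obj Z) -> exists Z : stalk C p, is_zero_obj Z.
Proof.
move=> [Z Z0]; exists (germ C Up Z).
exact: (additive_functor_zero_obj (germ_additive Up)).
Qed.

End At.
End GermSums.

(** * Sums of morphisms of the stack *)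

Section StackAdditive.
Variables (X : topologicalType) (C S : prestack X) (eta : prestack_functor C S).
Hypothesis SS : is_stack S.
Hypothesis Finj : forall (p : X) (L M : stalk C p) (f g : hom L M),
  fmor (stalkf eta p) f = fmor (stalkf eta p) g -> f = g.
Hypothesis Ffull : forall (p : X) (L M : stalk C p)
  (f : hom (stalkf eta p L) (stalkf eta p M)), exists g, f = fmor (stalkf eta p) g.
Hypothesis Fess : forall (p : X) (M : stalk S p),
  exists (L : stalk C p) (i : iso (stalkf eta p L) M), True.
Variable ad : forall U : opens X, preadditive (C U).
Hypothesis adres : forall (U V : opens X) (hVU : V `<=` U),
  additive_functor (ad U) (ad V) (res C hVU).

(** Through the equivalence eta, the sums of germs in C give sums of germs in
    S. *)
Definition germ_preadditive (p : X) : preadditive (stalk S p) :=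
  transport (@Finj p) (@Ffull p) (@Fess p) (stalk_preadditive adres p).

Lemma stalkf_additive (p : X) : additive_functor (stalk_preadditive adres p)
    (germ_preadditive p) (stalkf eta p).
Proof. exact: transport_additive. Qed.

(** Near a point A and B come from C, and so do two germs between them. The
    outer factors a and b are shared, so what is done in C to u1 and v1 is done
    to u and v. *)
Lemma local_model (U V W : opens X) (hU : W `<=` U) (hV : W `<=` V) (A : S U)
    (B : S V) (u v : hom (res S hU A) (res S hV B)) (p : X) (Wp : carrier W p) :
  exists (T U1 V1 : opens X) (A1 : C U1) (B1 : C V1) (kU : T `<=` U)
    (kV : T `<=` V) (k1 : T `<=` U1) (l1 : T `<=` V1)
    (a : hom (res S kU A) (res S k1 (eta U1 A1)))
    (b : hom (res S l1 (eta V1 B1)) (res S kV B))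
    (u1 v1 : hom (res C k1 A1) (res C l1 B1)),
  carrier T p /\ forall q (Tq : carrier T q) (Wq : carrier W q) (Uq : carrier U q)
    (Vq : carrier V q) (U1q : carrier U1 q) (V1q : carrier V1 q),
    sgerm u Wq Uq Vq = sgerm b Tq V1q Vq ∘ fmor (stalkf eta q) (sgerm u1 Tq U1q V1q)
      ∘ sgerm a Tq Uq U1q /\
    sgerm v Wq Uq Vq = sgerm b Tq V1q Vq ∘ fmor (stalkf eta q) (sgerm v1 Tq U1q V1q)
      ∘ sgerm a Tq Uq U1q.
Proof.
have Up := hU p Wp; have Vp := hV p Wp.
have [[U1 U1p A1] [i _]] := Fess (StalkObj Up A : stalk S p).
have [[V1 V1p B1] [j _]] := Fess (StalkObj Vp B : stalk S p).
have [g gE] := Ffull (bwd j ∘ sgerm u Wp Up Vp ∘ i).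
have [h hE] := Ffull (bwd j ∘ sgerm v Wp Up Vp ∘ i).
have {}gE : sgerm u Wp Up Vp = j ∘ fmor (stalkf eta p) g ∘ bwd i.
  by rewrite -gE !compmA bwdK comp1m compm_bwdK.
have {}hE : sgerm v Wp Up Vp = j ∘ fmor (stalkf eta p) h ∘ bwd i.
  by rewrite -hE !compmA bwdK comp1m compm_bwdK.
have [W1 [W1p [k1 [l1 [u1 [v1 [ug vh]]]]]]] := sgerm_parallel g h.
have [Wa [Wap [ka [la [a aE]]]]] := sgermP (bwd i).
have [Wb [Wbp [kb [lb [b bE]]]]] := sgermP (fwd j).
pose R := opensI W1 (opensI Wa Wb).
have Rp : carrier R p by [].
have r1 : R `<=` W1 by move=> x [].
have ra : R `<=` Wa by move=> x [_ []].
have rb : R `<=` Wb by move=> x [_ []].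
have RU := subset_trans ra ka; have RV := subset_trans rb lb.
have R1 := subset_trans r1 k1; have R2 := subset_trans r1 l1.
pose a' := mres ra RU R1 a; pose b' := mres rb R2 RV b.
pose u' := mres r1 R1 R2 u1; pose v' := mres r1 R1 R2 v1.
have e1 : sgerm u Wp Up Vp = sgerm (b' ∘ fsec eta u' ∘ a') Rp Up Vp.
  rewrite gE ug aE bE (sgermM _ _ _ _ U1p) (sgermM _ _ _ _ V1p) -stalkf_sgerm.
  by rewrite !sgerm_mres.
have e2 : sgerm v Wp Up Vp = sgerm (b' ∘ fsec eta v' ∘ a') Rp Up Vp.
  rewrite hE vh aE bE (sgermM _ _ _ _ U1p) (sgermM _ _ _ _ V1p) -stalkf_sgerm.
  by rewrite !sgerm_mres.
have [T [Tp TW TR e1T]] := sgerm_near e1.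
have [T' [T'p T'W T'R e2T]] := sgerm_near e2.
have s1 : opensI T T' `<=` T by exact: opensIl.
have s2 : opensI T T' `<=` T' by exact: opensIr.
have s := subset_trans s1 TR.
exists (opensI T T'), U1, V1, A1, B1, (subset_trans s RU), (subset_trans s RV),
  (subset_trans s R1), (subset_trans s R2), (mres s _ _ a'), (mres s _ _ b'),
  (mres s _ _ u'), (mres s _ _ v').
split; first by split.
move=> q Iq Wq Uq Vq U1q V1q; have Rq := s q Iq.
rewrite (sgerm_mres s _ _ a' Iq Rq) (sgerm_mres s _ _ b' Iq Rq).
rewrite (sgerm_mres s _ _ u' Iq Rq) (sgerm_mres s _ _ v' Iq Rq).
rewrite !stalkf_sgerm -!sgermM; split.
  exact: e1T (s1 q Iq) _ _ _ _.
exact: e2T (s2 q Iq) _ _ _ _.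
Qed.

Lemma hom_add_ex (U : opens X) (A B : S U) (f g : hom A B) :
  exists h : hom A B, forall q (Uq : carrier U q),
    fmor (germ S Uq) h = addm (germ_preadditive q) (fmor (germ S Uq) f)
      (fmor (germ S Uq) g).
Proof.
apply: (hom_glue SS (P := fun q Uq h =>
  h = addm (germ_preadditive q) (fmor (germ S Uq) f) (fmor (germ S Uq) g))).
  by move=> q Uq h h' -> ->.
move=> p Up.
have [T [U1 [V1 [A1 [B1 [kU [kV [k1 [l1 [a [b [u1 [v1 [Tp e]]]]]]]]]]]]]] :=
  local_model (fmor (res S (fun _ => id)) f) (fmor (res S (fun _ => id)) g) Up.
have ekU : kV = kU by exact: Prop_irrelevance.
subst kV.
exists T, kU, (b ∘ fsec eta (addm (ad T) u1 v1) ∘ a); split=> // q Tq Uq.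
have U1q := k1 q Tq; have V1q := l1 q Tq.
have [eu ev] := e q Tq Uq Uq Uq U1q V1q.
rewrite !germE eu ev (sgermM _ _ _ _ U1q) (sgermM _ _ _ _ V1q) -stalkf_sgerm.
by rewrite (sgermD adres) stalkf_additive compmDr compmDl.
Qed.

Lemma hom_zero_ex (U : opens X) (A B : S U) :
  exists h : hom A B, forall q (Uq : carrier U q),
    fmor (germ S Uq) h = zerom (germ_preadditive q) _ _.
Proof.
apply: (hom_glue SS (P := fun q Uq h => h = zerom (germ_preadditive q) _ _)).
  by move=> q Uq h h' -> ->.
move=> p Up.
have [W [Wp [hU [hV [u _]]]]] :=
  sgermP (zerom (germ_preadditive p) (germ S Up A) (germ S Up B)).
have ehV : hV = hU by exact: Prop_irrelevance.
subst hV.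
have [T [U1 [V1 [A1 [B1 [kU [kV [k1 [l1 [a [b [u1 [v1 [Tp e]]]]]]]]]]]]]] :=
  local_model u u Wp.
have ekU : kV = kU by exact: Prop_irrelevance.
subst kV.
exists T, kU, (b ∘ fsec eta (zerom (ad T) _ _) ∘ a); split=> // q Tq Uq.
have U1q := k1 q Tq; have V1q := l1 q Tq.
rewrite (sgermM _ _ _ _ U1q) (sgermM _ _ _ _ V1q) -stalkf_sgerm.
rewrite -(germ_zeroE adres _ _ _ _ _ U1q V1q).
rewrite [fmor _ _](additive_functor0 (@stalkf_additive q)).
by rewrite compm0 comp0m.
Qed.

Lemma hom_opp_ex (U : opens X) (A B : S U) (f : hom A B) :
  exists h : hom A B, forall q (Uq : carrier U q),
    fmor (germ S Uq) h = oppm (germ_preadditive q) (fmor (germ S Uq) f).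
Proof.
apply: (hom_glue SS (P := fun q Uq h =>
  h = oppm (germ_preadditive q) (fmor (germ S Uq) f))).
  by move=> q Uq h h' -> ->.
move=> p Up.
have [T [U1 [V1 [A1 [B1 [kU [kV [k1 [l1 [a [b [u1 [v1 [Tp e]]]]]]]]]]]]]] :=
  local_model (fmor (res S (fun _ => id)) f) (fmor (res S (fun _ => id)) f) Up.
have ekU : kV = kU by exact: Prop_irrelevance.
subst kV.
exists T, kU, (b ∘ fsec eta (oppm (ad T) u1) ∘ a); split=> // q Tq Uq.
have U1q := k1 q Tq; have V1q := l1 q Tq.
have [eu _] := e q Tq Uq Uq Uq U1q V1q.
rewrite !germE eu (sgermM _ _ _ _ U1q) (sgermM _ _ _ _ V1q) -stalkf_sgerm.
by rewrite (sgermN adres) (additive_functorN (@stalkf_additive q)) compmNr compmNl.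
Qed.

Section Ops.
Variable U : opens X.
Let add (A B : S U) (f g : hom A B) := sval (cid (hom_add_ex f g)).
Let opp (A B : S U) (f : hom A B) := sval (cid (hom_opp_ex f)).
Let zero (A B : S U) := sval (cid (hom_zero_ex A B)).
Let addE (A B : S U) (f g : hom A B) q (Uq : carrier U q) :
  fmor (germ S Uq) (add f g) = addm (germ_preadditive q) (fmor (germ S Uq) f)
    (fmor (germ S Uq) g).
Proof. by rewrite /add; case: (cid _). Qed.
Let oppE (A B : S U) (f : hom A B) q (Uq : carrier U q) :
  fmor (germ S Uq) (opp f) = oppm (germ_preadditive q) (fmor (germ S Uq) f).
Proof. by rewrite /opp; case: (cid _). Qed.
Let zeroE (A B : S U) q (Uq : carrier U q) :
  fmor (germ S Uq) (zero A B) = zerom (germ_preadditive q) (germ S Uq A) (germ S Uq B).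
Proof. by rewrite /zero; case: (cid _). Qed.

Program Definition stack_preadditive : preadditive (S U) :=
  {| addm := add; zerom := zero; oppm := opp |}.
Next Obligation. by move=> A B f g h; apply: (hom_sep SS) => q Uq;
  rewrite !addE addmA. Qed.
Next Obligation. by move=> A B f g; apply: (hom_sep SS) => q Uq; rewrite !addE addmC. Qed.
Next Obligation. by move=> A B f; apply: (hom_sep SS) => q Uq;
  rewrite addE zeroE add0m. Qed.
Next Obligation. by move=> A B f; apply: (hom_sep SS) => q Uq;
  rewrite addE zeroE oppE addNm. Qed.
Next Obligation.
by move=> A B D g h f; apply: (hom_sep SS) => q Uq; rewrite fmorM !addE !fmorM compmDl.
Qed.
Next Obligation.
by move=> A B D h f g; apply: (hom_sep SS) => q Uq; rewrite fmorM !addE !fmorM compmDr.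
Qed.

Lemma germ_stack_additive q (Uq : carrier U q) :
  additive_functor stack_preadditive (germ_preadditive q) (germ S Uq).
Proof. by move=> A B f g; exact: addE. Qed.

End Ops.

Lemma res_additive (U V : opens X) (hVU : V `<=` U) :
  additive_functor (stack_preadditive U) (stack_preadditive V) (res S hVU).
Proof.
move=> A B f g; apply: (hom_sep SS) => q Vq; have Uq := hVU q Vq.
apply: (iso_mono (i := rho hVU B Vq Uq)).
by rewrite rho_fmor !germ_stack_additive compmDl compmDr !rho_fmor.
Qed.

Lemma eta_additive (U : opens X) :
  additive_functor (ad U) (stack_preadditive U) (eta U).
Proof.
move=> A B f g; apply: (hom_sep SS) => q Uq.
by rewrite germ_stack_additive -!stalkf_germ (germ_additive adres) stalkf_additive.
Qed.

End StackAdditive.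

(** * Gluing cones and cocones *)

Section LiftNear.
Variables (X : topologicalType) (S : prestack X).

(** A factorization known at p only extends to a neighbourhood, because both of
    its equations spread out. *)
Lemma lift_near (p : X) (U V V' T W W' : opens X) (A : S U) (A' : S V) (K : S V')
    (B : S T)
    (hKA : W `<=` V') (hA : W `<=` U) (hKA' : W `<=` V') (hA' : W `<=` V)
    (hB : W' `<=` T) (hBA : W' `<=` U) (hB' : W' `<=` T) (hBA' : W' `<=` V)
    (k : hom (res S hKA K) (res S hA A)) (k' : hom (res S hKA' K) (res S hA' A'))
    (g : hom (res S hB B) (res S hBA A)) (g' : hom (res S hB' B) (res S hBA' A'))
    (Wp : carrier W p) (W'p : carrier W' p) (Up : carrier U p) (Vp : carrier V p)
    (V'p : carrier V' p) (Tp : carrier T p)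
    (e : @hom (stalk S p) (StalkObj Tp B) (StalkObj V'p K)) :
  sgerm k Wp V'p Up ∘ e = sgerm g W'p Tp Up ->
  sgerm k' Wp V'p Vp ∘ e = sgerm g' W'p Tp Vp ->
  exists (R : opens X) (lT : R `<=` T) (lV : R `<=` V')
      (u : hom (res S lT B) (res S lV K)), [/\ carrier R p, R `<=` W, R `<=` W' &
    forall q (Rq : carrier R q) (Wq : carrier W q) (W'q : carrier W' q)
      (Uq : carrier U q) (Vq : carrier V q) (V'q : carrier V' q) (Tq : carrier T q),
      sgerm k Wq V'q Uq ∘ sgerm u Rq Tq V'q = sgerm g W'q Tq Uq /\
      sgerm k' Wq V'q Vq ∘ sgerm u Rq Tq V'q = sgerm g' W'q Tq Vq].
Proof.
have [R [Rp [lT [lV [u ->]]]]] := sgermP e.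
have s1 : opensI R W `<=` R by exact: opensIl.
have s2 : opensI R W `<=` W by exact: opensIr.
have Ip : carrier (opensI R W) p by split.
have mT := subset_trans s1 lT; have mK := subset_trans s1 lV.
have mA := subset_trans s2 hA; have mA' := subset_trans s2 hA'.
rewrite -(sgerm_mres s1 mT mK u Ip) -(sgerm_mres s2 mK mA k Ip).
rewrite -(sgerm_mres s2 mK mA' k' Ip) -!sgermM => e1 e2.
have [R1 [R1p R1I R1W e1R]] := sgerm_near e1.
have [R2 [R2p R2I R2W e2R]] := sgerm_near e2.
have t1 : opensI R1 R2 `<=` R1 by exact: opensIl.
have t2 : opensI R1 R2 `<=` R2 by exact: opensIr.
have t := subset_trans t1 R1I.
exists (opensI R1 R2), (subset_trans t mT), (subset_trans t mK),
  (mres t _ _ (mres s1 mT mK u)); split.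
- by split.
- exact: subset_trans t s2.
- exact: subset_trans t1 R1W.
move=> q Rq Wq W'q Uq Vq V'q Tq; have Iq := t q Rq.
rewrite (sgerm_mres t _ _ _ Rq Iq) -(sgerm_mres s2 mK mA k Iq)
  -(sgerm_mres s2 mK mA' k' Iq).
rewrite -!sgermM; split.
  exact: (e1R q (t1 q Rq)).
exact: (e2R q (t2 q Rq)).
Qed.

Lemma colift_near (p : X) (U V' T W W' : opens X) (A : S U) (K : S V') (B : S T)
    (hKA : W `<=` V') (hA : W `<=` U) (hB : W' `<=` T) (hBA : W' `<=` U)
    (c : hom (res S hA A) (res S hKA K)) (g : hom (res S hBA A) (res S hB B))
    (Wp : carrier W p) (W'p : carrier W' p) (Up : carrier U p)
    (V'p : carrier V' p) (Tp : carrier T p)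
    (e : @hom (stalk S p) (StalkObj V'p K) (StalkObj Tp B)) :
  e ∘ sgerm c Wp Up V'p = sgerm g W'p Up Tp ->
  exists (R : opens X) (lT : R `<=` T) (lV : R `<=` V')
      (u : hom (res S lV K) (res S lT B)), [/\ carrier R p, R `<=` W, R `<=` W' &
    forall q (Rq : carrier R q) (Wq : carrier W q) (W'q : carrier W' q)
      (Uq : carrier U q) (V'q : carrier V' q) (Tq : carrier T q),
      sgerm u Rq V'q Tq ∘ sgerm c Wq Uq V'q = sgerm g W'q Uq Tq].
Proof.
have [R [Rp [lV [lT [u ->]]]]] := sgermP e.
have s1 : opensI R W `<=` R by exact: opensIl.
have s2 : opensI R W `<=` W by exact: opensIr.
have Ip : carrier (opensI R W) p by split.
have mT := subset_trans s1 lT; have mK := subset_trans s1 lV.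
have mA := subset_trans s2 hA.
rewrite -(sgerm_mres s1 mK mT u Ip) -(sgerm_mres s2 mA mK c Ip) -!sgermM => e1.
have [R1 [R1p R1I R1W e1R]] := sgerm_near e1.
exists R1, (subset_trans R1I mT), (subset_trans R1I mK),
  (mres R1I _ _ (mres s1 mK mT u)); split=> //.
  exact: subset_trans R1I s2.
move=> q Rq Wq W'q Uq V'q Tq; have Iq := R1I q Rq.
rewrite (sgerm_mres R1I _ _ _ Rq Iq) -(sgerm_mres s2 mA mK c Iq) -!sgermM.
exact: (e1R q Rq).
Qed.

End LiftNear.

Section Cones.
Variables (X : topologicalType) (S : prestack X).
Hypothesis SS : is_stack S.

Lemma joint_lift (U : opens X) (T K A A' : S U) (k : hom K A) (k' : hom K A')
    (g : hom T A) (g' : hom T A') :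
  (forall q (Uq : carrier U q) (e e' : hom (germ S Uq T) (germ S Uq K)),
     fmor (germ S Uq) k ∘ e = fmor (germ S Uq) k ∘ e' ->
     fmor (germ S Uq) k' ∘ e = fmor (germ S Uq) k' ∘ e' -> e = e') ->
  (forall q (Uq : carrier U q), exists e : hom (germ S Uq T) (germ S Uq K),
     fmor (germ S Uq) k ∘ e = fmor (germ S Uq) g /\
     fmor (germ S Uq) k' ∘ e = fmor (germ S Uq) g') ->
  exists u : hom T K, k ∘ u = g /\ k' ∘ u = g'.
Proof.
move=> mono loc.
have [q Uq e e' [e1 e2] [e1' e2']|p Up|u uP] := @hom_glue _ _ SS U T K
  (fun q Uq e => fmor (germ S Uq) k ∘ e = fmor (germ S Uq) g /\
     fmor (germ S Uq) k' ∘ e = fmor (germ S Uq) g').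
- by apply: mono; rewrite ?e1 ?e2.
- have [e [e1 e2]] := loc p Up; rewrite !germE in e1 e2.
  have [R [lT [lV [u [Rp RU _ uP]]]]] := lift_near e1 e2.
  have elV : lV = lT by exact: Prop_irrelevance.
  subst lV; exists R, lT, u; split=> // q Rq Uq.
  by rewrite !germE; exact: uP.
by exists u; split; apply: (hom_sep SS) => q Uq; rewrite fmorM; case: (uP q Uq).
Qed.

Lemma colift (U : opens X) (T K A : S U) (c : hom A K) (g : hom A T) :
  (forall q (Uq : carrier U q), is_epi (fmor (germ S Uq) c)) ->
  (forall q (Uq : carrier U q), exists e : hom (germ S Uq K) (germ S Uq T),
     e ∘ fmor (germ S Uq) c = fmor (germ S Uq) g) ->
  exists u : hom K T, u ∘ c = g.
Proof.
move=> epi loc.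
have [q Uq e e' e1 e2|p Up|u uP] := @hom_glue _ _ SS U K T
  (fun q Uq e => e ∘ fmor (germ S Uq) c = fmor (germ S Uq) g).
- by apply: (epi q Uq); rewrite e1 e2.
- have [e e1] := loc p Up; rewrite !germE in e1.
  have [R [lT [lV [u [Rp RU _ uP]]]]] := colift_near e1.
  have elV : lV = lT by exact: Prop_irrelevance.
  subst lV; exists R, lT, u; split=> // q Rq Uq.
  by rewrite !germE; exact: uP.
by exists u; apply: (hom_sep SS) => q Uq; rewrite fmorM uP.
Qed.

Section ConeGluing.
Variables (U : opens X) (A A' : S U).

(** The vertex is restricted along the identity inclusion, so that the legs are
    sections and their germs start at the vertex itself. *)
Record local_cone := LocalCone {
  lc_dom : opens X;
  lc_sub : lc_dom `<=` U;
  lc_obj : S lc_dom;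
  lc_fst : hom (res S (fun _ => id) lc_obj) (res S lc_sub A);
  lc_snd : hom (res S (fun _ => id) lc_obj) (res S lc_sub A') }.

Variable Q : forall q (Uq : carrier U q) (L : stalk S q),
  hom L (germ S Uq A) -> hom L (germ S Uq A') -> Prop.
Arguments Q {q} Uq {L} _ _.
Hypothesis Qiso : forall q (Uq : carrier U q) (L M : stalk S q) (i : iso M L) l l',
  @Q q Uq L l l' -> Q Uq (l ∘ i) (l' ∘ i).
Hypothesis Qmono : forall q (Uq : carrier U q) (L M : stalk S q) l l' (e e' : hom M L),
  Q Uq l l' -> l ∘ e = l ∘ e' -> l' ∘ e = l' ∘ e' -> e = e'.
Hypothesis Qlift : forall q (Uq : carrier U q) (L M : stalk S q) l l' m m',
  @Q q Uq L l l' -> @Q q Uq M m m' -> exists e : hom M L, l ∘ e = m /\ l' ∘ e = m'.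
Hypothesis Qloc : forall p, carrier U p -> exists c : local_cone,
  carrier (lc_dom c) p /\
  forall q (Wq : carrier (lc_dom c) q) (Uq : carrier U q),
    @Q q Uq (StalkObj Wq (lc_obj c)) (sgerm (lc_fst c) Wq Wq Uq)
      (sgerm (lc_snd c) Wq Wq Uq).

(** Here Q is a universal property on germs of pairs of morphisms to A and A':
    for a biproduct they are the projections, for a kernel the same morphism
    taken twice. It determines its vertex up to a unique isomorphism, so local
    vertices glue. *)
Lemma cone_glue : exists (K : S U) (k : hom K A) (k' : hom K A'),
  forall q (Uq : carrier U q), Q Uq (fmor (germ S Uq) k) (fmor (germ S Uq) k').
Proof.
pose I := {q | carrier U q}.
have [c cP] := choice (fun i : I => Qloc (svalP i)).
pose V i := lc_dom (c i).
pose hVU i : V i `<=` U := @lc_sub (c i).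
have cov : U `<=` \bigcup_i V i.
  by move=> q Uq; exists (exist _ q Uq) => //; exact: (proj1 (cP (exist _ q Uq))).
pose E i j q (Vi : carrier (V i) q) (Vj : carrier (V j) q)
  (e : @hom (stalk S q) (StalkObj Vj (lc_obj (c j))) (StalkObj Vi (lc_obj (c i)))) :=
  forall Uq : carrier U q,
    sgerm (lc_fst (c i)) Vi Vi Uq ∘ e = sgerm (lc_fst (c j)) Vj Vj Uq /\
    sgerm (lc_snd (c i)) Vi Vi Uq ∘ e = sgerm (lc_snd (c j)) Vj Vj Uq.
have Euniq i j q (Vi : carrier (V i) q) (Vj : carrier (V j) q) f g :
    E i j q Vi Vj f -> E i j q Vi Vj g -> f = g.
  move=> /(_ (hVU i q Vi)) [f1 f2] /(_ (hVU i q Vi)) [g1 g2].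
  by apply: (Qmono (proj2 (cP i) q Vi (hVU i q Vi))); rewrite ?f1 ?f2.
have Eid i q (Vi : carrier (V i) q) : E i i q Vi Vi (idm _).
  by move=> Uq; rewrite !compm1.
have Ecomp i j k q (Vi : carrier (V i) q) (Vj : carrier (V j) q)
    (Vk : carrier (V k) q) f g :
    E i j q Vi Vj f -> E j k q Vj Vk g -> E i k q Vi Vk (f ∘ g).
  by move=> fE gE Uq; case: (fE Uq) (gE Uq) => f1 f2 [g1 g2]; rewrite !compmA f1 f2.
have Eex i j q (Vi : carrier (V i) q) (Vj : carrier (V j) q) : exists e, E i j q Vi Vj e.
  have Uq := hVU i q Vi.
  have [e [e1 e2]] := Qlift (proj2 (cP i) q Vi Uq) (proj2 (cP j) q Vj Uq).
  by exists e => Uq'; rewrite (Prop_irrelevance Uq' Uq).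
have Eloc i j p : carrier (V i) p -> carrier (V j) p ->
  exists (W : opens X) (kj : W `<=` V j) (ki : W `<=` V i)
    (u : hom (res S kj (lc_obj (c j))) (res S ki (lc_obj (c i)))), carrier W p /\
    forall q (Wq : carrier W q) (Vi : carrier (V i) q) (Vj : carrier (V j) q),
      E i j q Vi Vj (sgerm u Wq Vj Vi).
  move=> Vi Vj; have Up := hVU i p Vi.
  have [e /(_ Up) [e1 e2]] := Eex i j p Vi Vj.
  have [R [lj [li [u [Rp _ _ uP]]]]] := lift_near e1 e2.
  by exists R, lj, li, u; split=> // q Rq Viq Vjq Uq; exact: uP.
have [K [s sE]] := obj_glue SS hVU cov Euniq Eid Ecomp Eloc.
have glueleg (B : S U) (l : forall i,
  hom (res S (fun _ => id) (lc_obj (c i))) (res S (hVU i) B)) :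
   (forall i j q (Vi : carrier (V i) q) (Vj : carrier (V j) q) (Uq : carrier U q) e,
      E i j q Vi Vj e -> sgerm (l i) Vi Vi Uq ∘ e = sgerm (l j) Vj Vj Uq) ->
   exists k : hom K B, forall q Uq i (Vi : carrier (V i) q),
     fmor (germ S Uq) k = sgerm (l i) Vi Vi Uq ∘ sgerm (s i) Vi Uq Vi.
  move=> lE.
  apply: (hom_glue SS (P := fun q Uq f => forall i (Vi : carrier (V i) q),
     f = sgerm (l i) Vi Vi Uq ∘ sgerm (s i) Vi Uq Vi)).
    move=> q Uq f g fP gP; have [i _ Vi] := cov q Uq.
    by rewrite (fP i Vi) (gP i Vi).
  move=> p Up; have [i _ Vi] := cov p Up.
  exists (V i), (hVU i), (l i ∘ s i); split=> // q Viq Uq j Vj.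
  have [e eE] := Eex j i q Vj Viq.
  by rewrite (sgermM _ _ _ _ Viq) -(lE _ _ _ _ _ _ _ eE) -compmA (sE _ _ _ _ _ _ _ eE).
have [k kE] := glueleg A (fun i => lc_fst (c i))
  (fun i j q Vi Vj Uq e eE => proj1 (eE Uq)).
have [k' k'E] := glueleg A' (fun i => lc_snd (c i))
  (fun i j q Vi Vj Uq e eE => proj2 (eE Uq)).
exists K, k, k' => q Uq; have [i _ Vi] := cov q Uq.
rewrite (kE q Uq i Vi) (k'E q Uq i Vi).
exact: (Qiso (sgerm_iso (s i) Vi Uq Vi) (proj2 (cP i) q Vi Uq)).
Qed.

End ConeGluing.

Section CoconeGluing.
Variables (U : opens X) (A : S U).

Record local_cocone := LocalCocone {
  lcc_dom : opens X;
  lcc_sub : lcc_dom `<=` U;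
  lcc_obj : S lcc_dom;
  lcc_leg : hom (res S lcc_sub A) (res S (fun _ => id) lcc_obj) }.

Variable Q : forall q (Uq : carrier U q) (L : stalk S q), hom (germ S Uq A) L -> Prop.
Arguments Q {q} Uq {L} _.
Hypothesis Qiso : forall q (Uq : carrier U q) (L M : stalk S q) (i : iso L M) l,
  @Q q Uq L l -> Q Uq (i ∘ l).
Hypothesis Qepi : forall q (Uq : carrier U q) (L : stalk S q) l, @Q q Uq L l -> is_epi l.
Hypothesis Qlift : forall q (Uq : carrier U q) (L M : stalk S q) l m,
  @Q q Uq L l -> @Q q Uq M m -> exists e : hom L M, e ∘ l = m.
Hypothesis Qloc : forall p, carrier U p -> exists c : local_cocone,
  carrier (lcc_dom c) p /\
  forall q (Wq : carrier (lcc_dom c) q) (Uq : carrier U q),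
    @Q q Uq (StalkObj Wq (lcc_obj c)) (sgerm (lcc_leg c) Wq Uq Wq).

Lemma cocone_glue : exists (K : S U) (k : hom A K),
  forall q (Uq : carrier U q), Q Uq (fmor (germ S Uq) k).
Proof.
pose I := {q | carrier U q}.
have [c cP] := choice (fun i : I => Qloc (svalP i)).
pose V i := lcc_dom (c i).
pose hVU i : V i `<=` U := @lcc_sub (c i).
have cov : U `<=` \bigcup_i V i.
  by move=> q Uq; exists (exist _ q Uq) => //; exact: (proj1 (cP (exist _ q Uq))).
pose E i j q (Vi : carrier (V i) q) (Vj : carrier (V j) q)
  (e : @hom (stalk S q) (StalkObj Vj (lcc_obj (c j))) (StalkObj Vi (lcc_obj (c i)))) :=
  forall Uq : carrier U q,
    e ∘ sgerm (lcc_leg (c j)) Vj Uq Vj = sgerm (lcc_leg (c i)) Vi Uq Vi.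
have Euniq i j q (Vi : carrier (V i) q) (Vj : carrier (V j) q) f g :
    E i j q Vi Vj f -> E i j q Vi Vj g -> f = g.
  move=> /(_ (hVU i q Vi)) f1 /(_ (hVU i q Vi)) g1.
  by apply: (Qepi (proj2 (cP j) q Vj (hVU i q Vi))); rewrite f1.
have Eid i q (Vi : carrier (V i) q) : E i i q Vi Vi (idm _).
  by move=> Uq; rewrite comp1m.
have Ecomp i j k q (Vi : carrier (V i) q) (Vj : carrier (V j) q)
    (Vk : carrier (V k) q) f g :
    E i j q Vi Vj f -> E j k q Vj Vk g -> E i k q Vi Vk (f ∘ g).
  by move=> fE gE Uq; rewrite -compmA gE fE.
have Eex i j q (Vi : carrier (V i) q) (Vj : carrier (V j) q) : exists e, E i j q Vi Vj e.
  have Uq := hVU i q Vi.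
  have [e e1] := Qlift (proj2 (cP j) q Vj Uq) (proj2 (cP i) q Vi Uq).
  by exists e => Uq'; rewrite (Prop_irrelevance Uq' Uq).
have Eloc i j p : carrier (V i) p -> carrier (V j) p ->
  exists (W : opens X) (kj : W `<=` V j) (ki : W `<=` V i)
    (u : hom (res S kj (lcc_obj (c j))) (res S ki (lcc_obj (c i)))), carrier W p /\
    forall q (Wq : carrier W q) (Vi : carrier (V i) q) (Vj : carrier (V j) q),
      E i j q Vi Vj (sgerm u Wq Vj Vi).
  move=> Vi Vj; have Up := hVU i p Vi.
  have [e /(_ Up) e1] := Eex i j p Vi Vj.
  have [R [li [lj [u [Rp _ _ uP]]]]] := colift_near e1.
  by exists R, lj, li, u; split=> // q Rq Viq Vjq Uq; exact: uP.
have [K [s sE]] := obj_glue SS hVU cov Euniq Eid Ecomp Eloc.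
have [k kE] : exists k : hom A K, forall q Uq i (Vi : carrier (V i) q),
     fmor (germ S Uq) k = sgerm (bwd (s i)) Vi Vi Uq ∘ sgerm (lcc_leg (c i)) Vi Uq Vi.
  apply: (hom_glue SS (P := fun q Uq f => forall i (Vi : carrier (V i) q),
     f = sgerm (bwd (s i)) Vi Vi Uq ∘ sgerm (lcc_leg (c i)) Vi Uq Vi)).
    move=> q Uq f g fP gP; have [i _ Vi] := cov q Uq.
    by rewrite (fP i Vi) (gP i Vi).
  move=> p Up; have [i _ Vi] := cov p Up.
  exists (V i), (hVU i), (bwd (s i) ∘ lcc_leg (c i)); split=> // q Viq Uq j Vj.
  have [e eE] := Eex j i q Vj Viq.
  rewrite (sgermM _ _ _ _ Viq) -(eE Uq).
  apply: (iso_mono (i := sgerm_iso (s j) Vj Uq Vj)).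
  rewrite bwd_compK -[fwd (sgerm_iso (s j) Vj Uq Vj)](sE _ _ _ _ _ _ _ eE) -compmA;
    congr (_ ∘ _).
  exact: (bwd_compK (sgerm_iso (s i) Viq Uq Viq)).
exists K, k => q Uq; have [i _ Vi] := cov q Uq.
rewrite (kE q Uq i Vi).
exact: (Qiso (iso_inv (sgerm_iso (s i) Vi Uq Vi)) (proj2 (cP i) q Vi Uq)).
Qed.

End CoconeGluing.

End Cones.

(** * Kernels and cokernels in a stack *)

Section KernelsOfStack.
Variables (X : topologicalType) (S : prestack X).
Hypothesis SS : is_stack S.
Variable ads : forall U : opens X, preadditive (S U).
Variable adp : forall p : X, preadditive (stalk S p).
Hypothesis gadd : forall (U : opens X) (p : X) (Up : carrier U p),
  additive_functor (ads U) (adp p) (germ S Up).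
Hypothesis zeroS : forall U : opens X, exists Z : S U, is_zero_obj Z.
Hypothesis zeroP : forall p : X, exists Z : stalk S p, is_zero_obj Z.
Hypothesis normal_mono : forall p (A B : stalk S p) (f : hom A B),
  is_mono f -> exists (E : stalk S p) (g : hom B E), is_kernel f g.
Hypothesis normal_epi : forall p (A B : stalk S p) (f : hom A B),
  is_epi f -> exists (E : stalk S p) (g : hom E A), is_cokernel g f.
Hypothesis local_ker : forall (U : opens X) (A B : S U) (f : hom A B) p,
  carrier U p -> exists (W : opens X) (hWU : W `<=` U) (K : S W)
    (k : hom (res S (fun _ => id) K) (res S hWU A)), carrier W p /\
    forall q (Wq : carrier W q) (Uq : carrier U q),
      is_kernel (sgerm k Wq Wq Uq) (fmor (germ S Uq) f).
Hypothesis local_coker : forall (U : opens X) (A B : S U) (f : hom A B) p,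
  carrier U p -> exists (W : opens X) (hWU : W `<=` U) (K : S W)
    (c : hom (res S hWU B) (res S (fun _ => id) K)), carrier W p /\
    forall q (Wq : carrier W q) (Uq : carrier U q),
      is_cokernel (fmor (germ S Uq) f) (sgerm c Wq Uq Wq).

Definition stalk_kernel (U : opens X) (K A B : S U) (k : hom K A) (f : hom A B) : Prop :=
  forall q (Uq : carrier U q), is_kernel (fmor (germ S Uq) k) (fmor (germ S Uq) f).

Definition stalk_cokernel (U : opens X) (A B K : S U) (f : hom A B)
    (c : hom B K) : Prop :=
  forall q (Uq : carrier U q), is_cokernel (fmor (germ S Uq) f) (fmor (germ S Uq) c).

Lemma germ0 (U : opens X) (A B : S U) q (Uq : carrier U q) :
  fmor (germ S Uq) (zerom (ads U) A B) = zerom (adp q) _ _.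
Proof. exact: (additive_functor0 (gadd Uq)). Qed.

(** Factorizations exist and are unique on germs, hence glue. *)
Lemma stalk_kernel_is_kernel (U : opens X) (K A B : S U) (k : hom K A) (f : hom A B) :
  stalk_kernel k f -> is_kernel k f.
Proof.
move=> kf; have kfq q Uq := proj1 (kernelP (adp q) (zeroP q) _ _) (kf q Uq).
apply/(kernelP (ads U) (zeroS U)); split.
  by apply: (hom_sep SS) => q Uq; rewrite fmorM (proj1 (kfq q Uq)) germ0.
move=> T g fg0.
have [|q Uq|u [uE _]] := @joint_lift _ _ SS U T K A A k k g g.
- by move=> q Uq e e' h _; exact: (kernel_mono (kf q Uq)).
- have [|e [eE _]] := proj2 (kfq q Uq) _ (fmor (germ S Uq) g).
    by rewrite -fmorM fg0 germ0.
  by exists e.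
exists u; split=> // v vE; apply: (hom_sep SS) => q Uq.
by apply: (kernel_mono (kf q Uq)); rewrite -!fmorM uE vE.
Qed.

Lemma stalk_cokernel_is_cokernel (U : opens X) (A B K : S U) (f : hom A B) (c : hom B K) :
  stalk_cokernel f c -> is_cokernel f c.
Proof.
move=> cf; have cfq q Uq := proj1 (cokernelP (adp q) (zeroP q) _ _) (cf q Uq).
apply/(cokernelP (ads U) (zeroS U)); split.
  by apply: (hom_sep SS) => q Uq; rewrite fmorM (proj1 (cfq q Uq)) germ0.
move=> T g gf0.
have [|q Uq|u uE] := @colift _ _ SS U T K B c g.
- by move=> q Uq; exact: (cokernel_epi (cf q Uq)).
- have [|e [eE _]] := proj2 (cfq q Uq) _ (fmor (germ S Uq) g).
    by rewrite -fmorM gf0 germ0.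
  by exists e.
exists u; split=> // v vE; apply: (hom_sep SS) => q Uq.
by apply: (cokernel_epi (cf q Uq)); rewrite -!fmorM uE vE.
Qed.

Lemma stalk_kernel_exists (U : opens X) (A B : S U) (f : hom A B) :
  exists (K : S U) (k : hom K A), stalk_kernel k f.
Proof.
have [|||p Up|K [k [k' kP]]] := @cone_glue _ _ SS U A A
  (fun q Uq L l l' => is_kernel l (fmor (germ S Uq) f) /\ l' = l).
- move=> q Uq L M i l l' [lf ->]; split=> //.
  apply: (is_kernel_iso (a := iso_id _) (b := iso_id _) (c := iso_inv i) _ _ lf).
    by rewrite compm1 comp1m.
  by rewrite /= compm_bwdK comp1m.
- by move=> q Uq L M l l' e e' [lf _] h _; exact: (kernel_mono lf).
- move=> q Uq L M l l' m m' [[lf0 lu] ->] [[mf0 _] ->].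
  by have [e [eE _]] := lu M m mf0; exists e.
- have [W [hWU [K [k [Wp kP]]]]] := local_ker f Up.
  by exists (LocalCone k k); split=> // q Wq Uq; split=> //; exact: kP.
by exists K, k => q Uq; case: (kP q Uq).
Qed.

Lemma stalk_cokernel_exists (U : opens X) (A B : S U) (f : hom A B) :
  exists (K : S U) (c : hom B K), stalk_cokernel f c.
Proof.
have [|||p Up|K [c cP]] := @cocone_glue _ _ SS U B
  (fun q Uq L l => is_cokernel (fmor (germ S Uq) f) l).
- move=> q Uq L M i l lf.
  apply: (is_cokernel_iso (a := iso_id _) (b := iso_id _) (c := i) _ _ lf).
    by rewrite compm1 comp1m.
  by rewrite compm1.
- by move=> q Uq L l lf; exact: (cokernel_epi lf).
- move=> q Uq L M l m [lf0 lu] [mf0 _].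
  by have [e [eE _]] := lu M m mf0; exists e.
- have [W [hWU [K [k [Wp kP]]]]] := local_coker f Up.
  by exists (LocalCocone k); split=> // q Wq Uq; exact: kP.
by exists K, c.
Qed.

(** One kernel of f is a kernel on germs, and all kernels of f are isomorphic. *)
Lemma kernel_is_stalk_kernel (U : opens X) (K A B : S U) (k : hom K A) (f : hom A B) :
  is_kernel k f -> stalk_kernel k f.
Proof.
move=> kf; have [K' [k' k'f]] := stalk_kernel_exists f.
have k'f' := stalk_kernel_is_kernel k'f.
have [u [uE _]] := proj2 kf _ _ (proj1 k'f').
have [v [vE _]] := proj2 k'f' _ _ (proj1 kf).
have vu : v ∘ u = idm _ by apply: (kernel_mono k'f'); rewrite compmA vE uE compm1.
have uv : u ∘ v = idm _ by apply: (kernel_mono kf); rewrite compmA uE vE compm1.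
move=> q Uq.
apply: (is_kernel_iso (a := iso_id _) (b := iso_id _)
  (c := fmor_iso (germ S Uq) (Iso vu uv))
  _ _ (k'f q Uq)); first by rewrite compm1 comp1m.
by rewrite comp1m -[fwd _]/(fmor (germ S Uq) u) -fmorM uE.
Qed.

Lemma cokernel_is_stalk_cokernel (U : opens X) (A B K : S U) (f : hom A B) (c : hom B K) :
  is_cokernel f c -> stalk_cokernel f c.
Proof.
move=> cf; have [K' [c' c'f]] := stalk_cokernel_exists f.
have c'f' := stalk_cokernel_is_cokernel c'f.
have [u [uE _]] := proj2 c'f' _ _ (proj1 cf).
have [v [vE _]] := proj2 cf _ _ (proj1 c'f').
have vu : v ∘ u = idm _ by apply: (cokernel_epi c'f'); rewrite -compmA uE vE comp1m.
have uv : u ∘ v = idm _ by apply: (cokernel_epi cf); rewrite -compmA vE uE comp1m.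
move=> q Uq.
apply: (is_cokernel_iso (a := iso_id _) (b := iso_id _)
  (c := fmor_iso (germ S Uq) (Iso vu uv))
  _ _ (c'f q Uq)); first by rewrite compm1 comp1m.
by rewrite compm1 -[fwd _]/(fmor (germ S Uq) u) -fmorM uE.
Qed.

(** Test objects of a stalk need not extend to U, so f is not seen directly to
    be a monomorphism on germs; but its kernel vanishes, and this passes to
    germs. There f is the kernel of its cokernel. *)
Lemma stack_normal_mono (U : opens X) (A B : S U) (f : hom A B) :
  is_mono f -> exists (D : S U) (g : hom B D), is_kernel f g.
Proof.
move=> fm; have [K [k kf]] := stalk_kernel_exists f.
have [D [c cf]] := stalk_cokernel_exists f.
exists D, c; apply: stalk_kernel_is_kernel => q Uq.
have k0 := proj2 (kernel0_mono (ads U) (zeroS U) (stalk_kernel_is_kernel kf)) fm.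
have fqm : is_mono (fmor (germ S Uq) f).
  by apply/(kernel0_mono (adp q) (zeroP q) (kf q Uq)); rewrite k0 germ0.
have [E [g gf]] := normal_mono fqm.
exact: normal_mono_coker gf (cf q Uq).
Qed.

Lemma stack_normal_epi (U : opens X) (A B : S U) (f : hom A B) :
  is_epi f -> exists (D : S U) (g : hom D A), is_cokernel g f.
Proof.
move=> fm; have [D [k kf]] := stalk_kernel_exists f.
have [K [c cf]] := stalk_cokernel_exists f.
exists D, k; apply: stalk_cokernel_is_cokernel => q Uq.
have c0 := proj2 (cokernel0_epi (ads U) (zeroS U) (stalk_cokernel_is_cokernel cf)) fm.
have fqe : is_epi (fmor (germ S Uq) f).
  by apply/(cokernel0_epi (adp q) (zeroP q) (cf q Uq)); rewrite c0 germ0.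
have [E [g gf]] := normal_epi fqe.
exact: normal_epi_ker gf (kf q Uq).
Qed.

(** Kernels and cokernels are detected on germs, which restriction does not
    change. *)
Lemma res_exact (U V : opens X) (hVU : V `<=` U) : is_exact (res S hVU).
Proof.
split=> [K A B k f /kernel_is_stalk_kernel kf|A B K f c /cokernel_is_stalk_cokernel cf].
  apply: stalk_kernel_is_kernel => q Vq; have Uq := hVU q Vq.
  apply: (is_kernel_iso (a := iso_inv (rho hVU A Vq Uq)) (b := iso_inv (rho hVU B Vq Uq))
    (c := iso_inv (rho hVU K Vq Uq)) _ _ (kf q Uq)).
    apply: (iso_mono (i := rho hVU B Vq Uq)).
    by rewrite compmA rho_fmor compm_bwdK bwd_compK.
  apply: (iso_mono (i := rho hVU A Vq Uq)).
  by rewrite compmA rho_fmor compm_bwdK bwd_compK.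
apply: stalk_cokernel_is_cokernel => q Vq; have Uq := hVU q Vq.
apply: (is_cokernel_iso (a := iso_inv (rho hVU A Vq Uq)) (b := iso_inv (rho hVU B Vq Uq))
  (c := iso_inv (rho hVU K Vq Uq)) _ _ (cf q Uq)).
  apply: (iso_mono (i := rho hVU B Vq Uq)).
  by rewrite compmA rho_fmor compm_bwdK bwd_compK.
apply: (iso_mono (i := rho hVU K Vq Uq)).
by rewrite bwd_compK compmA rho_fmor compm_bwdK.
Qed.

End KernelsOfStack.

(** * Biproducts *)

Section Biproducts.
Variables (C : category) (ad : preadditive C).

Lemma biproduct_iso (A A' B B' P P' : C) (a : iso A A') (b : iso B B') (c : iso P' P)
    (i : hom A P) (j : hom B P) (p : hom P A) (q : hom P B) :
  is_biproduct ad i j p q ->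
  is_biproduct ad (bwd c ∘ i ∘ bwd a) (bwd c ∘ j ∘ bwd b) (a ∘ p ∘ c) (b ∘ q ∘ c).
Proof.
move=> [pi qj qi pj e]; split.
- by rewrite !compmA compm_bwdK -(compmA _ p) pi compm1 bwdK.
- by rewrite !compmA compm_bwdK -(compmA _ q) qj compm1 bwdK.
- by rewrite !compmA compm_bwdK -(compmA _ q) qi compm0 comp0m.
- by rewrite !compmA compm_bwdK -(compmA _ p) pj compm0 comp0m.
rewrite !compmA !compm_fwdK -compmDl -!(compmA (bwd c)) -compmDr.
by rewrite e compm1 fwdK.
Qed.

Lemma biproduct_joint_mono (A B P T : C) (i : hom A P) (j : hom B P) (p : hom P A)
    (q : hom P B) (e e' : hom T P) :
  is_biproduct ad i j p q -> p ∘ e = p ∘ e' -> q ∘ e = q ∘ e' -> e = e'.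
Proof.
move=> [_ _ _ _ E] pe qe; rewrite -[e]comp1m -[e']comp1m -E !compmDl.
by rewrite -!compmA pe qe.
Qed.

Lemma biproduct_lift (A B P T : C) (i : hom A P) (j : hom B P) (p : hom P A)
    (q : hom P B) (f : hom T A) (g : hom T B) :
  is_biproduct ad i j p q -> exists e : hom T P, p ∘ e = f /\ q ∘ e = g.
Proof.
move=> [pi qj qi pj E]; exists (addm ad (i ∘ f) (j ∘ g)).
by rewrite !compmDr !compmA pi pj qi qj !comp1m !comp0m add0m addm0.
Qed.

Lemma additive_biproduct (D : category) (adD : preadditive D) (F : functor C D)
  (A B P : C) (i : hom A P) (j : hom B P) (p : hom P A) (q : hom P B) :
  additive_functor ad adD F -> is_biproduct ad i j p q ->
  is_biproduct adD (fmor F i) (fmor F j) (fmor F p) (fmor F q).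
Proof.
move=> Fa [pi qj qi pj E]; split; rewrite -?fmorM ?pi ?qj ?qi ?pj ?fmor1 //.
- exact: additive_functor0.
- exact: additive_functor0.
by rewrite -Fa E fmor1.
Qed.

End Biproducts.

Section BiproductsOfStack.
Variables (X : topologicalType) (S : prestack X).
Hypothesis SS : is_stack S.
Variable ads : forall U : opens X, preadditive (S U).
Variable adp : forall p : X, preadditive (stalk S p).
Hypothesis local_biproduct : forall (U : opens X) (A B : S U) p,
  carrier U p -> exists (W : opens X) (hWU : W `<=` U) (P : S W)
    (k : hom (res S (fun _ => id) P) (res S hWU A))
    (l : hom (res S (fun _ => id) P) (res S hWU B)), carrier W p /\
    forall q (Wq : carrier W q) (Uq : carrier U q), exists i j,
      is_biproduct (adp q) i j (sgerm k Wq Wq Uq) (sgerm l Wq Wq Uq).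

Lemma stack_biproduct (U : opens X) (A B : S U) :
  exists (P : S U) (i : hom A P) (j : hom B P) (p : hom P A) (q : hom P B),
    is_biproduct (ads U) i j p q.
Proof.
have [|||p Up|P [k [l kl]]] := @cone_glue _ _ SS U A B
  (fun q Uq L l l' => exists i j, is_biproduct (adp q) i j l l').
- move=> q Uq L M i l l' [i' [j' /(biproduct_iso (iso_id _) (iso_id _) i)]].
  by rewrite !comp1m => h; eexists; eexists; exact: h.
- by move=> q Uq L M l l' e e' [i [j h]]; exact: (biproduct_joint_mono h).
- by move=> q Uq L M l l' m m' [i [j h]] _; exact: (biproduct_lift m m' h).
- have [W [hWU [P [k [l [Wp kl]]]]]] := local_biproduct A B Up.
  by exists (LocalCone k l).
have lift (T : S U) (g : hom T A) (g' : hom T B) :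
    exists e : hom T P, k ∘ e = g /\ l ∘ e = g'.
  apply: (joint_lift SS) => q Uq; have [i [j h]] := kl q Uq.
    by move=> e e'; exact: (biproduct_joint_mono h).
  exact: (biproduct_lift _ _ h).
have [i [ki li]] := lift A (idm A) (zerom (ads U) A B).
have [j [kj lj]] := lift B (zerom (ads U) B A) (idm B).
exists P, i, j, k, l; split=> //.
apply: (hom_sep SS) => q Uq; have [i' [j' h]] := kl q Uq.
apply: (biproduct_joint_mono h); rewrite -!fmorM; congr (fmor _ _).
  by rewrite compmDr !compmA ki kj comp1m comp0m addm0 compm1.
by rewrite compmDr !compmA li lj comp1m comp0m add0m compm1.
Qed.

End BiproductsOfStack.

(** * From the prestack to its associated stack *)

(** The two equations between an isomorphism of germs and its inverse spread
    out. *)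
Lemma iso_near (X : topologicalType) (S : prestack X) (p : X) (U V : opens X)
    (A : S U) (B : S V) (Up : carrier U p) (Vp : carrier V p)
    (i : @iso (stalk S p) (StalkObj Up A) (StalkObj Vp B)) :
  exists (W : opens X) (Wp : carrier W p) (hU : W `<=` U) (hV : W `<=` V)
    (phi : iso (res S hU A) (res S hV B)), fwd i = sgerm phi Wp Up Vp.
Proof.
have [W [Wp [hU [hV [u uE]]]]] := sgermP (fwd i).
have [W' [W'p [hV' [hU' [v vE]]]]] := sgermP (bwd i).
have s1 : opensI W W' `<=` W by exact: opensIl.
have s2 : opensI W W' `<=` W' by exact: opensIr.
have Ip : carrier (opensI W W') p by split.
have kU := subset_trans s1 hU; have kV := subset_trans s1 hV.
have e1 : sgerm (mres s2 kV kU v ∘ mres s1 kU kV u) Ip Up Up = sgerm (idm (res S kU A)) Ip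
  Up Up.
  by rewrite (sgermM _ _ _ _ Vp) !sgerm_mres -uE -vE fwdK sgerm1.
have e2 : sgerm (mres s1 kU kV u ∘ mres s2 kV kU v) Ip Vp Vp = sgerm (idm (res S kV B)) Ip
  Vp Vp.
  by rewrite (sgermM _ _ _ _ Up) !sgerm_mres -uE -vE bwdK sgerm1.
have /sgerm_eqP [T [hT [hT' [lU [lU' [Tp {}e1]]]]]] := e1.
have /sgerm_eqP [R [hR [hR' [lV [lV' [Rp {}e2]]]]]] := e2.
have ? : lU' = lU by exact: Prop_irrelevance.
have ? : lV' = lV by exact: Prop_irrelevance.
subst lU' lV'.
have t1 : opensI T R `<=` T by exact: opensIl.
have t2 : opensI T R `<=` R by exact: opensIr.
have t := subset_trans t1 hT.
have mU := subset_trans t kU; have mV := subset_trans t kV.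
have f1 : mres t mV mU (mres s2 kV kU v) ∘ mres t mU mV (mres s1 kU kV u) = idm _.
  by rewrite -mresM -(mres_mres hT lU lU t1) e1 (mres_mres _ _ _ _ t) mres1.
have f2 : mres t mU mV (mres s1 kU kV u) ∘ mres t mV mU (mres s2 kV kU v) = idm _.
  by rewrite -mresM -(mres_mres hR lV lV t2) e2 (mres_mres _ _ _ _ t) mres1.
exists (opensI T R), (conj Tp Rp), mU, mV, (Iso f1 f2) => /=.
by rewrite (sgerm_mres t _ _ _ _ Ip) sgerm_mres.
Qed.

Section Transfer.
Variables (X : topologicalType) (C S : prestack X) (eta : prestack_functor C S).
Hypothesis SS : is_stack S.
Hypothesis Finj : forall (p : X) (L M : stalk C p) (f g : hom L M),
  fmor (stalkf eta p) f = fmor (stalkf eta p) g -> f = g.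
Hypothesis Ffull : forall (p : X) (L M : stalk C p)
  (f : hom (stalkf eta p L) (stalkf eta p M)), exists g, f = fmor (stalkf eta p) g.
Hypothesis Fess : forall (p : X) (M : stalk S p),
  exists (L : stalk C p) (i : iso (stalkf eta p L) M), True.
Variable ad : forall U : opens X, preadditive (C U).
Hypothesis adres : forall (U V : opens X) (hVU : V `<=` U),
  additive_functor (ad U) (ad V) (res C hVU).
Hypothesis adC : forall U, additive_structure (ad U).

Let adp := germ_preadditive Finj Ffull Fess adres.
Let ads := stack_preadditive SS Finj Ffull Fess adres.
Let Fad := stalkf_additive Finj Ffull Fess adres.
Let gadd := germ_stack_additive SS Finj Ffull Fess adres.
Let etaadd := eta_additive SS Finj Ffull Fess adres.

Lemma stalk_zero (p : X) : exists Z : stalk C p, is_zero_obj Z.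
Proof.
exact: (stalk_zero_obj adres (U := Opens (@openT X)) Logic.I (proj1 (adC _))).
Qed.

Lemma stalk_zero_stack (p : X) : exists Z : stalk S p, is_zero_obj Z.
Proof. exact: (equiv_zero_obj (@Fad p) (stalk_zero p)). Qed.

Lemma zero_obj_stack (U : opens X) : exists Z : S U, is_zero_obj Z.
Proof.
have [[Z Z0] _] := adC U; exists (eta U Z).
exact: (additive_functor_zero_obj (@etaadd U)).
Qed.

Lemma local_image (U : opens X) (A : S U) p : carrier U p ->
  exists (W : opens X) (hWU : W `<=` U) (A1 : C W) (phi : iso (eta W A1) (res S hWU A)),
    carrier W p.
Proof.
move=> Up; have [[V Vp A1] [i _]] := Fess (StalkObj Up A : stalk S p).
have [W [Wp [hV [hU [phi _]]]]] := iso_near (A := eta V A1) (Up := Vp) i.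
by exists W, hU, (res C hV A1), (iso_comp phi (pres eta hV A1)).
Qed.

Lemma local_stalk_biproduct (U : opens X) (A B : S U) p :
  carrier U p -> exists (W : opens X) (hWU : W `<=` U) (P : S W)
    (k : hom (res S (fun _ => id) P) (res S hWU A))
    (l : hom (res S (fun _ => id) P) (res S hWU B)), carrier W p /\
    forall q (Wq : carrier W q) (Uq : carrier U q), exists i j,
      is_biproduct (adp q) i j (sgerm k Wq Wq Uq) (sgerm l Wq Wq Uq).
Proof.
move=> Up.
have [W1 [h1 [A1 [phi W1p]]]] := local_image A Up.
have [W2 [h2 [B1 [psi W2p]]]] := local_image (res S h1 B) W1p.
have h := subset_trans h2 h1.
have [P [i [j [k [l bip]]]]] := proj2 (adC W2) (res C h2 A1) B1.
pose a : iso (eta W2 (res C h2 A1)) (res S h A) :=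
  iso_comp (resC S h1 h2 h A) (iso_comp (fmor_iso (res S h2) phi) (pres eta h2 A1)).
pose b : iso (eta W2 B1) (res S h B) := iso_comp (resC S h1 h2 h B) psi.
(* A morphism to a restriction of D, read as a section with values in D. *)
have legE (D : S U) (E : C W2) (m : hom P E) (c : iso (eta W2 E) (res S h D)) q
    (Wq : carrier W2 q) (Uq : carrier U q) :
  sgerm (c ∘ fmor (eta W2) m ∘ res1 S (fun _ => id) (eta W2 P)) Wq Wq Uq
  = rho h D Wq Uq ∘ fmor_iso (germ S Wq) c ∘ fmor (germ S Wq) (fmor (eta W2) m).
  rewrite -[fwd (fmor_iso _ c)]/(fmor (germ S Wq) c).
  by rewrite -(compmA (fwd (rho _ _ _ _))) -fmorM germE rhoE -sgermM res1_nat.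
exists W2, h, (eta W2 P), (a ∘ fmor (eta W2) k ∘ res1 S (fun _ => id) (eta W2 P)),
  (b ∘ fmor (eta W2) l ∘ res1 S (fun _ => id) (eta W2 P)); split=> // q Wq Uq.
have := additive_biproduct (@gadd W2 q Wq) (additive_biproduct (@etaadd W2) bip).
move=> /(biproduct_iso (iso_comp (rho h A Wq Uq) (fmor_iso (germ S Wq) a))
  (iso_comp (rho h B Wq Uq) (fmor_iso (germ S Wq) b)) (iso_id _)).
rewrite !legE => hb; eexists; eexists; move: hb; rewrite !compm1; exact.
Qed.

Hypothesis Cker : forall (p : X) (A B : stalk C p) (f : hom A B),
    exists (U : opens X) (pU : carrier U p) (A' B' : C U) (f' : hom A' B'),
      represents pU f' f /\
      exists (K K' : C U) (k : hom K A') (c : hom B' K'),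
        forall (q : X) (qU : carrier U q),
          is_kernel (fmor (germ C qU) k) (fmor (germ C qU) f') /\
          is_cokernel (fmor (germ C qU) f') (fmor (germ C qU) c).

(** As eta is an equivalence on stalks, the germ of f at p is one of C, which the
    hypothesis represents by a morphism with a kernel and a cokernel on germs
    at all nearby points. The identification with f, known at p, spreads out. *)
Lemma local_representation (U : opens X) (A B : S U) (f : hom A B) p (Up : carrier U p) :
  exists (V : opens X) (A' B' K K' : C V) (f' : hom A' B') (k : hom K A') (c : hom B' K')
    (W : opens X) (hV : W `<=` V) (hU : W `<=` U)
    (a : iso (res S hV (eta V A')) (res S hU A))
      (b : iso (res S hV (eta V B')) (res S hU B)),
  carrier W p /\ forall q (Wq : carrier W q) (Vq : carrier V q) (Uq : carrier U q),
    [/\ fmor (germ S Uq) f ∘ sgerm a Wq Vq Uq = sgerm b Wq Vq Uq ∘ fmor (germ S Vq)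
      (fmor (eta V) f'),
        is_kernel (fmor (germ S Vq) (fmor (eta V) k)) (fmor (germ S Vq) (fmor (eta V) f'))
          &
        is_cokernel (fmor (germ S Vq) (fmor (eta V) f'))
          (fmor (germ S Vq) (fmor (eta V) c))].
Proof.
have [L [i _]] := Fess (germ S Up A); have [M [j _]] := Fess (germ S Up B).
have [f0 f0E] := Ffull (bwd j ∘ fmor (germ S Up) f ∘ i).
have [V [Vp [A' [B' [f' [[a0 [b0 ab]] [K [K' [k [c kc]]]]]]]]]] := Cker f0.
have Fab : fmor (stalkf eta p) f0 ∘ fmor (stalkf eta p) a0
    = fmor (stalkf eta p) b0 ∘ fmor (stalkf eta p) (fmor (germ C Vp) f').
  by rewrite -!fmorM ab.
have [W1 [W1p [hV1 [hU1 [a aE]]]]] :=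
  iso_near (A := eta V A') (Up := Vp) (iso_comp i (fmor_iso (stalkf eta p) a0)).
have [W2 [W2p [hV2 [hU2 [b bE]]]]] :=
  iso_near (A := eta V B') (Up := Vp) (iso_comp j (fmor_iso (stalkf eta p) b0)).
have s1 : opensI W1 W2 `<=` W1 by exact: opensIl.
have s2 : opensI W1 W2 `<=` W2 by exact: opensIr.
have Ip : carrier (opensI W1 W2) p by split.
have kV := subset_trans s1 hV1; have kU := subset_trans s1 hU1.
have e : sgerm (fmor (res S kU) f ∘ mres s1 kV kU a) Ip Vp Up
    = sgerm (mres s2 kV kU b ∘ fmor (res S kV) (fmor (eta V) f')) Ip Vp Up.
  rewrite (sgermM _ _ _ _ Up) (sgermM _ _ _ _ Vp) !sgerm_fmor !sgerm_mres -aE -bE.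
  rewrite -stalkf_germ.
  apply: (iso_mono (i := iso_inv j)); rewrite /= !compmA f0E fwdK comp1m.
  exact: Fab.
have [T [Tp TI _ eT]] := sgerm_near e.
exists V, A', B', K, K', f', k, c, T, (subset_trans TI kV), (subset_trans TI kU),
  (mres_iso TI _ _ (mres_iso s1 kV kU a)), (mres_iso TI _ _ (mres_iso s2 kV kU b)).
split=> // q Tq Vq Uq; have Iq := TI q Tq; split.
- rewrite !(sgerm_mres TI _ _ _ Tq Iq) -(sgerm_fmor kU f Iq) -(sgerm_fmor kV _ Iq)
    -!sgermM.
  exact: eT.
- rewrite -!stalkf_germ.
  exact: (equiv_kernel (@Finj q) (@Ffull q) (@Fess q) (@Fad q) (stalk_zero q)
    (proj1 (kc q Vq))).
rewrite -!stalkf_germ.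
exact: (equiv_cokernel (@Finj q) (@Ffull q) (@Fess q) (@Fad q) (stalk_zero q)
  (proj2 (kc q Vq))).
Qed.

Lemma local_stalk_kernel (U : opens X) (A B : S U) (f : hom A B) p :
  carrier U p -> exists (W : opens X) (hWU : W `<=` U) (K : S W)
    (k : hom (res S (fun _ => id) K) (res S hWU A)), carrier W p /\
    forall q (Wq : carrier W q) (Uq : carrier U q),
      is_kernel (sgerm k Wq Wq Uq) (fmor (germ S Uq) f).
Proof.
move=> Up.
have [V [A' [B' [K [K' [f' [k [c [W [hV [hU [a [b [Wp ab]]]]]]]]]]]]]] :=
  local_representation f Up.
exists W, hU, (res S hV (eta V K)),
  (a ∘ fmor (res S hV) (fmor (eta V) k) ∘ res1 S (fun _ => id) _).
split=> // q Wq Uq; have Vq := hV q Wq; have [e ker _] := ab q Wq Vq Uq.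
apply: (is_kernel_iso (a := sgerm_iso a Wq Vq Uq) (b := sgerm_iso b Wq Vq Uq)
  (c := iso_inv (rho hV (eta V K) Wq Vq)) e _ ker).
rewrite (sgermM _ _ _ _ Vq) (sgermM _ _ _ _ Vq) sgerm_fmor -rhoE.
exact: compm_bwdK.
Qed.

Lemma local_stalk_cokernel (U : opens X) (A B : S U) (f : hom A B) p :
  carrier U p -> exists (W : opens X) (hWU : W `<=` U) (K : S W)
    (c : hom (res S hWU B) (res S (fun _ => id) K)), carrier W p /\
    forall q (Wq : carrier W q) (Uq : carrier U q),
      is_cokernel (fmor (germ S Uq) f) (sgerm c Wq Uq Wq).
Proof.
move=> Up.
have [V [A' [B' [K [K' [f' [k [c [W [hV [hU [a [b [Wp ab]]]]]]]]]]]]]] :=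
  local_representation f Up.
exists W, hU, (res S hV (eta V K')),
  (bwd (res1 S (fun _ => id) _) ∘ fmor (res S hV) (fmor (eta V) c) ∘ bwd b).
split=> // q Wq Uq; have Vq := hV q Wq; have [e _ coker] := ab q Wq Vq Uq.
apply: (is_cokernel_iso (a := sgerm_iso a Wq Vq Uq) (b := sgerm_iso b Wq Vq Uq)
  (c := iso_inv (rho hV (eta V K') Wq Vq)) e _ coker).
rewrite (sgermM _ _ _ _ Vq) (sgermM _ _ _ _ Vq) sgerm_fmor.
by rewrite -[sgerm (bwd b) Wq Uq Vq]/(bwd (sgerm_iso b Wq Vq Uq)) compm_fwdK.
Qed.

Lemma transfer_abelian (Cstalks : forall p : X, is_abelian (stalk C p)) :
  is_abelian_prestack S.
Proof.
have nm p := equiv_normal_mono (@Finj p) (@Ffull p) (@Fess p) (@Fad p) (stalk_zero p)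
  (let: And5 _ _ _ h _ := Cstalks p in h).
have ne p := equiv_normal_epi (@Finj p) (@Ffull p) (@Fess p) (@Fad p) (stalk_zero p)
  (let: And5 _ _ _ _ h := Cstalks p in h).
have adS U : additive_structure (ads U).
  split; first exact: zero_obj_stack.
  move=> A B; exact: (stack_biproduct SS _ (@local_stalk_biproduct)).
split.
- by exists ads; split=> // U V hVU; exact: res_additive.
- move=> U; split.
  + by exists (ads U).
  + move=> A B f; have [K [k kf]] := stalk_kernel_exists SS (@local_stalk_kernel) f.
    by exists K, k; exact: (stalk_kernel_is_kernel SS (@gadd) zero_obj_stack
      stalk_zero_stack kf).
  + move=> A B f; have [K [c cf]] := stalk_cokernel_exists SS (@local_stalk_cokernel) f.
    by exists K, c; exact: (stalk_cokernel_is_cokernel SS (@gadd) zero_obj_stack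
      stalk_zero_stack cf).
  + by move=> A B f; exact: (stack_normal_mono SS (@gadd) zero_obj_stack stalk_zero_stack
      nm (@local_stalk_kernel) (@local_stalk_cokernel)).
  + by move=> A B f; exact: (stack_normal_epi SS (@gadd) zero_obj_stack stalk_zero_stack
      ne (@local_stalk_kernel) (@local_stalk_cokernel)).
move=> U V hVU.
exact: (res_exact SS (@gadd) zero_obj_stack stalk_zero_stack (@local_stalk_kernel)
  (@local_stalk_cokernel)).
Qed.

End Transfer.

Theorem theorem2p3p1 (X : topologicalType) (C : prestack X)
  (Cadd : is_additive_prestack C)
  (Cstalks : forall p : X, is_abelian (stalk C p))
  (Cker : forall (p : X) (A B : stalk C p) (f : hom A B),
    exists (U : opens X) (pU : carrier U p) (A' B' : C U) (f' : hom A' B'),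
      represents pU f' f /\
      exists (K K' : C U) (k : hom K A') (c : hom B' K'),
        forall (q : X) (qU : carrier U q),
          is_kernel (fmor (germ C qU) k) (fmor (germ C qU) f') /\
          is_cokernel (fmor (germ C qU) f') (fmor (germ C qU) c))
  (S : prestack X) (eta : prestack_functor C S)
  (Sass : is_associated_stack eta) :
  is_abelian_stack S.
Proof.
split; first exact: (proj1 Sass).
have [ad [adC adres]] := Cadd.
pose z p : stalk C p := sval (cid (stalk_zero adres adC p)).
exact: (transfer_abelian (proj1 Sass) (stalkf_eta_inj z Sass) (stalkf_eta_full Sass)
  (stalkf_eta_esssurj Sass) adres adC Cker Cstalks).
Qed.
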